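(* Let $\Gamma$ be a group and let $G:=L\Gamma\rtimes V$ be the associated untwisted fraction group. The formula $$(\varphi,\beta)\cdot(\zeta,f):=\bigl(\beta(\zeta)^{k_\varphi},\ \overline\beta(f)^{\varphi}\cdot\beta(\zeta)^{\gamma_\varphi}\bigr),$$ for $\varphi\in N_{H(\mathfrak C)}(V)$, $\beta\in\mathrm{Aut}(\Gamma)$, $\zeta\in Z(\Gamma)$, $f\in N_{\overline K}(G)/Z(\Gamma)$, defines an action by automorphisms of $N_{H(\mathfrak C)}(V)\times\mathrm{Aut}(\Gamma)$ on $Z(\Gamma)\times N_{\overline K}(G)/Z(\Gamma)$. Let $(Z(\Gamma)\times N_{\overline K}(G)/Z(\Gamma))\rtimes(N_{H(\mathfrak C)}(V)\times\mathrm{Aut}(\Gamma))$ be the semidirect product constructed from this action. The map $$\Xi:(Z(\Gamma)\times N_{\overline K}(G)/Z(\Gamma))\rtimes(N_{H(\mathfrak C)}(V)\times\mathrm{Aut}(\Gamma))\to\mathrm{Aut}(G),\quad(\zeta,f,\varphi,\beta)\mapsto F_\zeta\circ\mathrm{ad}(f)\circ A_{\varphi,\beta}$$ is a surjective group morphism with kernel $$\ker(\Xi)=\{(e_{Z(\Gamma)},\overline g,\mathrm{id},\mathrm{ad}(g^{-1})):\ g\in\Gamma\},$$ where $\overline g$ is the class in $N_{\overline K}(G)/Z(\Gamma)$ of the constant map equal to $g$ everywhere, and $\mathrm{ad}(g^{-1})\in\mathrm{Aut}(\Gamma)$ is the inner automorphism $h\mapsto g^{-1}hg$.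
   Context: Let $\mathfrak C=\{0,1\}^{\mathbf N}$ be the Cantor space. A standard dyadic interval (sdi) is a set $I=\{m_I\cdot y:y\in\mathfrak C\}$ of sequences with a given finite prefix $m_I$; a standard dyadic partition (sdp) is a finite partition of $\mathfrak C$ into sdi. Thompson's group $V$ is the group of homeomorphisms $v$ of $\mathfrak C$ for which there are two sdp $(I_k)_{k=1}^n,(J_k)_{k=1}^n$ with $v(m_{I_k}\cdot x)=m_{J_k}\cdot x$ for all $k,x$. If $v(m\cdot z)=w\cdot z$ for all $z\in\mathfrak C$ and $x\in\mathfrak C$ has prefix $m$, then the slope of $v$ at $x$ is $v'(x)=2^{|m|-|w|}$ ($|\cdot|$ = number of letters). $\mathbf Q_2\subset\mathfrak C$ is the set of sequences with finitely many $1$'s (a dense $V$-orbit, identified with the dyadic rationals of $[0,1)$); $0\in\mathbf Q_2$ is the zero sequence. $N_{H(\mathfrak C)}(V)=\{\varphi\in\mathrm{Homeo}(\mathfrak C):\varphi V\varphi^{-1}=V\}$ and $\mathrm{ad}_\varphi(v)=\varphi v\varphi^{-1}$. $L\Gamma$ is the group (pointwise product) of locally constant maps $a:\mathfrak C\to\Gamma$ (constant on each piece of some sdp). $G=L\Gamma\rtimes V$ is formed with the untwisted action $(v\cdot a)(x)=a^v(x)=a(v^{-1}x)$. A locally constant map on $\mathbf Q_2$ is identified with its unique locally constant extension to $\mathfrak C$. Put $\overline K=\prod_{\mathbf Q_2}\Gamma$ with the same untwisted action of $V$, and view $G\subset\overline K\rtimes V$ by restricting maps to $\mathbf Q_2$.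 $N_{\overline K}(G)=\{f\in\overline K:fGf^{-1}=G\}$; inside it $Z(\Gamma)$ denotes the subgroup of constant maps valued in the center $Z(\Gamma)$ of $\Gamma$. Notation: $\overline\beta(a)(x)=\beta(a(x))$; $a^\varphi(x)=a(\varphi^{-1}(x))$; $\ell_v(x)=\log_2(v'(v^{-1}x))$; for $\zeta\in Z(\Gamma)$ and $h:\mathbf Q_2\to\mathbf Z$, $\zeta^{h}$ is the map $x\mapsto\zeta^{h(x)}$. For $a\in L\Gamma$, $v\in V$: $A_{\varphi,\beta}(av)=\overline\beta(a)^\varphi\cdot\mathrm{ad}_\varphi(v)$, $\mathrm{ad}(f)(av)=f\,av\,f^{-1}=fa(f^v)^{-1}\cdot v$, $F_\zeta(av)=\zeta^{\ell_v}\cdot a\cdot v$; these are automorphisms of $G$. For $\varphi\in N_{H(\mathfrak C)}(V)$: $\varphi^{-1}(\mathbf Q_2)$ is the set of all sequences $y\cdot c^\infty$ ($y$ a finite word) for some prime word $c$ in $0,1$ (prime: nonempty and not a power of a strictly shorter word); $k_\varphi:=|c|$. The map $\gamma_\varphi:\mathbf Q_2\to\mathbf Z$ is the well-defined map given by $\gamma_\varphi(v0)=\log_2((\varphi^{-1}v\varphi)'(\varphi^{-1}0))-k_\varphi\cdot\log_2(v'(0))$ for all $v\in V$.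
   Formalization: The formula for (φ,β)·(ζ,f) is asserted only when f^φ makes sense: each φ^{-1}(x), x in Q_2, lies in Q_2 or f is constant on Q_2 near it. Otherwise it is undefined and can fail (φ = bit flip, Γ = Z, f = number of 1's). The action and Ξ are on the full groups. *)

(* Defs.v *)
From HB Require Import structures.
From mathcomp Require Import all_boot all_order all_algebra.
From mathcomp Require Import all_classical topology cantor.

Set Implicit Arguments.
Unset Strict Implicit.
Unset Printing Implicit Defensive.

Local Open Scope classical_set_scope.
Local Open Scope group_scope.

(* A [groupType] carries a choice operator.  This is no restriction on the
   group: classically every type has one ([gen_choiceMixin] below). *)

Record subgroup (G : groupType) := Subgroup {
  sgset : set G;
  sg1 : sgset 1;
  sgM : forall x y, sgset x -> sgset y -> sgset (x * y);
  sgV : forall x, sgset x -> sgset x^-1 }.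

Record subgroup_sort (G : groupType) (S : subgroup G) : Type :=
  SgIn { sgval : G; sgvalP : sgset S sgval }.
Coercion subgroup_sort : subgroup >-> Sortclass.

Section SubgroupType.
Context {G : groupType} (S : subgroup G).
Implicit Types x y z : S.

Lemma sgval_inj : injective (@sgval G S).
Proof.
case=> x Sx [y Sy] /= xy; subst y.
by congr SgIn; apply: Prop_irrelevance.
Qed.

Definition sg_one : S := SgIn (sg1 S).
Definition sg_mul x y : S := SgIn (sgM (sgvalP x) (sgvalP y)).
Definition sg_inv x : S := SgIn (sgV (sgvalP x)).

Lemma sg_mulA : associative sg_mul.
Proof. by move=> x y z; apply: sgval_inj; rewrite /= mulgA. Qed.
Lemma sg_mul1 : left_id sg_one sg_mul.
Proof. by move=> x; apply: sgval_inj; rewrite /= mul1g. Qed.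
Lemma sg_mulr1 : right_id sg_one sg_mul.
Proof. by move=> x; apply: sgval_inj; rewrite /= mulg1. Qed.
Lemma sg_mulV : left_inverse sg_one sg_inv sg_mul.
Proof. by move=> x; apply: sgval_inj; rewrite /= mulVg. Qed.
Lemma sg_mulrV : right_inverse sg_one sg_inv sg_mul.
Proof. by move=> x; apply: sgval_inj; rewrite /= mulgV. Qed.

HB.instance Definition _ := gen_eqMixin (subgroup_sort S).
HB.instance Definition _ := gen_choiceMixin (subgroup_sort S).
HB.instance Definition _ := isGroup.Build (subgroup_sort S)
  sg_mulA sg_mul1 sg_mulr1 sg_mulV sg_mulrV.

End SubgroupType.

Section Normaliser.
Context {G : groupType}.
Implicit Types (x : G) (S : set G).

Definition conjset x S : set G := [set x * s * x^-1 | s in S].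

Lemma conjset1 S : conjset 1 S = S.
Proof.
by apply/seteqP; split=> y /= => [[s Ss <-]|Sy]; [|exists y => //];
  rewrite invg1 mulg1 mul1g.
Qed.

Lemma conjsetM x y S : conjset (x * y) S = conjset x (conjset y S).
Proof.
apply/seteqP; split=> z /= => [[s Ss <-]|[_ [s Ss <-] <-]].
  by exists (y * s * y^-1); [exists s | rewrite invgM !mulgA].
by exists s => //; rewrite invgM !mulgA.
Qed.

Lemma normaliser1 S : conjset 1 S = S. Proof. exact: conjset1. Qed.
Lemma normaliserM S x y :
  conjset x S = S -> conjset y S = S -> conjset (x * y) S = S.
Proof. by move=> xS yS; rewrite conjsetM yS xS. Qed.
Lemma normaliserV S x : conjset x S = S -> conjset x^-1 S = S.
Proof. by move=> xS; rewrite -{1}xS -conjsetM mulVg conjset1. Qed.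

Definition normaliser S : subgroup G :=
  @Subgroup G [set x | conjset x S = S]
    (normaliser1 S) (@normaliserM S) (@normaliserV S).

Lemma sub_normaliser (S : subgroup G) x :
  sgset S x -> sgset (normaliser (sgset S)) x.
Proof.
move=> Sx; apply/seteqP; split=> y /= => [[s Ss <-]|Sy].
  by apply: sgM; [apply: sgM | apply: sgV].
exists (x^-1 * y * x); last by rewrite !mulgA mulgV mul1g mulgK.
by apply: sgM => //; apply: sgM => //; apply: sgV.
Qed.

Definition center_set : set G := [set z | forall x, z * x = x * z].
Lemma center1 : center_set 1. Proof. by move=> x; rewrite mul1g mulg1. Qed.
Lemma centerM x y : center_set x -> center_set y -> center_set (x * y).
Proof. by move=> cx cy z; rewrite -mulgA cy !mulgA cx. Qed.
Lemma centerV x : center_set x -> center_set x^-1.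
Proof. by move=> cx y; apply: (@mulgI _ x); rewrite mulVKg mulgA cx mulgK. Qed.

End Normaliser.

Definition center (G : groupType) : subgroup G :=
  @Subgroup G center_set center1 centerM centerV.

Section Aut.
Context {G : groupType}.

Record aut := Aut {
  afun :> G -> G;
  ainv : G -> G;
  afunK : cancel afun ainv;
  ainvK : cancel ainv afun;
  afunM : {morph afun : x y / x * y} }.

Lemma aut_inj (f g : aut) : f =1 g -> f = g.
Proof.
case: f g => f f' fK f'K fM [g g' gK g'K gM] /= /funext fg; subst g.
have f'g' : f' = g' by apply/funext=> x; rewrite -[LHS]gK f'K.
by subst g'; congr Aut; apply: Prop_irrelevance.
Qed.

Lemma ainvM (f : aut) : {morph ainv f : x y / x * y}.
Proof. by move=> x y; rewrite -{1}(ainvK f x) -{1}(ainvK f y) -afunM afunK. Qed.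

Definition aut_one : aut :=
  @Aut id id (fun=> erefl) (fun=> erefl) (fun _ _ => erefl).
Definition aut_inv (f : aut) : aut := Aut (@ainvK f) (@afunK f) (@ainvM f).
Lemma aut_mul_subproof (f g : aut) : {morph f \o g : x y / x * y}.
Proof. by move=> x y /=; rewrite !afunM. Qed.
Definition aut_mul (f g : aut) : aut :=
  @Aut (f \o g) (ainv g \o ainv f) (can_comp (@afunK f) (@afunK g))
    (can_comp (@ainvK g) (@ainvK f)) (aut_mul_subproof f g).
Lemma aut_mulA : associative aut_mul.
Proof. by move=> f g h; apply: aut_inj. Qed.
Lemma aut_mul1 : left_id aut_one aut_mul.
Proof. by move=> f; apply: aut_inj. Qed.
Lemma aut_mulr1 : right_id aut_one aut_mul.
Proof. by move=> f; apply: aut_inj. Qed.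
Lemma aut_mulV : left_inverse aut_one aut_inv aut_mul.
Proof. by move=> f; apply: aut_inj => x /=; rewrite afunK. Qed.
Lemma aut_mulrV : right_inverse aut_one aut_inv aut_mul.
Proof. by move=> f; apply: aut_inj => x /=; rewrite ainvK. Qed.

HB.instance Definition _ := gen_eqMixin aut.
HB.instance Definition _ := gen_choiceMixin aut.
HB.instance Definition _ :=
  isGroup.Build aut aut_mulA aut_mul1 aut_mulr1 aut_mulV aut_mulrV.

Lemma aut1 (f : aut) : f 1 = 1.
Proof. by apply: (@mulgI _ (f 1)); rewrite -afunM !mulg1. Qed.
Lemma autV (f : aut) x : f x^-1 = (f x)^-1.
Proof. by apply: (@mulgI _ (f x)); rewrite -afunM !mulgV aut1. Qed.

Lemma innerK g : cancel (fun x : G => g * x * g^-1) (fun x => g^-1 * x * g).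
Proof. by move=> x; rewrite -!mulgA mulVg mulg1 mulKg. Qed.
Lemma innerVK g : cancel (fun x : G => g^-1 * x * g) (fun x => g * x * g^-1).
Proof. by move=> x; rewrite -!mulgA mulgV mulg1 mulVKg. Qed.
Lemma innerM g : {morph (fun x : G => g * x * g^-1) : x y / x * y}.
Proof. by move=> x y /=; rewrite !mulgA mulgVK. Qed.
Definition inner (g : G) : aut := Aut (innerK g) (innerVK g) (innerM g).

Lemma aut_center_subproof (f : aut) (z : center G) : center_set (f (sgval z)).
Proof. by move=> x; rewrite -(ainvK f x) -!afunM (sgvalP z). Qed.
Definition aut_center (f : aut) (z : center G) : center G :=
  @SgIn G (center G) _ (aut_center_subproof f z).

End Aut.
Arguments aut : clear implicits.

Record nsubgroup (G : groupType) := NSubgroup {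
  nsg : subgroup G;
  nsgJ : forall x n, sgset nsg n -> sgset nsg (x * n * x^-1) }.

Section Quotient.
Context {G : groupType} (N : nsubgroup G).
Notation inN := (sgset (nsg N)).

Definition quo_rel (x y : G) : bool := `[< inN (x^-1 * y) >].
Lemma quo_refl : reflexive quo_rel.
Proof. by move=> x; apply/asboolP; rewrite mulVg; apply: sg1. Qed.
Lemma quo_sym : symmetric quo_rel.
Proof.
by move=> x y; apply/asboolP/asboolP => /sgV; rewrite invgM invgK.
Qed.
Lemma quo_trans : transitive quo_rel.
Proof.
move=> y x z /asboolP Nxy /asboolP Nyz; apply/asboolP.
by have := sgM Nxy Nyz; rewrite mulgA mulgK.
Qed.
Canonical quo_equiv := EquivRel quo_rel quo_refl quo_sym quo_trans.

Definition quo : Type := {eq_quot quo_equiv}%qT.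
HB.instance Definition _ := Choice.on quo.

Definition quo_pi (x : G) : quo := \pi_({eq_quot quo_equiv})%qT x.

Lemma quo_eqP x y : quo_pi x = quo_pi y <-> inN (x^-1 * y).
Proof. by split=> [/eqmodP/asboolP|xy] //; apply/eqmodP/asboolP. Qed.

Lemma quo_piP (q : quo) : exists x, q = quo_pi x.
Proof. by exists (repr q); rewrite /quo_pi reprK. Qed.

Definition quo_mul (p q : quo) : quo := quo_pi (repr p * repr q).
Definition quo_inv (p : quo) : quo := quo_pi (repr p)^-1.

Lemma repr_quo_pi x : inN ((repr (quo_pi x))^-1 * x).
Proof. by apply/quo_eqP; rewrite /quo_pi reprK. Qed.

Lemma quo_piM : {morph quo_pi : x y / x * y >-> quo_mul x y}.
Proof.
move=> x y; apply/esym/quo_eqP; rewrite invgM.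
have := sgM (repr_quo_pi y) (nsgJ y^-1 (repr_quo_pi x)).
by rewrite invgK !mulgA mulgK.
Qed.

Lemma quo_piV : {morph quo_pi : x / x^-1 >-> quo_inv x}.
Proof.
move=> x; apply/quo_eqP; rewrite invgK.
have := nsgJ x (repr_quo_pi x).
by rewrite -!mulgA mulgV mulg1.
Qed.

Lemma quo_mulA : associative quo_mul.
Proof.
move=> p q r; have [x ->] := quo_piP p; have [y ->] := quo_piP q.
by have [z ->] := quo_piP r; rewrite -!quo_piM mulgA.
Qed.
Lemma quo_mul1 : left_id (quo_pi 1) quo_mul.
Proof. by move=> p; have [x ->] := quo_piP p; rewrite -quo_piM mul1g. Qed.
Lemma quo_mulr1 : right_id (quo_pi 1) quo_mul.
Proof. by move=> p; have [x ->] := quo_piP p; rewrite -quo_piM mulg1. Qed.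
Lemma quo_mulV : left_inverse (quo_pi 1) quo_inv quo_mul.
Proof.
by move=> p; have [x ->] := quo_piP p; rewrite -quo_piV -quo_piM mulVg.
Qed.
Lemma quo_mulrV : right_inverse (quo_pi 1) quo_inv quo_mul.
Proof.
by move=> p; have [x ->] := quo_piP p; rewrite -quo_piV -quo_piM mulgV.
Qed.
HB.instance Definition _ :=
  isGroup.Build quo quo_mulA quo_mul1 quo_mulr1 quo_mulV quo_mulrV.

End Quotient.
Arguments quo_pi {G} N x.

Section PointwiseGroup.
Context (T : Type) (G : groupType).

(* Alias of T -> G carrying the pointwise product. *)
Definition pfun := T -> G.
Implicit Types a b c : pfun.
Definition pfun_one : pfun := fun=> 1.
Definition pfun_inv a : pfun := fun x => (a x)^-1.
Definition pfun_mul a b : pfun := fun x => a x * b x.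
Lemma pfun_mulA : associative pfun_mul.
Proof. by move=> a b c; apply/funext => x; apply: mulgA. Qed.
Lemma pfun_mul1 : left_id pfun_one pfun_mul.
Proof. by move=> a; apply/funext => x; apply: mul1g. Qed.
Lemma pfun_mulr1 : right_id pfun_one pfun_mul.
Proof. by move=> a; apply/funext => x; apply: mulg1. Qed.
Lemma pfun_mulV : left_inverse pfun_one pfun_inv pfun_mul.
Proof. by move=> a; apply/funext => x; apply: mulVg. Qed.
Lemma pfun_mulrV : right_inverse pfun_one pfun_inv pfun_mul.
Proof. by move=> a; apply/funext => x; apply: mulgV. Qed.
HB.instance Definition _ := gen_eqMixin pfun.
HB.instance Definition _ := gen_choiceMixin pfun.
HB.instance Definition _ := isGroup.Build pfun
  pfun_mulA pfun_mul1 pfun_mulr1 pfun_mulV pfun_mulrV.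
End PointwiseGroup.

(* Left action of H on N by automorphisms. *)
Record gaction (H N : groupType) := GAction {
  gact :> H -> N -> N;
  gactM : forall h, {morph gact h : x y / x * y};
  gact_one : forall x, gact 1 x = x;
  gact_mul : forall h k x, gact (h * k) x = gact h (gact k x) }.

(* The semidirect product of N by H; [SdPair n h] is the product n h. *)
Record sdprod (H N : groupType) (act : gaction H N) :=
  SdPair { sdl : N; sdr : H }.
Arguments SdPair {H N act} sdl sdr.

Section SemidirectProduct.
Context (H N : groupType) (act : gaction H N).
Implicit Types p q r : sdprod act.

Lemma sdprod_eq p q : sdl p = sdl q -> sdr p = sdr q -> p = q.
Proof. by case: p q => [n h] [n' h'] /= -> ->. Qed.
Lemma gact1 h : act h 1 = 1.
Proof. by apply: (@mulgI _ (act h 1)); rewrite -gactM !mulg1. Qed.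
Lemma gactV h x : act h x^-1 = (act h x)^-1.
Proof. by apply: (@mulgI _ (act h x)); rewrite -gactM !mulgV gact1. Qed.

Definition sd_one : sdprod act := SdPair 1 1.
Definition sd_mul p q : sdprod act :=
  SdPair (sdl p * act (sdr p) (sdl q)) (sdr p * sdr q).
Definition sd_inv p : sdprod act :=
  SdPair (act (sdr p)^-1 (sdl p)^-1) (sdr p)^-1.
Lemma sd_mulA : associative sd_mul.
Proof.
by move=> p q r; apply: sdprod_eq; rewrite /= ?gactM ?gact_mul mulgA.
Qed.
Lemma sd_mul1 : left_id sd_one sd_mul.
Proof. by move=> p; apply: sdprod_eq; rewrite /= ?gact_one mul1g. Qed.
Lemma sd_mulr1 : right_id sd_one sd_mul.
Proof. by move=> p; apply: sdprod_eq; rewrite /= ?gact1 mulg1. Qed.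
Lemma sd_mulV : left_inverse sd_one sd_inv sd_mul.
Proof. by move=> p; apply: sdprod_eq; rewrite /= -?gactM mulVg ?gact1. Qed.
Lemma sd_mulrV : right_inverse sd_one sd_inv sd_mul.
Proof.
by move=> p; apply: sdprod_eq; rewrite /= -?gact_mul mulgV // gact_one mulgV.
Qed.
HB.instance Definition _ := gen_eqMixin (sdprod act).
HB.instance Definition _ := gen_choiceMixin (sdprod act).
HB.instance Definition _ := isGroup.Build (sdprod act)
  sd_mulA sd_mul1 sd_mulr1 sd_mulV sd_mulrV.
End SemidirectProduct.

Definition expgz (G : groupType) (x : G) (n : int) : G :=
  match n with Posz k => x ^+ k | Negz k => x ^- k.+1 end.

Section Homeomorphisms.

Record homeo := Homeo {
  hfun :> cantor_space -> cantor_space;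
  hinv : cantor_space -> cantor_space;
  hfunK : cancel hfun hinv;
  hinvK : cancel hinv hfun;
  hfun_continuous : continuous hfun;
  hinv_continuous : continuous hinv }.

Lemma homeo_inj (f g : homeo) : f =1 g -> f = g.
Proof.
case: f g => f f' fK f'K cf cf' [g g' gK g'K cg cg'] /= /funext fg; subst g.
have f'g' : f' = g' by apply/funext=> x; rewrite -[LHS]gK f'K.
by subst g'; congr Homeo; apply: Prop_irrelevance.
Qed.

Definition homeo_one : homeo :=
  @Homeo id id (fun=> erefl) (fun=> erefl) (fun x => cvg_id) (fun x => cvg_id).
Definition homeo_inv (f : homeo) : homeo :=
  Homeo (@hinvK f) (@hfunK f) (@hinv_continuous f) (@hfun_continuous f).
Lemma continuous_comp_all (f g : cantor_space -> cantor_space) :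
  continuous f -> continuous g -> continuous (f \o g).
Proof. by move=> cf cg x; apply: continuous_comp; [apply: cg | apply: cf]. Qed.
Definition homeo_mul (f g : homeo) : homeo :=
  @Homeo (f \o g) (hinv g \o hinv f)
    (can_comp (@hfunK f) (@hfunK g)) (can_comp (@hinvK g) (@hinvK f))
    (continuous_comp_all (@hfun_continuous f) (@hfun_continuous g))
    (continuous_comp_all (@hinv_continuous g) (@hinv_continuous f)).
Lemma homeo_mulA : associative homeo_mul.
Proof. by move=> f g h; apply: homeo_inj. Qed.
Lemma homeo_mul1 : left_id homeo_one homeo_mul.
Proof. by move=> f; apply: homeo_inj. Qed.
Lemma homeo_mulr1 : right_id homeo_one homeo_mul.
Proof. by move=> f; apply: homeo_inj. Qed.
Lemma homeo_mulV : left_inverse homeo_one homeo_inv homeo_mul.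
Proof. by move=> f; apply: homeo_inj => x /=; rewrite hfunK. Qed.
Lemma homeo_mulrV : right_inverse homeo_one homeo_inv homeo_mul.
Proof. by move=> f; apply: homeo_inj => x /=; rewrite hinvK. Qed.
HB.instance Definition _ := gen_eqMixin homeo.
HB.instance Definition _ := gen_choiceMixin homeo.
HB.instance Definition _ := isGroup.Build homeo
  homeo_mulA homeo_mul1 homeo_mulr1 homeo_mulV homeo_mulrV.

End Homeomorphisms.

Notation word := (seq bool).

Definition wcat (m : word) (y : cantor_space) : cantor_space :=
  fun n => if (n < size m)%N then nth false m n else y (n - size m)%N.

Definition sdi (m : word) : set cantor_space := range (wcat m).

Definition sdp (n : nat) (m : 'I_n -> word) : Prop :=
  trivIset setT (fun k => sdi (m k)) /\ \bigcup_k sdi (m k) = setT.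

Section Words.
Implicit Types (m w u : word) (x y z : cantor_space).

Definition pref n x : word := mkseq x n.
Definition shift n x : cantor_space := fun i => x (n + i)%N.

Lemma wcat0 y : wcat [::] y = y.
Proof. by apply/funext => i; rewrite /wcat /= subn0. Qed.

Lemma wcat_cat m u y : wcat (m ++ u) y = wcat m (wcat u y).
Proof.
apply/funext => i; rewrite /wcat size_cat nth_cat.
case: (ltnP i (size m)) => im; first by rewrite (leq_trans im) ?leq_addr.
by rewrite -(subnKC im) ltn_add2l subnDl addKn.
Qed.

Lemma wcat_pref n x : wcat (pref n x) (shift n x) = x.
Proof.
apply/funext => i; rewrite /wcat size_mkseq; case: ltnP => ni.
  by rewrite nth_mkseq.
by rewrite /shift subnKC.
Qed.

Lemma wcat_inj m : injective (wcat m).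
Proof.
move=> y z yz; apply/funext => i; have := congr1 (@^~ (size m + i)%N) yz.
by rewrite /wcat ltnNge leq_addr /= addKn.
Qed.

Lemma pref_wcat m y : pref (size m) (wcat m y) = m.
Proof.
apply: (@eq_from_nth _ false); rewrite size_mkseq // => i im.
by rewrite nth_mkseq // /wcat im.
Qed.

Lemma sdi_pref n x : sdi (pref n x) x.
Proof. by exists (shift n x) => //; rewrite wcat_pref. Qed.

Lemma sdiP m x : sdi m x -> m = pref (size m) x.
Proof. by case=> y _ <-; rewrite pref_wcat. Qed.

Lemma pref_cat n k x : (n <= k)%N -> exists u, pref k x = pref n x ++ u.
Proof.
move=> nk; exists (pref (k - n) (shift n x)).
rewrite -[in LHS](subnKC nk) /pref /mkseq iotaD map_cat add0n; congr cat.
by rewrite -[n in iota n]addn0 iotaDl -map_comp.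
Qed.

Lemma sdi_sub m u : sdi (m ++ u) `<=` sdi m.
Proof. by move=> _ [y _ <-]; rewrite wcat_cat; exists (wcat u y). Qed.

Lemma wcat_size m w : (forall y, wcat m y = wcat w y) -> size m = size w.
Proof.
have leq u v : (forall y, wcat u y = wcat v y) -> (size u <= size v)%N.
  move=> uv; rewrite leqNgt; apply/negP => vu.
  have /(congr1 (@^~ (size v))) := uv (fun=> ~~ nth false u (size v)).
  by rewrite /wcat vu ltnn => /eqP; case: (nth _ _ _).
by move=> mw; apply/eqP; rewrite eqn_leq !leq // => y; rewrite mw.
Qed.

(* Compactness of the Cantor space, in the form of Koenig's lemma. *)
Lemma word_compact (P : word -> Prop) :
  (forall m u, P m -> P (m ++ u)) -> (forall x, exists n, P (pref n x)) ->
  exists N, forall m, size m = N -> P m.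
Proof.
move=> Pcat Pex; apply/not_existsP => nP.
pose bad m := forall N, exists2 u, size u = N & ~ P (m ++ u).
have bad0 : bad [::].
  by move=> N; have /existsNP[m /not_implyP[mN Pm]] := nP N; exists m.
have badS m : bad m -> {b | bad (rcons m b)}.
  move=> badm; apply: cid; apply/not_existsP => nbad.
  have /existsNP[N0 P0] := nbad false; have /existsNP[N1 P1] := nbad true.
  have [[|b u]] := badm (maxn N0 N1).+1 => // -[su].
  have [v [v' uvv' sv]] : exists v, exists2 v', u = v ++ v' &
      size v = if b then N1 else N0.
    exists (take (if b then N1 else N0) u), (drop (if b then N1 else N0) u).
      by rewrite cat_take_drop.
    by rewrite size_takel // su; case: b; rewrite ?leq_maxr ?leq_maxl.
  apply; rewrite uvv' -cat_rcons catA; apply: Pcat; apply: contrapT => nPv.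
  by case: b sv nPv => sv nPv; [apply: P1 | apply: P0]; exists v.
pose bm := {m | bad m}.
pose next (m : bm) : bm := let: exist m0 H := m in
  let: exist b Hb := badS m0 H in exist _ (rcons m0 b) Hb.
pose s n : bm := iter n next (exist _ [::] bad0).
pose x : cantor_space := fun n => last false (sval (s n.+1)).
have sx n : sval (s n) = pref n x.
  elim: n => [//|n IHn].
  rewrite /pref mkseqS -/(pref n x) -IHn /x /s /= -/(s n).
  by case: (s n) => m0 H /=; case: (badS m0 H) => b Hb /=; rewrite last_rcons.
have [n Pn] := Pex x; have [u _] := svalP (s n) 0%N.
by rewrite sx; apply; apply: Pcat.
Qed.

Lemma sdp_tuples N : sdp (fun k : 'I_#|{: N.-tuple bool}| => enum_val k : word).
Proof.
split.
  move=> j k _ _ [_ [[y _ <-] [z _ yz]]]; apply: enum_val_inj; apply: val_inj.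
  have e (t : N.-tuple bool) x : pref N (wcat t x) = t.
    by have := pref_wcat t x; rewrite size_tuple.
  by have := congr1 (pref N) yz; rewrite !e.
apply/seteqP; split=> // x _.
have sN : size (pref N x) == N by rewrite size_mkseq.
exists (enum_rank (Tuple sN)) => //=.
by rewrite enum_rankK; apply: sdi_pref.
Qed.

Lemma nbhs_sdi (x : cantor_space) (U : set cantor_space) :
  nbhs x U -> exists n, sdi (pref n x) `<=` U.
Proof.
pose F := filter_from setT (fun n => sdi (pref n x)).
have FF : Filter F.
  apply: filter_from_filter; first by exists 0%N.
  move=> i j _ _; exists (maxn i j) => //.
  have [u eu] := pref_cat x (leq_maxl i j).
  have [v ev] := pref_cat x (leq_maxr i j).
  by move=> y ye; split; [apply: (@sdi_sub _ u) | apply: (@sdi_sub _ v)];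
    rewrite -?eu -?ev.
suff Fx : F --> x by move=> /Fx [n _ nU]; exists n.
apply/cvg_sup => i; apply/cvg_image; first by
  rewrite eqEsubset; split=> // b _; exists (fun=> b).
move=> W Wx; exists (@^~ i @^-1` W); last first.
  rewrite image_preimage // eqEsubset; split=> // b _; exists (fun=> b) => //.
exists i.+1 => // _ [y _ <-] /=; rewrite /wcat size_mkseq ltnSn nth_mkseq //.
exact: nbhs_singleton Wx.
Qed.

Lemma sdi_nbhs m (x : cantor_space) : sdi m x -> nbhs x (sdi m).
Proof.
move=> /sdiP ->; elim: (size m) => [|n IHn].
  by apply: filterS filterT => y _; exists y; rewrite ?wcat0.
have nx : nbhs x [set y : cantor_space | y n = x n].
  apply: (@proj_continuous nat (fun=> bool) n x [set x n]).
  by apply: open_nbhs_nbhs; split; [apply: discrete_open |].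
apply: filterS (filterI IHn nx) => y [yn /= yx].
have -> : pref n.+1 x = pref n.+1 y.
  rewrite /pref !mkseqS yx; congr rcons.
  by have := sdiP yn; rewrite size_mkseq.
exact: sdi_pref.
Qed.

End Words.

Definition thompsonV_set : set homeo := [set v | exists n (m w : 'I_n -> word),
  [/\ sdp m, sdp w & forall k y, v (wcat (m k) y) = wcat (w k) y]].

Section ThompsonV.
Implicit Types (v : homeo) (m w : word) (x y : cantor_space).

Definition acts_on v m w := forall y, v (wcat m y) = wcat w y.

Lemma thompsonV_local v : thompsonV_set v <->
  forall x, exists m w, sdi m x /\ acts_on v m w.
Proof.
split=> [[n [m [w [[_ mT] _ vmw]]]] x|loc].
  have : [set: cantor_space] x by [].
  by rewrite -mT => -[k _ mx]; exists (m k), (w k); split => // y; apply: vmw.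
have [N PN] : exists N, forall m, size m = N -> exists w, acts_on v m w.
  apply: word_compact => [m u [w mw]|x].
    by exists (w ++ u) => y; rewrite !wcat_cat mw.
  have [m [w [/sdiP mx mw]]] := loc x.
  by exists (size m); rewrite -mx; exists w.
pose w (k : 'I_#|{: N.-tuple bool}|) :=
  sval (cid (PN (enum_val k) (size_tuple _))).
have wP (k : 'I_#|{: N.-tuple bool}|) :
    acts_on v (enum_val k : N.-tuple bool) (w k).
  exact: svalP (cid (PN (enum_val k) (size_tuple _))).
have [mtriv mT] := sdp_tuples N.
exists _, (fun k : 'I_#|{: N.-tuple bool}| => enum_val k : word), w.
split=> //; split.
  move=> j k _ _ [_ [[y _ <-] [z _ yz]]].
  apply: (mtriv j k I I); exists (wcat (enum_val j) y).
  split; first by exists y.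
  by exists z => //; apply: (can_inj (@hfunK v)); rewrite !wP.
apply/seteqP; split=> // x _; have : [set: cantor_space] (hinv v x) by [].
rewrite -mT => -[k _ [y _ kx]]; exists k => //.
by exists y => //; rewrite -(hinvK v x) -kx wP.
Qed.

Lemma thompsonV1 : thompsonV_set 1.
Proof.
apply/thompsonV_local => x; exists [::], [::]; split=> //.
by exists x; rewrite ?wcat0.
Qed.

Lemma thompsonVM u v :
  thompsonV_set u -> thompsonV_set v -> thompsonV_set (u * v).
Proof.
move=> /thompsonV_local uV /thompsonV_local vV; apply/thompsonV_local => x.
have [m [w [[y _ mx] mw]]] := vV x.
have [m' [w' [m'x mw']]] := uV (v x).
pose n := maxn (size w) (size m').
have [s es] := pref_cat (v x) (leq_maxl (size w) (size m')).
have [t et] := pref_cat (v x) (leq_maxr (size w) (size m')).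
have vx : v x = wcat w y by rewrite -mx mw.
have ew : pref (size w) (v x) = w by rewrite vx pref_wcat.
rewrite -(sdiP m'x) in et; rewrite ew in es.
exists (m ++ s), (w' ++ t); split.
  exists (shift (size s) y) => //; rewrite wcat_cat -mx; congr wcat.
  apply: (@wcat_inj w); rewrite -wcat_cat -es -vx.
  have e : (size w + size s = maxn (size w) (size m'))%N.
    by rewrite -size_cat -es size_mkseq.
  rewrite -[RHS](wcat_pref (maxn (size w) (size m')) (v x)); congr wcat.
  apply/funext => i; rewrite /shift vx /wcat -e.
  by rewrite -addnA ltnNge leq_addr /= addKn.
by move=> z; rewrite /= wcat_cat mw -wcat_cat -es et wcat_cat mw' -wcat_cat.
Qed.

Lemma thompsonVV v : thompsonV_set v -> thompsonV_set v^-1.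
Proof.
move=> [n [m [w [mP wP vmw]]]]; exists n, w, m; split=> // k y.
by rewrite -vmw; apply: hfunK.
Qed.

End ThompsonV.

Definition thompsonV : subgroup homeo :=
  @Subgroup homeo thompsonV_set thompsonV1 thompsonVM thompsonVV.

Definition NHV : subgroup homeo := normaliser (sgset thompsonV).

(* log_2 v'(x): the slope is v'(x) = 2 ^ (|m| - |w|) when m is a prefix of x
   and v maps m . z to w . z for all z.  By [log_slopeE] below the choice of
   (m, w) is immaterial. *)
Definition log_slope (v : homeo) (x : cantor_space) : int :=
  xget 0%R [set d | exists m w,
    [/\ sdi m x, forall z, v (wcat m z) = wcat w z &
        d = ((size m)%:Z - (size w)%:Z)%R]].

Section LogSlope.
Implicit Types (v : homeo) (m w : word) (x : cantor_space).

Lemma acts_on_cat v m w u : acts_on v m w -> acts_on v (m ++ u) (w ++ u).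
Proof. by move=> mw z; rewrite !wcat_cat mw. Qed.

Lemma log_slopeE v x m w :
  sdi m x -> acts_on v m w -> log_slope v x = ((size m)%:Z - (size w)%:Z)%R.
Proof.
have slope_le m1 w1 m2 w2 : sdi m1 x -> sdi m2 x -> (size m1 <= size m2)%N ->
    acts_on v m1 w1 -> acts_on v m2 w2 ->
    ((size m1)%:Z - (size w1)%:Z = (size m2)%:Z - (size w2)%:Z)%R.
  move=> /sdiP m1x /sdiP m2x le12 vm1 vm2.
  have [u] := pref_cat x le12; rewrite -m1x -m2x => m2E; subst m2.
  have vm1u := acts_on_cat u vm1.
  have <- : size (w1 ++ u) = size w2.
    by apply: wcat_size => z; rewrite -vm1u -vm2.
  by rewrite !size_cat !PoszD GRing.opprD GRing.addrACA GRing.subrr GRing.addr0.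
move=> mx mw; rewrite /log_slope; case: xgetP => [d _ [m' [w' [m'x mw' ->]]]|].
  case: (leqP (size m) (size m')) => [|/ltnW] le.
    exact/esym/slope_le.
  exact: slope_le.
by move=> /(_ ((size m)%:Z - (size w)%:Z)%R) []; exists m, w.
Qed.

End LogSlope.

Definition loc_const_set (T : Type) : set (cantor_space -> T) := [set a |
  exists n (m : 'I_n -> word),
    sdp m /\ forall k y z, a (wcat (m k) y) = a (wcat (m k) z)].

Lemma loc_constP (T : Type) (a : cantor_space -> T) : loc_const_set a <->
  forall x, exists2 m, sdi m x & forall y z, a (wcat m y) = a (wcat m z).
Proof.
split=> [[n [m [[_ mT] am]]] x|loc].
  have : [set: cantor_space] x by [].
  by rewrite -mT => -[k _ mx]; exists (m k).
have [N PN] : exists N, forall m, size m = N ->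
    forall y z, a (wcat m y) = a (wcat m z).
  apply: word_compact => [m u am y z|x]; first by rewrite !wcat_cat.
  by have [m /sdiP mx am] := loc x; exists (size m); rewrite -mx.
exists _, (fun k : 'I_#|{: N.-tuple bool}| => enum_val k : word).
by split=> [|k y z]; [apply: sdp_tuples | apply: PN; rewrite size_tuple].
Qed.

Lemma loc_const_comp (T U : Type) (f : T -> U) (a : cantor_space -> T) :
  loc_const_set a -> loc_const_set (f \o a).
Proof.
by move=> [n [m [mP am]]]; exists n, m; split=> // k y z /=; rewrite (am k y z).
Qed.

Lemma loc_const2 (T U W : Type) (f : T -> U -> W) a b :
  loc_const_set a -> loc_const_set b -> loc_const_set (fun x => f (a x) (b x)).
Proof.
move=> /loc_constP la /loc_constP lb; apply/loc_constP => x.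
have [m mx am] := la x; have [w wx bw] := lb x.
have [u eu] := pref_cat x (leq_maxl (size m) (size w)).
have [v ev] := pref_cat x (leq_maxr (size m) (size w)).
exists (pref (maxn (size m) (size w)) x); first exact: sdi_pref.
move=> y z; congr (f _ _); [rewrite eu -(sdiP mx) | rewrite ev -(sdiP wx)];
  by rewrite !wcat_cat; auto.
Qed.

Lemma loc_const_homeo (T : Type) (f : homeo) (a : cantor_space -> T) :
  loc_const_set a -> loc_const_set (a \o f).
Proof.
move=> /loc_constP la; apply/loc_constP => x.
have [m mx am] := la (f x).
have [n nU] : exists n, sdi (pref n x) `<=` f @^-1` sdi m.
  apply: nbhs_sdi; apply: (@hfun_continuous f x).
  exact: sdi_nbhs.
exists (pref n x); first exact: sdi_pref.
move=> y z /=.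
have [y' _ <-] : sdi m (f (wcat (pref n x) y)) by apply: nU; exists y.
have [z' _ <-] : sdi m (f (wcat (pref n x) z)) by apply: nU; exists z.
exact: am.
Qed.

Section LoopGroup.
Context (Gamma : groupType).

Lemma LGamma1 : loc_const_set (1 : pfun cantor_space Gamma).
Proof.
by apply/loc_constP => x; exists [::] => //; exists x; rewrite ?wcat0.
Qed.
Lemma LGammaM (a b : pfun cantor_space Gamma) :
  loc_const_set a -> loc_const_set b -> loc_const_set (a * b).
Proof. exact: loc_const2. Qed.
Lemma LGammaV (a : pfun cantor_space Gamma) :
  loc_const_set a -> loc_const_set a^-1.
Proof. exact: loc_const_comp. Qed.

Definition LGamma : subgroup (pfun cantor_space Gamma) :=
  @Subgroup (pfun cantor_space Gamma) (@loc_const_set Gamma)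
    LGamma1 LGammaM LGammaV.

Definition LGamma_act (v : thompsonV) (a : LGamma) : LGamma :=
  @SgIn _ LGamma (sgval a \o hinv (sgval v))
    (loc_const_homeo (sgval v)^-1 (sgvalP a)).

Lemma LGamma_actM v : {morph LGamma_act v : a b / a * b}.
Proof. by move=> a b; apply: sgval_inj. Qed.
Lemma LGamma_act1 a : LGamma_act 1 a = a.
Proof. exact: sgval_inj. Qed.
Lemma LGamma_act_mul u v a :
  LGamma_act (u * v) a = LGamma_act u (LGamma_act v a).
Proof. exact: sgval_inj. Qed.

Definition LGamma_action : gaction thompsonV LGamma :=
  GAction LGamma_actM LGamma_act1 LGamma_act_mul.

Definition fraction_group := sdprod LGamma_action.
HB.instance Definition _ := Group.on fraction_group.

End LoopGroup.

Definition Q2_set : set cantor_space := [set x | finite_set [set n | x n]].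

Record Q2 := InQ2 { q2val :> cantor_space; q2P : Q2_set q2val }.

Lemma Q2_inj : injective q2val.
Proof.
case=> x Px [y Py] /= xy; subst y.
by congr InQ2; apply: Prop_irrelevance.
Qed.

Lemma Q2_zeroP : Q2_set (fun=> false).
Proof. by apply: (@sub_finite_set _ _ set0). Qed.
Definition Q2_zero : Q2 := InQ2 Q2_zeroP.

Lemma Q2_wcat m y : Q2_set (wcat m y) <-> Q2_set y.
Proof.
split=> fy.
  apply: sub_finite_set (finite_image (subn^~ (size m)) fy) => n /= yn.
  by exists (size m + n)%N; rewrite /= ?addKn // /wcat ltnNge leq_addr addKn.
have fS : finite_set (`I_(size m) `|` addn (size m) @` [set n | y n]).
  by rewrite finite_setU; split; [apply: finite_II | apply: finite_image].
apply: sub_finite_set fS => n /=; rewrite /wcat.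
case: ltnP => nm yn; first by left.
by right; exists (n - size m)%N => //; rewrite subnKC.
Qed.

Lemma Q2_thompsonV (v : thompsonV) x : Q2_set x -> Q2_set (sgval v x).
Proof.
have /thompsonV_local/(_ x)[m [w [[y _ <-] ->]]] := sgvalP v.
by move=> /Q2_wcat ?; apply/Q2_wcat.
Qed.

Definition Q2_act (v : thompsonV) (x : Q2) : Q2 :=
  InQ2 (Q2_thompsonV v (q2P x)).

Section BigGroup.
Context (Gamma : groupType).

Definition Kbar := pfun Q2 Gamma.
HB.instance Definition _ := Group.on Kbar.

Definition Kbar_act (v : thompsonV) (f : Kbar) : Kbar := f \o Q2_act v^-1.
Lemma Kbar_actM v : {morph Kbar_act v : f g / f * g}.
Proof. by []. Qed.
Lemma Kbar_act1 f : Kbar_act 1 f = f.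
Proof. by apply/funext => x; congr f; apply: Q2_inj. Qed.
Lemma Kbar_act_mul u v f : Kbar_act (u * v) f = Kbar_act u (Kbar_act v f).
Proof. by apply/funext => x; congr f; apply: Q2_inj. Qed.

Definition Kbar_action : gaction thompsonV Kbar :=
  GAction Kbar_actM Kbar_act1 Kbar_act_mul.

Definition big_group := sdprod Kbar_action.
HB.instance Definition _ := Group.on big_group.

Definition iotaG (g : fraction_group Gamma) : big_group :=
  SdPair (sgval (sdl g) \o q2val : Kbar) (sdr g).
Definition iotaK (f : Kbar) : big_group := SdPair f 1.

Lemma iotaGM : {morph iotaG : x y / x * y}.
Proof. by move=> x y; apply: sdprod_eq. Qed.
Lemma iotaKM : {morph iotaK : x y / x * y}.
Proof.
move=> x y; apply: sdprod_eq; rewrite /= ?mul1g //.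
by rewrite -[Kbar_act 1 y]/(Kbar_action 1 y) gact_one.
Qed.
Lemma iotaG1 : iotaG 1 = 1. Proof. exact: sdprod_eq. Qed.
Lemma iotaK1 : iotaK 1 = 1. Proof. exact: sdprod_eq. Qed.
Lemma iotaKV f : iotaK f^-1 = (iotaK f)^-1.
Proof. by apply: (@mulgI _ (iotaK f)); rewrite -iotaKM !mulgV iotaK1. Qed.

Definition NK_set : set Kbar :=
  [set f | sgset (normaliser (range iotaG)) (iotaK f)].
Lemma NK1 : NK_set 1. Proof. by rewrite /NK_set /= iotaK1; apply: conjset1. Qed.
Lemma NKM f g : NK_set f -> NK_set g -> NK_set (f * g).
Proof. by rewrite /NK_set /mkset iotaKM; apply: sgM. Qed.
Lemma NKV f : NK_set f -> NK_set f^-1.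
Proof. by rewrite /NK_set /mkset iotaKV; apply: sgV. Qed.

Definition NK : subgroup Kbar := @Subgroup Kbar NK_set NK1 NKM NKV.

Lemma range_iotaG1 : range iotaG 1. Proof. by exists 1; rewrite ?iotaG1. Qed.
Lemma range_iotaGM x y : range iotaG x -> range iotaG y -> range iotaG (x * y).
Proof. by move=> [g _ <-] [h _ <-]; exists (g * h); rewrite ?iotaGM. Qed.
Lemma range_iotaGV x : range iotaG x -> range iotaG x^-1.
Proof.
by move=> [g _ <-]; exists g^-1.
Qed.
Definition range_iotaG : subgroup big_group :=
  @Subgroup big_group (range iotaG) range_iotaG1 range_iotaGM range_iotaGV.

Lemma NK_constP (g : Gamma) : NK_set (fun=> g).
Proof.
apply: (@sub_normaliser _ range_iotaG).
have lg : loc_const_set (fun=> g : Gamma).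
  by apply/loc_constP => x; exists [::] => //; exists x; rewrite ?wcat0.
by exists (SdPair (@SgIn _ (LGamma Gamma) _ lg) 1).
Qed.
Definition NK_const (g : Gamma) : NK := @SgIn _ NK _ (NK_constP g).

(* The copy of Z(Gamma) inside N_Kbar(G) formed by the constant maps. *)
Definition constZ_set : set NK :=
  [set f | exists z : center Gamma, f = NK_const (sgval z)].
Lemma constZ1 : constZ_set 1.
Proof. by exists 1; apply: sgval_inj. Qed.
Lemma constZM f g : constZ_set f -> constZ_set g -> constZ_set (f * g).
Proof. by move=> [z ->] [t ->]; exists (z * t); apply: sgval_inj. Qed.
Lemma constZV f : constZ_set f -> constZ_set f^-1.
Proof. by move=> [z ->]; exists z^-1; apply: sgval_inj. Qed.
Definition constZ_subgroup : subgroup NK :=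
  @Subgroup NK constZ_set constZ1 constZM constZV.
Lemma constZJ f z : constZ_set z -> constZ_set (f * z * f^-1).
Proof.
move=> [t ->]; exists t; apply: sgval_inj; apply/funext => x.
rewrite -[LHS]/(sgval f x * sgval t * (sgval f x)^-1).
by rewrite -(sgvalP t) mulgK.
Qed.
Definition constZ : nsubgroup NK :=
  @NSubgroup NK constZ_subgroup constZJ.

End BigGroup.
Arguments NK_const {Gamma} g.
Arguments constZ {Gamma}.

Section Automorphisms.
Context (Gamma : groupType).
Notation G := (fraction_group Gamma).

Definition ell (v : homeo) (x : cantor_space) : int := log_slope v (hinv v x).

Lemma loc_const_ell (v : thompsonV) : loc_const_set (ell (sgval v)).
Proof.
apply/loc_constP => x.
have /thompsonV_local/(_ (hinv (sgval v) x))[m [w [[y _ mx] mw]]] := sgvalP v.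
exists w; first by exists y => //; rewrite -mw mx hinvK.
move=> z t; rewrite /ell -!mw !hfunK.
by rewrite !(@log_slopeE _ _ m w) //; [exists t | exists z].
Qed.

Lemma zeta_ell_subproof (zeta : Gamma) (v : thompsonV) :
  loc_const_set (fun x => expgz zeta (ell (sgval v) x)).
Proof. exact: (loc_const_comp (expgz zeta) (loc_const_ell v)). Qed.

Definition zeta_ell (zeta : center Gamma) (v : thompsonV) : LGamma Gamma :=
  @SgIn _ (LGamma Gamma) _ (zeta_ell_subproof (sgval zeta) v).

Definition Fmap (zeta : center Gamma) (g : G) : G :=
  SdPair (zeta_ell zeta (sdr g) * sdl g) (sdr g).

Lemma Amap_subproof (phi : homeo) (beta : aut Gamma) (a : LGamma Gamma) :
  loc_const_set (fun x => beta (sgval a (hinv phi x))).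
Proof.
exact: (loc_const_comp beta (loc_const_homeo phi^-1 (sgvalP a))).
Qed.

Lemma adV_subproof (phi : NHV) (v : thompsonV) :
  thompsonV_set (sgval phi * sgval v * (sgval phi)^-1).
Proof.
have /= phiV := sgvalP phi; rewrite -[thompsonV_set]phiV.
by exists (sgval v) => //; apply: (@sgvalP _ thompsonV).
Qed.
Definition adV (phi : NHV) (v : thompsonV) : thompsonV :=
  @SgIn _ thompsonV _ (adV_subproof phi v).

Definition Amap (phi : NHV) (beta : aut Gamma) (g : G) : G :=
  SdPair (@SgIn _ (LGamma Gamma) _ (Amap_subproof (sgval phi) beta (sdl g)))
         (adV phi (sdr g)).

Lemma admap_subproof (f : NK Gamma) (g : G) :
  exists h, iotaG h = iotaK (sgval f) * iotaG g * (iotaK (sgval f))^-1.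
Proof.
suff [h _ <-] : range (@iotaG Gamma)
    (iotaK (sgval f) * iotaG g * (iotaK (sgval f))^-1) by exists h.
have fG :
    conjset (iotaK (sgval f)) (range (@iotaG Gamma)) = range (@iotaG Gamma).
  exact: sgvalP f.
by rewrite -fG; exists (iotaG g) => //; exists g.
Qed.
(* The value at g is the unique h with h = f g f^-1 in Kbar x| V; it is unique
   because [iotaG] is injective, Q_2 being dense. *)
Definition admap (f : NK Gamma) (g : G) : G := sval (cid (admap_subproof f g)).

End Automorphisms.

Section NormaliserData.

Definition prime_word (c : word) : Prop :=
  c != [::] /\
  ~ exists (d : word) n, (size d < size c)%N /\ c = flatten (nseq n d).

Definition winf (c : word) : cantor_space :=
  fun n => nth false c (n %% size c)%N.

(* The length of a prime word c such that phi^-1(Q_2) is the set of the y . c^oo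
   (c is determined up to rotation, hence its length is determined). *)
Definition kphi (phi : homeo) : nat := xget 0%N [set k | exists c,
  [/\ prime_word c, hinv phi @` Q2_set = [set wcat y (winf c) | y in setT]
    & k = size c]].

(* The value at v0 does not depend on the choice of v. *)
Definition gammaphi (phi : homeo) (x : Q2) : int := xget 0%R [set d |
  exists v : thompsonV, Q2_act v Q2_zero = x /\
    d = (log_slope (phi^-1 * sgval v * phi)%g (hinv phi Q2_zero)
         - (kphi phi)%:Z * log_slope (sgval v) Q2_zero)%R].

Context (Gamma : groupType).
Implicit Types (phi : homeo) (beta : aut Gamma) (f : Kbar Gamma).

(* f : Q_2 -> Gamma has value g at the point x of the Cantor space: either x is
   in Q_2 and f x = g, or x is outside Q_2 and f is equal to g on the points of
   Q_2 near x.  If f is locally constant this is the graph of its locally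
   constant extension to the Cantor space. *)
Definition Kval f (x : cantor_space) (g : Gamma) : Prop :=
  (exists2 q : Q2, q2val q = x & f q = g) \/
  (~ Q2_set x /\
   exists2 m, sdi m x & forall q : Q2, sdi m q -> f q = g).

Lemma Kval_unique f x g h : Kval f x g -> Kval f x h -> g = h.
Proof.
case=> [[q <- <-]|[nx [m mx fg]]] [[r rx <-]|[nr [w wx fh]]].
- by congr f; apply: Q2_inj.
- by case: nr; apply: q2P.
- by case: nx; rewrite -rx; apply: q2P.
pose n := maxn (size m) (size w).
have [u eu] := pref_cat x (leq_maxl (size m) (size w)).
have [v ev] := pref_cat x (leq_maxr (size m) (size w)).
have qP : Q2_set (wcat (pref n x) Q2_zero) by apply/Q2_wcat/q2P.
rewrite -(fg (InQ2 qP)) ?(fh (InQ2 qP)) //=.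
  by apply: (@sdi_sub _ v); rewrite (sdiP wx) -ev; exists Q2_zero.
by apply: (@sdi_sub _ u); rewrite (sdiP mx) -eu; exists Q2_zero.
Qed.

(* [fphi] is the map f^phi : x |-> f (phi^-1 x) of Kbar.  As phi^-1 need not
   preserve Q_2, f^phi need not exist; it does for every f if phi(Q_2) = Q_2,
   and for every phi if f is locally constant. *)
Definition is_translate phi f (fphi : Kbar Gamma) : Prop :=
  forall x : Q2, Kval f (hinv phi x) (fphi x).

Definition Kmap beta f : Kbar Gamma := beta \o f.

Definition zpow (zeta : Gamma) (h : Q2 -> int) : Kbar Gamma :=
  fun x => expgz zeta (h x).

Lemma is_translate_stable phi f (phiQ : forall x : Q2, Q2_set (hinv phi x)) :
  is_translate phi f (fun x => f (InQ2 (phiQ x))).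
Proof. by move=> x; left; exists (InQ2 (phiQ x)). Qed.

Lemma is_translate_LGamma phi (a : LGamma Gamma) :
  is_translate phi (sgval a \o q2val) (fun x => sgval a (hinv phi x)).
Proof.
move=> x; case: (pselect (Q2_set (hinv phi x))) => [qx|nx].
  by left; exists (InQ2 qx).
right; split=> //.
have /loc_constP/(_ (hinv phi x))[m [y _ <-] am] := sgvalP a.
by exists m; [exists y | move=> q /= [z _ <-]; apply: am].
Qed.

End NormaliserData.

(* Main.v *)
Require Import Defs.
From HB Require Import structures.
From mathcomp Require Import all_boot all_order all_algebra.
From mathcomp Require Import all_classical topology cantor.
From mathcomp Require Import zify.

(* V is generated by transpositions of disjoint cylinders, hence it is simple
   and perfect, and Rubin's reconstruction shows that every automorphism of V is
   conjugation by an element of N(V).  Simplicity of V also forces an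
   automorphism alpha of G to preserve LGamma: otherwise the images in V of the
   maps supported on the two halves of the Cantor space would be two commuting,
   conjugate normal subgroups generating V.  After composing with A_{phi,1},
   alpha(a v) = kappa(a) c_v v.  Conjugation invariance makes kappa act pointwise,
   kappa(a)(x) = kappa_x(a(x)), and put beta = kappa_0.  For v fixing 0 the value
   c_v(0) is central, and it only depends on the germ of v because V is perfect;
   as germs at 0 are powers of a contraction, c_v(0) = zeta^(ell_v(0)).  The
   cocycle zeta^(-ell) c is then a coboundary f (f^v)^-1 on the orbit Q_2 of 0, and
   alpha = F_zeta ad(f) A_{phi,beta}.  The action is conjugation by A_{phi,beta}
   on the injective image of (zeta, f) |-> F_zeta ad(f); it exists because the
   same analysis applied to A F_zeta ad(f) A^-1 gives an inner beta. *)

Set Implicit Arguments.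
Unset Strict Implicit.
Unset Printing Implicit Defensive.

Local Open Scope classical_set_scope.
Local Open Scope group_scope.

(** * Orthogonal words and the transpositions of V *)

(** The formula for the action cannot serve as its definition: phi^-1 need not preserve Q_2, so
    f^phi is only a relation ([is_translate]), and its existence for each f in the normaliser cannot
    be read off the formula. The formula is therefore checked on each given translate, after
    conjugation has defined the action. The obstacle is then that the coefficient map of A F_zeta
    ad(f) A^-1 is visibly inner only at phi(0), a point that may lie outside Q_2; V moves it near 0,
    and a contraction carries the property to 0 itself.

    Most local arguments rest on one device: an element of V that moves a cylinder while fixing a
    given point, built from one or two transpositions through a disjoint auxiliary word.

    The number k_phi enters as a ratio of exponents: conjugation by phi^-1 turns the generator of
    the germs at 0 into a germ of slope 2^-|c| at phi^-1(0). After this rescaling, what remains of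
    ell_v is a coboundary on Q_2, with potential gamma_phi. *)

Section OrthogonalWords.
Implicit Types (m w a b c u : word) (x y z : cantor_space).

Lemma sdi_wcat m y : sdi m (wcat m y). Proof. by exists y. Qed.

Lemma shift_wcat m y : shift (size m) (wcat m y) = y.
Proof. by apply/funext => i; rewrite /shift /wcat ltnNge leq_addr addKn. Qed.

Lemma wcat_shift m x : sdi m x -> wcat m (shift (size m) x) = x.
Proof. by case=> y _ <-; rewrite shift_wcat. Qed.

Lemma sdi_nth m x : sdi m x <-> forall i, (i < size m)%N -> x i = nth false m i.
Proof.
split=> [[y _ <-] i im|mx]; first by rewrite /wcat im.
exists (shift (size m) x) => //; apply/funext => i.
by rewrite /wcat; case: ltnP => im; [rewrite mx | rewrite /shift subnKC].
Qed.

Lemma sdi_catE m u y : sdi (m ++ u) (wcat m y) <-> sdi u y.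
Proof.
split=> [[z _]|[z _ <-]]; first by rewrite wcat_cat => /wcat_inj <-; exists z.
by exists z; rewrite ?wcat_cat.
Qed.

Lemma sdi_nil x : sdi [::] x. Proof. by exists x; rewrite ?wcat0. Qed.
Hint Resolve sdi_nil sdi_wcat : core.

Lemma sdi_le m w x : sdi m x -> sdi w x -> (size m <= size w)%N ->
  exists u, w = m ++ u.
Proof. by move=> /sdiP mx /sdiP wx /(pref_cat x); rewrite -mx -wx. Qed.

Definition ortho a b := forall x, sdi a x -> sdi b x -> False.

Lemma ortho_sym a b : ortho a b -> ortho b a.
Proof. by move=> ab x ax bx; apply: (ab x). Qed.

Lemma orthoPn a b : ~ ortho a b -> exists u, b = a ++ u \/ a = b ++ u.
Proof.
move=> /existsNP[x /not_implyP[ax /not_implyP[bx _]]].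
case: (leqP (size a) (size b)) => [le|/ltnW le].
  by have [u ->] := sdi_le ax bx le; exists u; left.
by have [u ->] := sdi_le bx ax le; exists u; right.
Qed.

Lemma ortho_catl a b u : ortho a b -> ortho (a ++ u) b.
Proof. by move=> ab x /sdi_sub; apply: ab. Qed.
Lemma ortho_catr a b u : ortho a b -> ortho a (b ++ u).
Proof. by move=> ab x ax /sdi_sub; apply: ab. Qed.
Lemma ortho_cat2 a u w : ortho u w -> ortho (a ++ u) (a ++ w).
Proof.
by move=> uw x [y _ <-]; rewrite wcat_cat => /sdi_catE; apply: uw.
Qed.

Lemma ortho_size a b : size a = size b -> a <> b -> ortho a b.
Proof. by move=> sab ab x /sdiP ax /sdiP bx; apply: ab; rewrite ax bx sab. Qed.

Lemma ortho_rcons a s : ortho (rcons a s) (rcons a (~~ s)).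
Proof.
apply: ortho_size; first by rewrite !size_rcons.
by move=> /rcons_inj[]; case: s.
Qed.

Lemma ortho_pref m x n : ~ sdi m x -> (size m <= n)%N -> ortho (pref n x) m.
Proof.
move=> mx mn z /sdi_nth zx /sdi_nth mz; apply: mx; apply/sdi_nth => i im.
rewrite -mz // zx ?size_mkseq ?(leq_trans im) // nth_mkseq //.
exact: leq_trans mn.
Qed.

Lemma ortho_pref_pref x y n :
  pref n x <> pref n y -> ortho (pref n x) (pref n y).
Proof. by apply: ortho_size; rewrite !size_mkseq. Qed.

Lemma neq_pref x y : x <> y -> exists n, pref n x <> pref n y.
Proof.
move=> xy; apply: contrapT => /forallNP nxy; apply: xy; apply/funext => i.
have /contrapT e := nxy i.+1.
by have := congr1 (nth false ^~ i) e; rewrite !nth_mkseq.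
Qed.

Lemma pref_le x y n k : (n <= k)%N -> pref k x = pref k y -> pref n x = pref n y.
Proof.
move=> nk e; apply: (@eq_from_nth _ false); rewrite !size_mkseq // => i ik.
have := congr1 (nth false ^~ i) e.
by rewrite !nth_mkseq ?(leq_trans ik).
Qed.

Lemma neq_ortho x y : x <> y -> exists n, forall k l, (n <= k)%N -> (n <= l)%N ->
  ortho (pref k x) (pref l y).
Proof.
move=> /neq_pref[n nxy]; exists n => k l nk nl.
have [u ->] := pref_cat x nk; have [v ->] := pref_cat y nl.
by apply: ortho_catl; apply: ortho_catr; apply: ortho_pref_pref.
Qed.

(** Provides room: [a] can be exchanged with [e] by an element of V that fixes [x]. The word [e] is
    the prefix of [x] of length [size a] followed by the wrong letter. *)
Lemma exists_ortho a x : ~ sdi a x -> exists e, ortho e a /\ ~ sdi e x.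
Proof.
move=> ax; pose p := pref (size a) x.
have pa : ortho p a by apply: ortho_pref.
exists (rcons p (~~ x (size a))); split; first by rewrite -cats1; apply: ortho_catl.
rewrite -[p]/(pref _ _) => /sdi_nth /(_ (size a)).
by rewrite size_rcons size_mkseq nth_rcons size_mkseq ltnn eqxx => /(_ (leqnn _)); case: (x _).
Qed.

Lemma ortho_head a : a <> [::] -> exists e, ortho e a.
Proof.
case: a => // b a _; exists [:: ~~ b] => x /sdi_nth /(_ 0%N (leqnn _)) /= x0.
by move=> /sdi_nth /(_ 0%N isT) /=; rewrite x0; case: b x0.
Qed.

Lemma ortho_neq0 a b : ortho a b -> a <> [::].
Proof. by move=> ab e; subst a; apply: (ab (wcat b (fun=> false))). Qed.

Lemma sdi_closed a x : ~ sdi a x -> exists m, sdi m x /\ ortho m a.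
Proof.
by move=> ax; exists (pref (size a) x); split; [apply: sdi_pref | apply: ortho_pref].
Qed.

Lemma sdi_open (m a : word) x : sdi m x -> sdi a x ->
  exists u w, m ++ u = a ++ w /\ sdi (m ++ u) x.
Proof.
move=> mx ax; case: (leqP (size m) (size a)) => [le|/ltnW le].
  by have [u e] := sdi_le mx ax le; exists u, [::]; rewrite cats0 -e.
by have [u e] := sdi_le ax mx le; exists [::], u; rewrite cats0 -e.
Qed.

End OrthogonalWords.
#[global] Hint Resolve sdi_nil sdi_wcat : core.

Definition locally_affine (f : cantor_space -> cantor_space) :=
  forall x, exists m w, sdi m x /\ forall y, f (wcat m y) = wcat w y.

Lemma locally_affine_continuous f : locally_affine f -> continuous f.
Proof.
move=> lf x U /nbhs_sdi[n nU]; have [m [w [mx mw]]] := lf x.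
have wx : sdi w (f x) by rewrite -(wcat_shift mx) mw.
have [k [v [e kx]]] := sdi_open wx (sdi_pref n (f x)).
have mkx : sdi (m ++ k) x.
  by move: kx; rewrite -(wcat_shift mx) mw !sdi_catE.
apply: filterS (sdi_nbhs mkx) => y [z _ <-] /=; rewrite wcat_cat mw.
by apply: nU; rewrite -wcat_cat e wcat_cat.
Qed.

Lemma locally_affine_inv f g :
  cancel f g -> cancel g f -> locally_affine f -> locally_affine g.
Proof.
move=> fK gK lf x; have [m [w [mx mw]]] := lf (g x); exists w, m; split.
  by rewrite -(gK x) -(wcat_shift mx) mw.
by move=> y; rewrite -mw fK.
Qed.

Definition affine_homeo f g (fK : cancel f g) (gK : cancel g f)
    (lf : locally_affine f) : homeo :=
  Homeo fK gK (locally_affine_continuous lf)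
    (locally_affine_continuous (locally_affine_inv fK gK lf)).

(** Elements of V are built from bijections that are affine near each point: continuity in both
    directions follows, and compactness, through [thompsonV_local], supplies the two partitions. *)
Definition affine_V f g (fK : cancel f g) (gK : cancel g f)
    (lf : locally_affine f) : thompsonV :=
  @SgIn _ thompsonV (affine_homeo fK gK lf)
    (proj2 (thompsonV_local (affine_homeo fK gK lf)) lf).

Section Swap.
Implicit Types (m w a b c u : word) (x y z : cantor_space) (v g : thompsonV).

Definition swap_fun a b x :=
  if `[< sdi a x >] then wcat b (shift (size a) x)
  else if `[< sdi b x >] then wcat a (shift (size b) x) else x.

Lemma swap_funl a b y : swap_fun a b (wcat a y) = wcat b y.
Proof. by rewrite /swap_fun asboolT // shift_wcat. Qed.

Lemma swap_funr a b y : ortho a b -> swap_fun a b (wcat b y) = wcat a y.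
Proof.
move=> ab; rewrite /swap_fun asboolF ?asboolT ?shift_wcat // => ay.
exact: (ab _ ay).
Qed.

Lemma swap_fun_id a b x : ~ sdi a x -> ~ sdi b x -> swap_fun a b x = x.
Proof. by move=> ax bx; rewrite /swap_fun !asboolF. Qed.

Lemma swap_funK a b : ortho a b -> involutive (swap_fun a b).
Proof.
move=> ab x; have [[y _ <-]|ax] := pselect (sdi a x).
  by rewrite swap_funl swap_funr.
have [[y _ <-]|bx] := pselect (sdi b x); first by rewrite swap_funr // swap_funl.
by rewrite !swap_fun_id.
Qed.

Lemma swap_fun_affine a b : ortho a b -> locally_affine (swap_fun a b).
Proof.
move=> ab x; have [ax|ax] := pselect (sdi a x).
  by exists a, b; split=> // y; rewrite swap_funl.
have [bx|bx] := pselect (sdi b x).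
  by exists b, a; split=> // y; rewrite swap_funr.
have [m [mx ma]] := sdi_closed ax; have [w [wx wb]] := sdi_closed bx.
have [u [s [e ux]]] := sdi_open mx wx.
exists (m ++ u), (m ++ u); split=> // y; rewrite swap_fun_id //.
  by move=> /(@ortho_catl _ _ u ma); apply.
by rewrite e => /(@ortho_catl _ _ s wb); apply.
Qed.

(** The value 1 on words that are not orthogonal makes [swap] total, so that [swapK], [swapC] and
    [swap_id] hold for all pairs of words. *)
Definition swap a b : thompsonV :=
  if pselect (ortho a b) is left ab
  then affine_V (swap_funK ab) (swap_funK ab) (swap_fun_affine ab) else 1.

Lemma swapE a b : ortho a b -> sgval (swap a b) =1 swap_fun a b.
Proof. by move=> ab x; rewrite /swap; case: pselect. Qed.

Lemma swapl a b : ortho a b -> acts_on (sgval (swap a b)) a b.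
Proof. by move=> ab y; rewrite swapE // swap_funl. Qed.

Lemma swapr a b : ortho a b -> acts_on (sgval (swap a b)) b a.
Proof. by move=> ab y; rewrite swapE // swap_funr. Qed.

Lemma swap_id a b x : ~ sdi a x -> ~ sdi b x -> sgval (swap a b) x = x.
Proof.
move=> ax bx; rewrite /swap; case: pselect => //= ab.
by rewrite swap_fun_id.
Qed.

Lemma swap_ortho a b c : ortho c a -> ortho c b ->
  acts_on (sgval (swap a b)) c c.
Proof.
by move=> ca cb y; apply: swap_id; [apply: (ca (wcat c y))|apply: (cb (wcat c y))].
Qed.

Lemma thompsonV_eq v g : sgval v =1 sgval g -> v = g.
Proof. by move=> vg; apply: sgval_inj; apply: homeo_inj. Qed.

Lemma VM v g x : sgval (v * g) x = sgval v (sgval g x). Proof. by []. Qed.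
Lemma V1 x : sgval (1 : thompsonV) x = x. Proof. by []. Qed.
Lemma VK v : cancel (sgval v) (sgval v^-1).
Proof. by move=> x; apply: hfunK. Qed.
Lemma VVK v : cancel (sgval v^-1) (sgval v).
Proof. by move=> x; apply: hinvK. Qed.
Lemma V_inj v : injective (sgval v). Proof. exact: can_inj (VK v). Qed.

Lemma acts_onM v g m w u : acts_on (sgval g) m w -> acts_on (sgval v) w u ->
  acts_on (sgval (v * g)) m u.
Proof. by move=> gm vw y; rewrite VM gm vw. Qed.

Lemma acts_onV v m w : acts_on (sgval v) m w -> acts_on (sgval v^-1) w m.
Proof. by move=> vm y; rewrite -vm VK. Qed.

Lemma acts_on_sdi v m w x : acts_on (sgval v) m w -> sdi w (sgval v x) <-> sdi m x.
Proof.
move=> vm; split=> [[y _ /esym]|[y _ <-]]; last by rewrite vm.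
by rewrite -vm => /V_inj ->.
Qed.

Lemma acts_on_ortho v a a' b b' : acts_on (sgval v) a a' ->
  acts_on (sgval v) b b' -> ortho a b -> ortho a' b'.
Proof.
move=> va vb ab x [y _ <-]; rewrite -va => /(acts_on_sdi _ vb).
exact: ab.
Qed.

Lemma V_local v x : exists m w, sdi m x /\ acts_on (sgval v) m w.
Proof. exact: (proj1 (thompsonV_local _) (sgvalP v)). Qed.

Lemma swapK a b : swap a b * swap a b = 1.
Proof.
apply: thompsonV_eq => x; rewrite VM V1 /swap.
by case: pselect => //= ab; rewrite swap_funK.
Qed.

Lemma swapV a b : (swap a b)^-1 = swap a b.
Proof. by apply: (@mulgI _ (swap a b)); rewrite mulgV swapK. Qed.

Lemma swapC a b : swap a b = swap b a.
Proof.
have [ab|nab] := pselect (ortho a b); last first.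
  rewrite /swap; case: pselect => // _; case: pselect => // ba.
  by have := nab (ortho_sym ba).
have ba := ortho_sym ab; apply: thompsonV_eq => x.
have [[y _ <-]|ax] := pselect (sdi a x); first by rewrite swapl // swapr.
have [[y _ <-]|bx] := pselect (sdi b x); first by rewrite swapr // swapl.
by rewrite !swap_id.
Qed.

Lemma conj_swap g a b a' b' : ortho a b ->
  acts_on (sgval g) a a' -> acts_on (sgval g) b b' ->
  g * swap a b * g^-1 = swap a' b'.
Proof.
move=> ab ga gb; have ab' := acts_on_ortho ga gb ab.
suff e : g * swap a b = swap a' b' * g by rewrite e mulgK.
apply: thompsonV_eq => x; rewrite !VM.
have [[y _ <-]|ax] := pselect (sdi a x).
  by rewrite swapl // ga swapl.
have [[y _ <-]|bx] := pselect (sdi b x).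
  by rewrite swapr // gb swapr.
by rewrite !swap_id ?(acts_on_sdi _ ga) ?(acts_on_sdi _ gb).
Qed.

Lemma sdi_split a x : sdi a x <-> sdi (rcons a false) x \/ sdi (rcons a true) x.
Proof.
rewrite -!cats1; split=> [[y _ <-]|]; last by case=> /sdi_sub.
rewrite !sdi_catE; case y0: (y 0%N); [right|left];
  by apply/sdi_nth => -[].
Qed.

(** Halving creates room: each factor leaves the other half of [a] fixed, so its two words never
    cover the whole space. *)
Lemma swap_split a b : ortho a b ->
  swap a b = swap (rcons a false) (rcons b false)
             * swap (rcons a true) (rcons b true).
Proof.
have o c s : ortho (rcons c s) (rcons c (~~ s)) by apply: ortho_rcons.
move=> ab; apply: thompsonV_eq => x; rewrite VM.
have ab' s t : ortho (rcons a s) (rcons b t).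
  by rewrite -!cats1; apply: ortho_catl; apply: ortho_catr.
have swl s y : sgval (swap a b) (wcat (rcons a s) y) = wcat (rcons b s) y.
  by rewrite -!cats1 !wcat_cat swapl.
have swr s y : sgval (swap a b) (wcat (rcons b s) y) = wcat (rcons a s) y.
  by rewrite -!cats1 !wcat_cat swapr.
have ba' s t : ortho (rcons b s) (rcons a t) by apply: ortho_sym.
have [/sdi_split[]|ax] := pselect (sdi a x).
- move=> [y _ <-]; rewrite swl.
  by rewrite (@swap_ortho _ _ (rcons a false) (o a false)) ?swapl.
- move=> [y _ <-]; rewrite swl swapl //.
  by rewrite (@swap_ortho _ _ (rcons b true) (ba' _ _) (o b true)).
have [/sdi_split[]|bx] := pselect (sdi b x).
- move=> [y _ <-]; rewrite swr.
  by rewrite (@swap_ortho _ _ (rcons b false) (ba' _ _) (o b false)) ?swapr.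
- move=> [y _ <-]; rewrite swr swapr //.
  by rewrite (@swap_ortho _ _ (rcons a true) (o a true)).
by rewrite !swap_id // => h; (try by apply: ax; apply/sdi_split; auto);
  apply: bx; apply/sdi_split; auto.
Qed.

(** The words [a] and [a ++ u] overlap, so one transposition cannot do this; the detour through the
    disjoint word [e] can. *)
Lemma contract_V e a u : ortho e a ->
  acts_on (sgval (swap e (a ++ u) * swap a e)) a (a ++ u).
Proof.
by move=> ea; apply: acts_onM (swapl (ortho_sym ea)) (swapl (@ortho_catr _ _ u ea)).
Qed.

End Swap.

(** * V is generated by transpositions *)

Section Generation.
Implicit Types (m w a b c p q : word) (x y z : cantor_space) (v g : thompsonV).
Implicit Types (s : seq word) (t : seq (word * word)).

(** A standard dyadic partition as a list, that is, a complete prefix code. Counting prefixes makes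
    permutations and the merging of siblings immediate. *)
Definition code s := forall x, count (fun m => pref (size m) x == m) s = 1%N.

Lemma code_perm s s' : perm_eq s s' -> code s -> code s'.
Proof. by move=> /permP ss' cs x; rewrite -ss' cs. Qed.

Lemma code_uniq s : code s -> uniq s.
Proof.
move=> cs; apply: count_mem_uniq => m.
have [ms|/count_memPn -> //] := boolP (m \in s).
apply/eqP; rewrite eqn_leq -has_count has_pred1 ms andbT.
rewrite (leq_trans _ (eq_leq (cs (wcat m (fun=> false))))) //.
by apply: sub_count => _ /= /eqP ->; rewrite pref_wcat.
Qed.

Lemma code_mem s x : code s -> exists2 m, m \in s & sdi m x.
Proof.
move=> cs; have : has (fun m => pref (size m) x == m) s by rewrite has_count cs.
by move=> /hasP[m ms /eqP e]; exists m => //; rewrite -e; apply: sdi_pref.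
Qed.

Lemma code_ortho s m w : code s -> m \in s -> w \in s -> m <> w -> ortho m w.
Proof.
move=> cs ms ws mw x /sdiP mx /sdiP wx; have := cs x.
have /permP -> := perm_to_rem ms; rewrite /= -mx eqxx => -[] /eqP.
rewrite -leqn0 leqNgt -has_count => /hasP; apply; exists w; last by rewrite -wx.
by rewrite mem_rem_uniq ?code_uniq // inE ws andbT; apply/eqP/nesym.
Qed.

Lemma code_nil s : code s -> [::] \in s -> s = [:: [::]].
Proof.
move=> cs s0; have /eqP := cs (fun=> false).
have /permP -> := perm_to_rem s0; rewrite /= => /eqP[] /eqP.
have uS := code_uniq cs.
case: s cs s0 uS => [//|m [|w s]] cs s0 uS _.
  by move: s0; rewrite inE => /eqP <-.
have [m0|m0] := eqVneq m [::].
  have : m != w by move: uS => /= /andP[]; rewrite inE negb_or => /andP[].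
  move=> /eqP/(code_ortho cs (mem_head _ _)); rewrite m0 => h.
  by case: (h _ (wcat w (fun=> false))); rewrite ?inE ?eqxx ?orbT.
have /eqP/(code_ortho cs (mem_head _ _) s0) h := m0.
by case: (h (wcat m (fun=> false))).
Qed.

(** A longest word of the code has its sibling in the code: the word of the code that covers a point
    of the sibling cylinder is not longer than the sibling, and a strictly shorter one would also be
    a prefix of the longest word. *)
Lemma code_sibling s : code s -> s <> [:: [::]] ->
  exists p, rcons p false \in s /\ rcons p true \in s.
Proof.
move=> cs s1; have [m0 ms0 _] := code_mem (fun=> false) cs.
have [m ms mmax] : exists2 m, m \in s & forall w, w \in s -> (size w <= size m)%N.
  elim: s {cs s1} m0 ms0 => // a s IHs m0 _.
  case: s IHs => [_|b s /(_ _ (mem_head _ _))[m ms mm]].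
    by exists a; rewrite ?mem_head // => w; rewrite inE => /eqP ->.
  have [am|ma] := leqP (size a) (size m).
    exists m; first by rewrite inE ms orbT.
    by move=> w; rewrite inE => /predU1P[->//|/mm].
  exists a; first exact: mem_head.
  by move=> w; rewrite inE => /predU1P[->//|/mm /leq_trans]; apply; apply: ltnW.
case/lastP: m ms mmax => [/(code_nil cs)//|p d] pd mmax.
exists p; suff : rcons p (~~ d) \in s by case: d pd {mmax} => /= -> ->.
have [w ws wx] := code_mem (wcat (rcons p (~~ d)) (fun=> false)) cs.
have wd : (size w <= size (rcons p (~~ d)))%N.
  by have := mmax _ ws; rewrite !size_rcons.
have [u e] := sdi_le wx (sdi_wcat _ _) wd.
case/lastP: u e => [|u d']; first by rewrite cats0 => ->.
rewrite -rcons_cat => /rcons_inj[e _]; exfalso.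
have pw : rcons p d <> w.
  by move=> /(congr1 size); rewrite e size_rcons size_cat; lia.
apply: (code_ortho cs pd ws pw (sdi_wcat _ (fun=> false))).
by rewrite e -cats1 -catA wcat_cat; apply: sdi_wcat.
Qed.

Lemma code_merge p s :
  code [:: rcons p false, rcons p true & s] -> code (p :: s).
Proof.
move=> cs x; rewrite -(cs x) /= addnA; congr addn.
have in_pref m : (pref (size m) x == m) = `[< sdi m x >].
  by apply/eqP/asboolP => [e|/sdiP/esym //]; move: (sdi_pref (size m) x); rewrite e.
rewrite !in_pref; case: asboolP => [/sdi_split[] px|px].
- rewrite asboolT // asboolF // => px'; exact: (@ortho_rcons p false _ px px').
- rewrite asboolF ?asboolT // => px'; exact: (@ortho_rcons p false _ px' px).
- by rewrite !asboolF // => h; apply: px; apply/sdi_split; auto.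
Qed.

Lemma unzip2_inj t a b c :
  uniq (unzip2 t) -> (a, c) \in t -> (b, c) \in t -> a = b.
Proof.
elim: t => //= -[m w] t IHt /= /andP[wt ut]; rewrite !inE.
have nc d : (d, w) \in t -> False by move=> dt; case/mapP: wt; exists (d, w).
move=> /predU1P[[-> cw]|at_] /predU1P[[-> cw']|bt] //.
- by case: (nc b); rewrite -cw.
- by case: (nc a); rewrite -cw'.
- exact: IHt at_ bt.
Qed.

(** A description of [v] by two matched codes. It is far from unique, and the number of its rows is
    the measure of the induction in [V_swap_ind]. *)
Definition table v t := [/\ code (unzip1 t), code (unzip2 t) &
  forall r, r \in t -> acts_on (sgval v) r.1 r.2].

Lemma sdp_code n (m : 'I_n -> word) : sdp m -> code (map m (enum 'I_n)).
Proof.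
move=> [mI mT] x; have : [set: cantor_space] x by []; rewrite -mT => -[k _ kx].
rewrite count_map (@eq_count _ _ (pred1 k)); last first.
  move=> j /=; apply/eqP/eqP => [e|->]; last by rewrite -(sdiP kx).
  by apply: mI => //; exists x; split=> //; rewrite -e; apply: sdi_pref.
by rewrite count_uniq_mem ?enum_uniq // mem_enum.
Qed.

Lemma V_table v : exists t, table v t.
Proof.
have [n [m [w [mP wP vmw]]]] := sgvalP v.
exists [seq (m k, w k) | k <- enum 'I_n]; split.
- by rewrite /unzip1 -map_comp; apply: sdp_code.
- by rewrite /unzip2 -map_comp; apply: sdp_code.
- by move=> _ /mapP[k _ ->] y; apply: vmw.
Qed.

Definition word_swap a b c := if c == a then b else if c == b then a else c.

Lemma word_swapK a b : involutive (word_swap a b).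
Proof.
move=> c; rewrite /word_swap; case: (eqVneq c a) => [->|ca].
  by rewrite eqxx; case: eqVneq.
by case: (eqVneq c b) => [->|cb]; rewrite ?eqxx // (negPf ca) (negPf cb).
Qed.

Lemma table_swap v t a b : table v t -> a \in unzip2 t -> b \in unzip2 t ->
  table (if a == b then v else swap a b * v)
        [seq (r.1, word_swap a b r.2) | r <- t].
Proof.
move=> [c1 c2 vt] at_ bt; split.
- by rewrite /unzip1 -map_comp.
- have -> : unzip2 [seq (r.1, word_swap a b r.2) | r <- t]
            = map (word_swap a b) (unzip2 t) by rewrite /unzip2 -!map_comp.
  apply: (code_perm _ c2); apply: uniq_perm; first exact: code_uniq.
    by rewrite (map_inj_uniq (can_inj (word_swapK a b))) code_uniq.
  move=> c.
  rewrite -[X in _ = (X \in _)](word_swapK a b).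
  rewrite (mem_map (can_inj (word_swapK a b))).
  rewrite /word_swap; have [->|_] := eqVneq c a; first by rewrite at_ bt.
  by have [->|//] := eqVneq c b; rewrite at_ bt.
move=> _ /mapP[[m c] mc ->] /=; have ct : c \in unzip2 t by apply/mapP; exists (m, c).
rewrite /word_swap; have [<-|/eqP ab] := eqVneq a b.
  by have [e|_] := eqVneq c a; rewrite -?e; apply: vt mc.
have oab := code_ortho c2 at_ bt ab.
apply: (acts_onM (vt _ mc)) => /=.
have [->|/eqP ca] := eqVneq c a; first exact: swapl.
have [->|/eqP cb] := eqVneq c b; first exact: swapr.
by apply: swap_ortho; apply: (code_ortho c2).
Qed.

Lemma table_merge v t p q : table v t ->
  (rcons p false, rcons q false) \in t -> (rcons p true, rcons q true) \in t ->
  exists2 t', table v t' & (size t' < size t)%N.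
Proof.
move=> [c1 c2 vt] t0 t1; pose r0 := (rcons p false, rcons q false).
pose r1 := (rcons p true, rcons q true).
have t1' : r1 \in rem r0 t.
  rewrite mem_rem_uniq; last exact: map_uniq (code_uniq c1).
  by rewrite inE t1 andbT; apply/eqP => -[/rcons_inj[]].
have pt : perm_eq t [:: r0, r1 & rem r1 (rem r0 t)].
  by rewrite (permPl (perm_to_rem t0)) perm_cons perm_to_rem.
exists ((p, q) :: rem r1 (rem r0 t)); last by rewrite (perm_size pt).
split=> [||r].
- by apply: code_merge; apply: code_perm c1; apply: perm_map pt.
- by apply: code_merge; apply: code_perm c2; apply: perm_map pt.
rewrite inE => /predU1P[->/= y|/mem_rem/mem_rem/vt //].
have [/vt /= v0 /vt /= v1] := conj t0 t1.
have yE : y = wcat [:: y 0%N] (shift 1 y) by rewrite -[LHS](wcat_pref 1).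
by rewrite yE -!wcat_cat !cats1; case: (y 0%N); rewrite ?v0 ?v1.
Qed.

Lemma table_nil v : table v [:: ([::], [::])] -> v = 1.
Proof.
move=> [_ _ /(_ _ (mem_head _ _)) /= v1]; apply: thompsonV_eq => x.
by rewrite -{1}[x]wcat0 v1 wcat0.
Qed.

(** Induction on the number of rows of a table. Unless the table is trivial, its domain code and its
    range code each contain a pair of siblings; at most two transpositions match the two pairs, and
    then two rows merge into one. *)
Lemma V_swap_ind (S : set thompsonV) : S 1 ->
  (forall a b v, ortho a b -> S v -> S (swap a b * v)) -> forall v, S v.
Proof.
move=> S1 Sswap v; have [t] := V_table v.
have [n] := ubnP (size t); elim: n v t => // n IHn v t tn vt.
have S_swap g r a b : table g r -> a \in unzip2 r -> b \in unzip2 r ->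
    S (if a == b then g else swap a b * g) -> S g.
  move=> [_ c2 _] ra rb; case: eqVneq => // /eqP ab /(Sswap a b).
  by rewrite mulgA swapK mul1g; apply; apply: (code_ortho c2).
have [c1 c2 _] := vt.
have [e1|/eqP /(code_sibling c1)[p [p0 p1]]] := eqVneq (unzip1 t) [:: [::]].
  have -> : v = 1 => //; apply: table_nil; suff <- : t = [:: ([::], [::])] by [].
  case: t e1 c2 {tn vt c1} => [//|[a b] [|//]] /= [->] c2.
  case: b c2 => // d b /(code_mem (fun=> ~~ d))[m].
  by rewrite inE => /eqP -> /sdi_nth/(_ 0%N isT) /=; case: d.
have [q [q0 q1]] : exists q, rcons q false \in unzip2 t /\ rcons q true \in unzip2 t.
  apply: code_sibling c2 _ => e2; have := congr1 size e2; rewrite size_map => st.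
  have := code_ortho c1 p0 p1; case: t st p0 p1 {vt c1 e2 tn} => [|r [|]] //= _.
  by rewrite !inE => /eqP <- /eqP /rcons_inj[].
case/mapP: p0 => -[m0 w0] tm0 /= e0; subst m0.
have tw0 : w0 \in unzip2 t by apply/mapP; exists (rcons p false, w0).
apply: (S_swap _ _ _ _ vt tw0 q0); have := table_swap vt tw0 q0.
set v1 := (if _ then _ else _); set t1 := map _ t => vt1.
have [c11 c21 _] := vt1.
have t1E : unzip1 t1 = unzip1 t by rewrite /unzip1 -map_comp.
have t1p0 : (rcons p false, rcons q false) \in t1.
  by apply/mapP; exists (rcons p false, w0); rewrite //= /word_swap eqxx.
have t1q1 : rcons q true \in unzip2 t1.
  have -> : unzip2 t1 = map (word_swap w0 (rcons q false)) (unzip2 t).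
    by rewrite /unzip2 -!map_comp.
  rewrite -[X in X \in _](word_swapK w0 (rcons q false)).
  rewrite (mem_map (can_inj (word_swapK _ _))) /word_swap.
  have [_|_] := eqVneq (rcons q true) w0; first exact: q0.
  by have [_|_] := eqVneq (rcons q true) (rcons q false).
rewrite -t1E in p1; case/mapP: p1 => -[m1 w1] tm1 /= e1; subst m1.
have tw1 : w1 \in unzip2 t1 by apply/mapP; exists (rcons p true, w1).
apply: (S_swap _ _ _ _ vt1 tw1 t1q1); have := table_swap vt1 tw1 t1q1.
set v2 := (if _ then _ else _); set t2 := map _ t1 => vt2.
have t2p1 : (rcons p true, rcons q true) \in t2.
  by apply/mapP; exists (rcons p true, w1); rewrite //= /word_swap eqxx.
(* The first matched row survives the second exchange, since its image is neither [w1] nor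
   [rcons q true]. *)
have t2p0 : (rcons p false, rcons q false) \in t2.
  apply/mapP; exists (rcons p false, rcons q false) => //=; rewrite /word_swap.
  have [e|_] := eqVneq (rcons q false) w1; last first.
    by case: eqVneq => // /rcons_inj[].
  by rewrite -e in tm1; case/rcons_inj: (unzip2_inj (code_uniq c21) t1p0 tm1).
have [t' vt' st'] := table_merge vt2 t2p0 t2p1.
by apply: IHn vt'; rewrite (leq_trans st') // !size_map -ltnS.
Qed.
End Generation.

(** * Simplicity of V *)

Section Simplicity.
Implicit Types (m w a b c e : word) (x y z : cantor_space) (v g h : thompsonV).

(** The cylinder is found inside a prescribed [m], so that several displacement conditions can be
    imposed one after the other. *)
Lemma displaced v x m : sgval v x <> x -> sdi m x ->
  exists u b, [/\ sdi (m ++ u) x, ortho (m ++ u) b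
                & acts_on (sgval v) (m ++ u) b].
Proof.
move=> vx mx; have [k [w [kx kw]]] := V_local v x.
(* This length leaves at least N letters after [k], so that the image word [w ++ u'] is also long
   enough for [NP]. *)
have [N NP] := neq_ortho (nesym vx); pose n := (N + size k + size m)%N.
have nx := sdi_pref n x; have nn : size (pref n x) = n by rewrite size_mkseq.
have [u e] : exists u, pref n x = m ++ u by apply: sdi_le nx _ => //; lia.
have [u' e'] : exists u, pref n x = k ++ u by apply: sdi_le nx _ => //; lia.
have vxw : sdi (w ++ u') (sgval v x).
  move: nx; rewrite e' -(wcat_shift kx) kw !sdi_catE //.
exists u, (w ++ u'); rewrite -e; split=> //; last first.
  by rewrite e'; apply: acts_on_cat.
rewrite (sdiP vxw); apply: NP; first by rewrite /n; lia.
rewrite size_cat; have := congr1 size e'; rewrite nn size_cat /n; lia.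
Qed.

Lemma V_displaced v : v <> 1 -> exists x, sgval v x <> x.
Proof.
move=> v1; apply: contrapT => /forallNP h; apply: v1; apply: thompsonV_eq => x.
exact: contrapT (h x).
Qed.

Lemma swap_moves a b y : ortho a b -> sgval (swap a b) (wcat a y) <> wcat a y.
Proof. by move=> ab; rewrite swapl // => e; apply: (ab (wcat a y)) => //; rewrite -e. Qed.

Lemma ortho_cat a b u w : ortho a b -> ortho (a ++ u) (b ++ w).
Proof. by move=> ab; apply: ortho_catl; apply: ortho_catr. Qed.

Lemma ortho_catS a s t u w : s != t -> ortho (a ++ s :: u) (a ++ t :: w).
Proof.
move=> st; apply: ortho_cat2; have := @ortho_rcons [::] s.
have -> : ~~ s = t by case: s t st => -[].
exact: ortho_cat.
Qed.

Lemma swap_cat2 a u w x : ~ sdi a x -> sgval (swap (a ++ u) (a ++ w)) x = x.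
Proof. by move=> ax; apply: swap_id => /sdi_sub. Qed.

Lemma V_noncommuting a : exists g h,
  [/\ forall x, ~ sdi a x -> sgval g x = x,
      forall x, ~ sdi a x -> sgval h x = x & g * h <> h * g].
Proof.
exists (swap (a ++ [:: false]) (a ++ [:: true])).
exists (swap (a ++ [:: false; false]) (a ++ [:: false; true])).
split=> [x|x|]; try exact: swap_cat2.
pose y := wcat (a ++ [:: false; false]) (fun=> false).
have cat2 s t : a ++ [:: s; t] = (a ++ [:: s]) ++ [:: t] by rewrite -catA.
have o : ortho (a ++ [:: false]) (a ++ [:: true]) by apply: ortho_catS.
have o1 : ortho (a ++ [:: false; false]) (a ++ [:: false; true]).
  by rewrite !cat2; apply: ortho_catS.
have gE s : sgval (swap (a ++ [:: false]) (a ++ [:: true]))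
    (wcat (a ++ [:: false; s]) (fun=> false)) = wcat (a ++ [:: true; s]) (fun=> false).
  by rewrite !cat2 wcat_cat swapl // -wcat_cat.
move=> /(congr1 (fun v => sgval v y)); rewrite !VM /y (swapl o1) !gE.
rewrite swap_id; try by apply: (@ortho_catS a true false) (sdi_wcat _ _).
by rewrite !wcat_cat => /wcat_inj /(congr1 (fun f => f 1%N)).
Qed.

(** A double commutator puts one explicit transposition into P; conjugation spreads it to all
    transpositions that leave some cylinder free, and these generate V. *)
Lemma V_simple (P : nsubgroup thompsonV) p :
  sgset (nsg P) p -> p <> 1 -> forall v, sgset (nsg P) v.
Proof.
set Q := sgset _ => Pp /V_displaced[x0 px0].
have PM := @sgM _ (nsg P); have PV := @sgV _ (nsg P).
have PJ g v : Q v <-> Q (g * v * g^-1).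
  split=> [|/(@nsgJ _ P g^-1)]; first exact: nsgJ.
  by rewrite invgK !mulgA mulVg mul1g mulgVK.
have [a [b [_ ab pab]]] : exists a b,
    [/\ sdi a x0, ortho a b & acts_on (sgval p) a b].
  by have [u [b]] := displaced px0 (sdi_nil x0); exists u, b.
(* [p] carries the transposition [s] of two quarters of [a] to [s'] inside the disjoint [b], so s' s
   is the commutator of [p] and [s]. As [sg] acts only inside [a], the commutator of s' s with [sg]
   loses its part in [b]; up to conjugation by [s'] it is the product of two exchanges of quarters,
   which is the exchange of the halves of [a]. *)
have Pa : Q (swap (rcons a false) (rcons a true)).
  pose w (c : word) s t := c ++ [:: s; t].
  have wE c s t : rcons (rcons c s) t = w c s t.
    by rewrite -!cats1 -catA.
  pose s := swap (w a false false) (w a true false).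
  pose s' := swap (w b false false) (w b true false).
  have os c r1 r2 : ortho (w c false r1) (w c true r2) by apply: ortho_catS.
  have os2 c r : ortho (w c r false) (w c r true).
    by rewrite -!wE; apply: (@ortho_rcons _ false).
  have Ps : Q (s' * s).
    have -> : s' * s = p * (s * p^-1 * s^-1).
      rewrite /s' -(@conj_swap p (w a false false) (w a true false)) //.
      - by rewrite -/s swapV !mulgA.
      - exact: acts_on_cat.
      - exact: acts_on_cat.
    by apply: PM => //; apply: (proj1 (PJ _ _)); apply: PV.
  pose sg := swap (w a false false) (w a false true)
             * swap (w a true false) (w a true true).
  have ws c d r1 r2 r3 r4 : ortho c d -> ortho (w c r1 r2) (w d r3 r4).
    by move=> cd; apply: ortho_cat.
  have sgs' : sg * s' * sg^-1 = s'.
    apply: conj_swap => //; apply: (@acts_onM _ _ _ (w b _ false));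
      by apply: swap_ortho; apply: ws; apply: ortho_sym.
  have sgs : sg * s * sg^-1 = swap (w a false true) (w a true true).
    apply: conj_swap => //.
    - apply: (@acts_onM _ _ _ (w a false false)); last exact: swapl.
      exact: swap_ortho.
    - apply: (@acts_onM _ _ _ (w a true true)); first exact: swapl.
      by apply: swap_ortho; apply: ortho_sym.
  have e : s * (sg * s * sg^-1) = swap (rcons a false) (rcons a true).
    by rewrite sgs [RHS]swap_split ?wE //; apply: (@ortho_rcons _ false).
  have sV : s^-1 = s by apply: swapV.
  have s'V : s'^-1 = s' by apply: swapV.
  clearbody s s' sg; apply: (proj2 (PJ s' _)); rewrite -e.
  have -> : s' * (s * (sg * s * sg^-1)) * s'^-1
          = (s' * s) * (sg * (s' * s)^-1 * sg^-1).
    have -> : sg * (s' * s)^-1 * sg^-1 = (sg * s * sg^-1) * (sg * s' * sg^-1).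
      by rewrite invgM sV s'V !mulgA mulgVK.
    by rewrite sgs' s'V !mulgA.
  by apply: PM => //; apply: (proj1 (PJ _ _)); apply: PV.
have Pe e e' : ortho e e' -> Q (swap (rcons e false) (rcons e true)) ->
    Q (swap (rcons e' false) (rcons e' true)).
  move=> ee' /(PJ (swap e e')); rewrite (@conj_swap _ _ _ (rcons e' false) (rcons e' true)) //.
  - exact: (@ortho_rcons _ false).
  - by rewrite -!cats1; apply: acts_on_cat; apply: swapl.
  - by rewrite -!cats1; apply: acts_on_cat; apply: swapl.
(* If [a] and [e] are not orthogonal they are nested, and a word disjoint from the larger cylinder
   serves as an intermediate stop. *)
have Pall e : e <> [::] -> Q (swap (rcons e false) (rcons e true)).
  move=> e0; have [ae|/orthoPn[u ue]] := pselect (ortho a e); first exact: Pe Pa.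
  have [c [ca ce]] : exists c, ortho c a /\ ortho c e.
    case: ue => eq; [have [c oc] := ortho_head (ortho_neq0 ab)|
                      have [c oc] := ortho_head e0];
    by exists c; split=> //; rewrite eq; apply: ortho_catr.
  by apply: (Pe c) => //; apply: (Pe a) => //; apply: ortho_sym.
(* Exchanging a' and b' with the two halves of the free cylinder [c] conjugates their transposition
   to the one treated in [Pall]. *)
have Proom a' b' c : ortho a' b' -> ortho c a' -> ortho c b' -> Q (swap a' b').
  move=> ab' ca cb.
  apply: (proj2 (PJ (swap b' (rcons c true) * swap a' (rcons c false)) _)).
  rewrite (@conj_swap _ _ _ (rcons c false) (rcons c true)) //.
  - by apply: Pall; apply: ortho_neq0 ca.
  - apply: (@acts_onM _ _ _ (rcons c false)).
      by apply: swapl; rewrite -cats1; apply/ortho_sym/ortho_catl.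
    apply: swap_ortho; last exact: (@ortho_rcons _ false).
    by rewrite -cats1; apply: ortho_catl.
  - apply: (@acts_onM _ _ _ b').
      apply: swap_ortho; first exact: ortho_sym.
      by rewrite -cats1; apply/ortho_sym/ortho_catl.
    by apply: swapl; rewrite -cats1; apply/ortho_sym/ortho_catl.
apply: V_swap_ind; first exact: sg1.
move=> a' b' v ab' Pv; apply: (PM _ _ _ Pv); rewrite swap_split //.
have o s t : ortho (rcons a' s) (rcons b' t).
  by rewrite -!cats1; apply: ortho_cat.
apply: PM.
  by apply: (Proom _ _ (rcons a' true)) => //; apply: (@ortho_rcons _ true).
by apply: (Proom _ _ (rcons a' false)) => //; apply: (@ortho_rcons _ false).
Qed.

(** The kernel contains a nontrivial commutator, so it is all of V. Commutation is asked of the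
    values only, which suits a cocycle with central values in Gamma. *)
Lemma V_hom_abelian_trivial (A : groupType) (chi : thompsonV -> A) :
  {morph chi : v g / v * g} -> (forall v g, commute (chi v) (chi g)) ->
  forall v, chi v = 1.
Proof.
move=> chiM chiC.
have chi1 : chi 1 = 1 by apply: (@mulgI _ (chi 1)); rewrite -chiM !mulg1.
have chiV v : chi v^-1 = (chi v)^-1.
  by apply: (@mulgI _ (chi v)); rewrite -chiM !mulgV.
have KM v g : [set v | chi v = 1] v -> [set v | chi v = 1] g ->
    [set v | chi v = 1] (v * g).
  by rewrite /= chiM => -> ->; rewrite mulg1.
have KV v : [set v | chi v = 1] v -> [set v | chi v = 1] v^-1.
  by rewrite /= chiV => ->; rewrite invg1.
pose K := @Subgroup thompsonV [set v | chi v = 1] chi1 KM KV.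
have KJ g v : sgset K v -> sgset K (g * v * g^-1).
  by move=> /= v1; rewrite !chiM v1 mulg1 -chiM mulgV.
have [g [h [_ _ gh]]] := V_noncommuting [::].
apply: (@V_simple (NSubgroup KJ) (g * h * g^-1 * h^-1)) => /=.
  by rewrite !chiM !chiV (chiC g h) mulgK mulgV.
by move=> e; apply: gh; apply: (@mulIg _ g^-1); apply: (@mulIg _ h^-1); rewrite e mulgK mulgV.
Qed.

End Simplicity.

(** * Rubin's theorem for V *)

Section Rubin.
Implicit Types (m w a b c e : word) (x y z : cantor_space).
Implicit Types (v f g h k : thompsonV) (theta : aut thompsonV).

(** An involution whose support is exactly the cylinder of [a]; it represents the cylinder inside
    the group. *)
Definition flip a := swap (rcons a false) (rcons a true).

Lemma flip_ortho a : ortho (rcons a false) (rcons a true).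
Proof. exact: (@ortho_rcons a false). Qed.

Lemma flip_moves a x : sdi a x -> sgval (flip a) x <> x.
Proof.
have o := @flip_ortho a.
move=> /sdi_split[] [y _ <-]; first exact: swap_moves.
by rewrite /flip swapC; apply: swap_moves; apply: ortho_sym.
Qed.

Lemma flip_id a x : ~ sdi a x -> sgval (flip a) x = x.
Proof.
by move=> ax; apply: swap_id; rewrite -cats1 => /sdi_sub.
Qed.

Lemma conj_flip v a b : acts_on (sgval v) a b -> v * flip a * v^-1 = flip b.
Proof.
move=> vab; apply: conj_swap; rewrite -?cats1.
- by rewrite !cats1; apply: flip_ortho.
- exact: acts_on_cat.
- exact: acts_on_cat.
Qed.

Lemma commute_disjoint f g :
  (forall x, sgval f x = x \/ sgval g x = x) -> f * g = g * f.
Proof.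
move=> fg; apply: thompsonV_eq => x; rewrite !VM.
have [fx|gx] := fg x.
  by rewrite fx; have [//|/V_inj ->] := fg (sgval g x).
by rewrite gx; have [/V_inj -> //|->] := fg (sgval f x).
Qed.

Definition comm f g := f * g * f^-1 * g^-1.

Lemma comm_eq1 f g : comm f g = 1 <-> f * g = g * f.
Proof.
rewrite /comm; split=> [e|->]; last by rewrite mulgK mulgV.
by apply: (@mulIg _ f^-1); apply: (@mulIg _ g^-1); rewrite e mulgK mulgV.
Qed.

(* Rubin's algebraic substitute for disjointness of supports. *)
Definition algdisj f g := forall h, f * h <> h * f -> exists f1 f2,
  [/\ f1 * g = g * f1, f2 * g = g * f2, comm f1 (comm f2 h) <> 1
    & comm f1 (comm f2 h) * g = g * comm f1 (comm f2 h)].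

(** [h] moves some cylinder [a] off itself inside the support of [f], where [g] is trivial. Take f1,
    f2 supported in [a] that do not commute: the part of [f2, h] living on h(a) commutes with f1, so
    [f1, [f2, h]] = [f1, f2], which is nontrivial and supported in [a]. *)
Lemma disjoint_algdisj f g :
  (forall x, sgval f x = x \/ sgval g x = x) -> algdisj f g.
Proof.
move=> fg h fh.
have [x [fx hx]] : exists x, sgval f x <> x /\ sgval h x <> x.
  apply: contrapT => /forallNP nx; apply: fh; apply: commute_disjoint => x.
  by have := nx x; rewrite not_andE !notE.
have [a [fa hA]] : exists a, (forall y, sdi a y -> sgval f y <> y) /\
    exists2 b, ortho a b & acts_on (sgval h) a b.
  have [m0 [b [mx mb fm]]] := displaced fx (sdi_nil x).
  have [u [c [ux uc hu]]] := displaced hx mx.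
  exists (([::] ++ m0) ++ u); split; last by exists c.
  move=> y /sdi_sub my fy; apply: (mb y my).
  by rewrite -fy; apply/(acts_on_sdi _ fm).
have ga y : sdi a y -> sgval g y = y by move=> /fa; case: (fg y).
have [b ab hab] := hA; have [f1 [f2 [f1a f2a f12]]] := V_noncommuting a.
have comm_g k : (forall x, ~ sdi a x -> sgval k x = x) -> k * g = g * k.
  move=> ka; apply: commute_disjoint => y.
  by have [/ga|/ka] := pselect (sdi a y); auto.
have k_in k x' : (forall x, ~ sdi a x -> sgval k x = x) -> ~ sdi a x' ->
    sgval k^-1 x' = x'.
  by move=> ka /ka e; rewrite -[in LHS]e VK.
pose w := h * f2^-1 * h^-1.
have f1w : f1 * w = w * f1.
  apply: commute_disjoint => y; have [ay|] := pselect (sdi a y); last by left; apply: f1a.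
  right; rewrite /w !VM k_in ?VVK // => ahy.
  by apply: (ab y ay); rewrite -[y](VVK h); apply/(acts_on_sdi _ hab).
have f2h : comm f2 h = f2 * w by rewrite /comm /w !mulgA.
have kE : comm f1 (comm f2 h) = comm f1 f2.
  clearbody w; rewrite f2h /comm invgM -!mulgA (mulgA f1^-1).
  have -> : f1^-1 * w^-1 = w^-1 * f1^-1 by rewrite -!invgM f1w.
  by rewrite !mulgA mulgK.
exists f1, f2; rewrite kE; split; try exact: comm_g.
  by move=> /comm_eq1.
apply: comm_g => y ay; rewrite /comm !VM (k_in f2) // (k_in f1) //.
by rewrite f2a ?f1a.
Qed.

(** Here 12 is the least common multiple of 1, 2, 3, 4: if g^12 moves x, so do g, ..., g^4, and some
    cylinder [a] around x is disjoint from f(a) and from g^i(a) for 1 <= i <= 4. With h = [flip a],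
    the element k = [f1, [f2, h]] moves only points of four translates t(a), with each t commuting
    with g. The points moved by k are stable under g, so among q, gq, ..., g^4 q two lie in the same
    t(a), which contradicts the choice of [a]. *)
Lemma algdisj_disjoint f g : algdisj f g ->
  forall x, sgval f x <> x -> sgval (g ^+ 12) x = x.
Proof.
move=> fg x fx; apply: contrapT => gx.
have gi i : (0 < i <= 4)%N -> sgval (g ^+ i) x <> x.
  move=> i4 e; apply: gx.
  have [j ->] : exists j, 12%N = (i * j)%N.
    by case: i i4 {e} => [//|[|[|[|[|//]]]]] _; [exists 12%N|exists 6%N|exists 4%N|exists 3%N].
  by rewrite expgnA; elim: j => // j IHj; rewrite expgS VM IHj.
have away v m : sgval v x <> x -> sdi m x -> exists u, sdi (m ++ u) x /\
    forall y, sdi (m ++ u) y -> ~ sdi (m ++ u) (sgval v y).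
  move=> vx mx; have [u [b [ux ub vu]]] := displaced vx mx.
  exists u; split=> // y uy vy; apply: (ub _ vy).
  exact/(acts_on_sdi _ vu).
have [a [ax fa ga]] : exists a, [/\ sdi a x,
    forall y, sdi a y -> ~ sdi a (sgval f y) &
    forall i y, (0 < i <= 4)%N -> sdi a y -> ~ sdi a (sgval (g ^+ i) y)].
  have [u [ux fu]] := away f [::] fx (sdi_nil x).
  have [u1 [ux1 fu1]] := away _ _ (gi 1%N isT) ux.
  have [u2 [ux2 fu2]] := away _ _ (gi 2%N isT) ux1.
  have [u3 [ux3 fu3]] := away _ _ (gi 3%N isT) ux2.
  have [u4 [ux4 fu4]] := away _ _ (gi 4%N isT) ux3.
  exists ((((([::] ++ u) ++ u1) ++ u2) ++ u3) ++ u4); split=> //.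
    by move=> y /sdi_sub/sdi_sub/sdi_sub/sdi_sub/fu h /sdi_sub/sdi_sub/sdi_sub/sdi_sub.
  case=> [|[|[|[|[|//]]]]] y // _.
  - by move=> /sdi_sub/sdi_sub/sdi_sub/fu1 h /sdi_sub/sdi_sub/sdi_sub.
  - by move=> /sdi_sub/sdi_sub/fu2 h /sdi_sub/sdi_sub.
  - by move=> /sdi_sub/fu3 h /sdi_sub.
  - exact: fu4.
have ha := @flip_id a; set h := flip a in ha.
have hVa y : ~ sdi a y -> sgval h^-1 y = y.
  by rewrite /h /flip swapV; apply: flip_id.
have [f1 [f2 [f1g f2g k1 kg]]] : exists f1 f2,
    [/\ f1 * g = g * f1, f2 * g = g * f2, comm f1 (comm f2 h) <> 1
    & comm f1 (comm f2 h) * g = g * comm f1 (comm f2 h)].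
  apply: fg => /(congr1 (fun v => sgval v x)); rewrite !VM (ha (sgval f x)); last exact: fa.
  by move=> /V_inj; apply: flip_moves.
set k := comm f1 (comm f2 h) in k1 kg.
pose t (r : bool * bool) : thompsonV :=
  (if r.1 then f1 else 1) * (if r.2 then f2 else 1).
have tg r : t r * g = g * t r.
  have tgi (s : bool) k' : k' * g = g * k' ->
      (if s then k' else 1) * g = g * (if s then k' else 1).
    by case: s; rewrite ?mulg1 ?mul1g.
  by rewrite /t -mulgA (tgi r.2) // !mulgA (tgi r.1).
have tgi r i : (t r)^-1 * g ^+ i = g ^+ i * (t r)^-1.
  elim: i => [|i IHi]; first by rewrite mulg1 mul1g.
  rewrite expgS mulgA; have -> : (t r)^-1 * g = g * (t r)^-1.
    by apply: (@mulgI _ (t r)); rewrite mulVKg mulgA tg mulgK.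
  by rewrite -mulgA IHi mulgA.
(* Outside the four translates every occurrence of h or of its inverse in k acts trivially on the
   orbit of q, and the remaining letters cancel. *)
have kmoves q : sgval k q <> q -> exists r, sdi a (sgval (t r)^-1 q).
  move=> kq; apply: contrapT => /forallNP nq; apply: kq.
  have n00 : ~ sdi a q.
    by have := nq (false, false); rewrite /t mul1g invg1.
  have n10 : ~ sdi a (sgval f1^-1 q) by have := nq (true, false); rewrite /t mulg1.
  have n01 : ~ sdi a (sgval f2^-1 q) by have := nq (false, true); rewrite /t mul1g.
  have n11 : ~ sdi a (sgval f2^-1 (sgval f1^-1 q)).
    by have := nq (true, true); rewrite /t invgM.
  rewrite /k /comm !invgM !invgK !VM.
  by rewrite (hVa _ n01) VVK (ha _ n00) (hVa _ n10) (ha _ n11) !VVK.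
clearbody k; have [q kq] := V_displaced k1.
have kgi i : sgval k (sgval (g ^+ i) q) <> sgval (g ^+ i) q.
  elim: i => // i IHi; rewrite expgS VM -(VM k) kg VM => /V_inj; exact: IHi.
have [r rP] : exists r : nat -> bool * bool,
    forall i, sdi a (sgval (t (r i))^-1 (sgval (g ^+ i) q)).
  exists (fun i => sval (cid (kmoves _ (kgi i)))) => i.
  exact: svalP (cid (kmoves _ (kgi i))).
have [i [j [ij j5 rij]]] : exists i j, [/\ (i < j)%N, (j < 5)%N & r i = r j].
  apply: contrapT => nij.
  have : (#|'I_5| <= #|{: bool * bool}|)%N.
    apply: (@leq_card _ _ (fun i : 'I_5 => r i)) => i j rij; apply: val_inj.
    case: (ltngtP i j) => // ij; exfalso; apply: nij.
      by exists i, j; split.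
    by exists j, i; split=> //.
  by rewrite card_ord card_prod card_bool.
have := rP j; rewrite -rij -(subnK (ltnW ij)) expgnDr VM -(VM _ (g ^+ (j - i))).
rewrite tgi VM; apply: ga (rP i).
by rewrite subn_gt0 ij /=; lia.
Qed.

(** Trivial germ at [x]: the negation says that [x] lies in the closure of the support of [v]. *)
Definition fixnear v x := exists2 m, sdi m x & acts_on (sgval v) m m.

Lemma fixnear_fix v x : fixnear v x -> sgval v x = x.
Proof. by case=> m [y _ <-] ->. Qed.

(** On the cylinder of [m], the affine map from [m] to [w] has trivial germs everywhere if m = w and
    nowhere otherwise. Closures of supports are therefore open. *)
Lemma fixnear_closed v x : ~ fixnear v x ->
  exists2 m, sdi m x & forall z, sdi m z -> ~ fixnear v z.
Proof.
move=> vx; have [m [w [mx mw]]] := V_local v x; exists m => //.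
move=> z mz [k kz vk]; apply: vx; exists m => //.
have [u [s [e uz]]] := sdi_open mz kz.
have mu : acts_on (sgval v) (m ++ u) (m ++ u) by rewrite e; apply: acts_on_cat.
have : forall y, wcat (m ++ u) y = wcat (w ++ u) y.
  by move=> y; rewrite -mu wcat_cat mw -wcat_cat.
move=> /[dup] /wcat_size; rewrite !size_cat => /addIn smw.
move=> /(_ (fun=> false)); rewrite !wcat_cat => E.
suff mE : m = w by rewrite {2}mE.
by rewrite -[LHS](pref_wcat m (wcat u (fun=> false))) smw E pref_wcat.
Qed.

Lemma fixnear_conj v g x :
  fixnear v x -> fixnear (g * v * g^-1) (sgval g x).
Proof.
move=> [m mx vm]; have [k [w [kx gk]]] := V_local g x.
have [u [s [e ux]]] := sdi_open mx kx; exists (w ++ s).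
  by apply/(acts_on_sdi _ (acts_on_cat s gk)); rewrite -e.
apply: (@acts_onM _ _ _ (k ++ s)).
  by apply: acts_onV; apply: acts_on_cat.
apply: (@acts_onM _ _ _ (k ++ s)); last exact: acts_on_cat.
by rewrite -e; apply: acts_on_cat.
Qed.

(** Transpositions are killed by the 12th power, so a contraction, of infinite order, is used
    instead. *)
Lemma exists_moving12 a : exists g,
  (forall x, ~ sdi a x -> sgval g x = x) /\
  exists2 x, sdi a x & sgval (g ^+ 12) x <> x.
Proof.
pose a0 := a ++ [:: false]; pose a1 := a ++ [:: true].
have o : ortho a1 a0 by apply: ortho_catS.
exists (swap a1 (a0 ++ [:: false]) * swap a0 a1); split.
  move=> x ax; rewrite VM (swap_cat2 _ _ ax) swap_id //; first by move=> /sdi_sub.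
  by rewrite -catA => /sdi_sub.
exists (wcat a0 (fun=> true)); first by rewrite wcat_cat.
have gn n : acts_on (sgval ((swap a1 (a0 ++ [:: false]) * swap a0 a1) ^+ n))
    a0 (a0 ++ nseq n false).
  elim: n => [|n IHn]; first by rewrite cats0.
  rewrite expgS; apply: (acts_onM IHn); have := contract_V [:: false] o.
  by move=> /(acts_on_cat (nseq n false)); rewrite -[(_ ++ [:: _]) ++ _]catA.
rewrite gn wcat_cat => /wcat_inj /(congr1 (fun r : cantor_space => r 0%N)).
by [].
Qed.

(** A purely algebraic description, hence preserved by automorphisms, of the elements that are
    trivial wherever [f] has trivial germ ([rigid_hullP]). *)
Definition rigid_hull f h := forall g, algdisj f g -> h * g ^+ 12 = g ^+ 12 * h.

(** If h moves a point near which f is trivial, it displaces a small cylinder there, and a g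
    supported in that cylinder with nontrivial 12th power is algebraically disjoint from f but its
    12th power does not commute with h. Conversely, a point moved by g^12 has a neighbourhood moved
    by g^12, on which f must be trivial. *)
Lemma rigid_hullP f h :
  rigid_hull f h <-> forall x, fixnear f x -> sgval h x = x.
Proof.
split=> [fh x [m mx fm]|fh g /algdisj_disjoint fg].
  apply: contrapT => /displaced/(_ mx)[u [b [ux ub hu]]].
  have [g [gid [y uy gy]]] := exists_moving12 (m ++ u).
  have /fh : algdisj f g.
    apply: disjoint_algdisj => z.
    have [[t _ <-]|uz] := pselect (sdi (m ++ u) z); last by right; apply: gid.
    by left; apply: acts_on_cat.
  move=> /(congr1 (fun v => sgval v y)); rewrite (VM h) (VM _ h) => e; apply: gy.
  apply: (@V_inj h); rewrite e.
  have gn n z : ~ sdi (m ++ u) z -> sgval (g ^+ n) z = z.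
    by move=> /gid gz; elim: n => // n IHn; rewrite expgS VM IHn.
  by apply: gn => hy; apply: (ub _ hy); apply/(acts_on_sdi _ hu).
apply: commute_disjoint => x.
have [?|gx] := pselect (sgval (g ^+ 12) x = x); [by right|left; apply: fh].
have [m [b [mx mb gm]]] := displaced gx (sdi_nil x).
exists ([::] ++ m) => // y; apply: contrapT => /fg e.
by apply: (mb (wcat m y)) => //; rewrite -e gm.
Qed.

Lemma aut_comm theta f g : theta (comm f g) = comm (theta f) (theta g).
Proof. by rewrite /comm !afunM !autV. Qed.

Lemma aut_inj_fun theta : injective theta. Proof. exact: can_inj (@afunK _ theta). Qed.

Lemma autX theta f n : theta (f ^+ n) = theta f ^+ n.
Proof. by elim: n => [|n IHn]; rewrite ?aut1 // !expgS afunM IHn. Qed.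

Lemma aut_algdisj theta f g : algdisj f g -> algdisj (theta f) (theta g).
Proof.
move=> fg h fh; have [|f1 [f2 [f1g f2g k1 kg]]] := fg (ainv theta h).
  by move=> /(congr1 theta); rewrite !afunM ainvK.
exists (theta f1), (theta f2); rewrite -!afunM f1g f2g -{1 2 3}(ainvK theta h).
rewrite -!aut_comm -!afunM kg; split=> // /(congr1 (ainv theta)).
by rewrite afunK -(aut1 theta) afunK.
Qed.

Lemma aut_rigid_hull theta f h :
  rigid_hull (theta f) (theta h) <-> rigid_hull f h.
Proof.
split=> fh g fg.
  apply: (@aut_inj_fun theta).
  rewrite (afunM theta h) (afunM theta _ h) autX; apply: fh; exact: aut_algdisj.
rewrite -(ainvK theta g) -autX -!afunM fh //.
rewrite -(afunK theta f) -[ainv theta]/(afun (aut_inv theta)).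
exact: aut_algdisj.
Qed.

(** * Reconstruction of the homeomorphism from an automorphism of V *)

Section Reconstruction.
Variable theta : aut thompsonV.

(** The set onto which the homeomorphism to be built must map the cylinder of [a]: the closed
    support of the image of [flip a]. *)
Definition star a y := ~ fixnear (theta (flip a)) y.

Lemma fixnear_flip a x : fixnear (flip a) x <-> ~ sdi a x.
Proof.
split=> [fx ax|ax]; first exact: flip_moves ax (fixnear_fix fx).
have [m [mx ma]] := sdi_closed ax; exists m => // y.
by rewrite flip_id // => /(ma (wcat m y)); apply.
Qed.

Lemma starP a h : (forall x, ~ sdi a x -> sgval h x = x) <->
  (forall y, ~ star a y -> sgval (theta h) y = y).
Proof.
split=> [ha y /contrapT fy|ha x ax].
  apply: (proj1 (rigid_hullP _ _)) fy; apply/aut_rigid_hull/rigid_hullP => x.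
  by move=> /fixnear_flip; apply: ha.
apply: (proj1 (rigid_hullP (flip a) _)); last exact/fixnear_flip.
by apply/(aut_rigid_hull theta)/rigid_hullP => y fy; apply: ha => /(_ fy).
Qed.

Lemma star_open a y : star a y ->
  exists2 m, sdi m y & forall z, sdi m z -> star a z.
Proof. exact: fixnear_closed. Qed.

Lemma starN_open a y : ~ star a y ->
  exists2 m, sdi m y & forall z, sdi m z -> ~ star a z.
Proof.
by move=> /contrapT[m my am]; exists m => // z mz; apply; exists m.
Qed.

(** If the two stars met they would share a cylinder. Two noncommuting elements supported there pull
    back to elements supported in the disjoint cylinders of [a] and [b], which commute. *)
Lemma star_ortho a b y : ortho a b -> star a y -> star b y -> False.
Proof.
move=> ab /star_open[m my am] /star_open[w wy bw].
have [u [s [e uy]]] := sdi_open my wy.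
have [g [h [gu hu gh]]] := V_noncommuting (m ++ u); apply: gh.
rewrite -(ainvK theta g) -(ainvK theta h) -!afunM; congr (theta _).
have ga : forall x, ~ sdi a x -> sgval (ainv theta g) x = x.
  apply/starP => z az; rewrite ainvK gu // => /sdi_sub/am; exact: az.
have hb : forall x, ~ sdi b x -> sgval (ainv theta h) x = x.
  apply/starP => z az; rewrite ainvK hu // e => /sdi_sub/bw; exact: az.
apply: commute_disjoint => x; have [ax|/ga] := pselect (sdi a x); last by left.
by right; apply: hb => /(ab x ax).
Qed.

Lemma commute_rigid h a x : sdi a x ->
  (forall g, (forall x, ~ sdi a x -> sgval g x = x) -> h * g = g * h) ->
  sgval h x = x.
Proof.
move=> ax hg; apply: contrapT => /displaced/(_ ax)[u [b [ux ub hu]]].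
have := flip_moves ux; apply; apply: (@V_inj h); rewrite -VM hg; last first.
  by move=> y ay; apply: flip_id => /sdi_sub.
by rewrite VM flip_id // => uhx; apply: (ub _ uhx); apply/(acts_on_sdi _ hu).
Qed.

Lemma commute_starN h g a m : (forall x, ~ sdi a x -> sgval h x = x) ->
  (forall z, sdi m z -> ~ star a z) -> (forall x, ~ sdi m x -> sgval (theta g) x = x) ->
  g * h = h * g.
Proof.
move=> ha am gm; apply: (@aut_inj_fun theta); rewrite !afunM.
apply: commute_disjoint => z; have [mz|/gm] := pselect (sdi m z); last by left.
by right; apply: (proj1 (starP a h) ha); apply: am.
Qed.

Lemma star_nil y : star [::] y.
Proof.
apply: contrapT => /starN_open[m my nm].
apply: (flip_moves (sdi_wcat m (fun=> false))); rewrite -{1}(ainvK theta (flip m)).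
by apply: (proj1 (starP [::] _)) => [x []//|]; apply: nm.
Qed.

(** Otherwise some cylinder [c] inside the star of [a] misses the stars of both halves. The pullback
    of [flip c] then commutes with all elements supported in either half, hence fixes each point of
    [a]; being supported in [a], it is trivial, a contradiction. *)
Lemma star_split a y : star a y -> exists s, star (rcons a s) y.
Proof.
move=> /star_open[m my am]; apply: contrapT => /forallNP n.
have [m0 m0y am0] := starN_open (n false).
have [m1 m1y am1] := starN_open (n true).
have [u0 [s0 [e0 y0]]] := sdi_open my m0y.
have [u1 [s1 [e1 y1]]] := sdi_open y0 m1y.
set c := ((m ++ u0) ++ u1) in e1 y1.
apply: (flip_moves y1); rewrite -(ainvK theta (flip c)).
have -> : ainv theta (flip c) = 1; last by rewrite aut1.
have flc z : ~ sdi c z -> sgval (theta (ainv theta (flip c))) z = z.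
  by rewrite ainvK; apply: flip_id.
apply: thompsonV_eq => x; have [/sdi_split ax|] := pselect (sdi a x); last first.
  apply: (proj2 (starP a _)) => z az; apply: flc => /sdi_sub/sdi_sub/am.
  exact: az.
case: ax => ax; apply: (commute_rigid ax) => g ga;
  apply: (commute_starN ga _ flc) => z.
  by move=> /sdi_sub; rewrite e0 => /sdi_sub/am0.
by rewrite e1 => /sdi_sub/am1.
Qed.

Fixpoint star_word y n : word := if n is n'.+1
  then rcons (star_word y n') `[< star (rcons (star_word y n') true) y >]
  else [::].

(** The inverse of the homeomorphism: the point all of whose prefixes have [y] in their star. The
    letter 1 is taken whenever it is allowed. *)
Definition star_pt y : cantor_space :=
  fun n => `[< star (rcons (star_word y n) true) y >].

Lemma star_wordP y n : star (star_word y n) y.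
Proof.
elim: n => [|n IHn] /=; first exact: star_nil.
by case: asboolP => // n1; have [[/n1|]] := star_split IHn.
Qed.

Lemma pref_star_pt y n : pref n (star_pt y) = star_word y n.
Proof. by elim: n => [//|n IHn]; rewrite /pref mkseqS -/(pref n _) IHn. Qed.

Lemma star_ptP a y : sdi a (star_pt y) <-> star a y.
Proof.
split=> [/sdiP ->|ay]; first by rewrite pref_star_pt; apply: star_wordP.
have : star (pref (size a) (star_pt y)) y by rewrite pref_star_pt; apply: star_wordP.
move=> py; suff -> : a = pref (size a) (star_pt y) by apply: sdi_pref.
apply: contrapT => ne; apply: (star_ortho _ ay py).
by apply: ortho_size; rewrite ?size_mkseq.
Qed.

Lemma star_equiv v a b y : acts_on (sgval v) a b -> star a y ->
  star b (sgval (theta v) y).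
Proof.
move=> vab ay; rewrite /star -(conj_flip vab) !afunM autV => /(fixnear_conj (theta v)^-1).
by rewrite VK invgK !mulgA mulVg mul1g mulgVK; apply: ay.
Qed.

Lemma star_pt_equiv v y : star_pt (sgval (theta v) y) = sgval v (star_pt y).
Proof.
apply: contrapT => /neq_pref[n]; apply.
have [k [w [kx vk]]] := V_local v (star_pt y).
have [u e] := pref_cat (star_pt y) (leq_addr n (size k)); rewrite -(sdiP kx) in e.
have ux := sdi_pref (size k + n)%N (star_pt y); rewrite e in ux.
have vku := acts_on_cat u vk.
have : sdi (w ++ u) (star_pt (sgval (theta v) y)).
  by apply/star_ptP/(star_equiv vku)/star_ptP.
have : sdi (w ++ u) (sgval v (star_pt y)) by apply/(acts_on_sdi _ vku).
have nw : (n <= size (w ++ u))%N.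
  have := congr1 size e; rewrite size_mkseq !size_cat; lia.
by move=> /sdiP e1 /sdiP e2; apply: (pref_le nw); rewrite -e1.
Qed.

Lemma star_pt_continuous : continuous star_pt.
Proof.
move=> y U /nbhs_sdi[n nU].
have /star_open[m my mn] : star (pref n (star_pt y)) y.
  by apply/star_ptP; apply: sdi_pref.
by apply: filterS (sdi_nbhs my) => z /mn/star_ptP/nU.
Qed.

End Reconstruction.

(** If eta x differs from x, the flip of a small cylinder around eta x fixes x but moves eta x. *)
Lemma commute_V_id (eta : cantor_space -> cantor_space) :
  (forall v x, eta (sgval v x) = sgval v (eta x)) -> eta =1 id.
Proof.
move=> etaV x; apply: contrapT => /neq_ortho[n /(_ n n (leqnn _) (leqnn _)) o].
apply: (flip_moves (sdi_pref n (eta x))); rewrite -etaV flip_id // => nx.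
exact: (o _ nx (sdi_pref n x)).
Qed.

Lemma star_ptK theta : cancel (star_pt (aut_inv theta)) (star_pt theta).
Proof.
apply: commute_V_id => v x; rewrite -{1}(ainvK (aut_inv theta) v) star_pt_equiv.
by rewrite /= star_pt_equiv.
Qed.

(** The point maps built from [theta] and from its inverse compose to maps commuting with V, hence
    to the identity; this gives bijectivity. *)
Theorem Rubin_V theta : exists phi : NHV, forall v,
  sgval (theta v) = sgval phi * sgval v * (sgval phi)^-1.
Proof.
have KV : cancel (star_pt theta) (star_pt (aut_inv theta)).
  have := star_ptK (aut_inv theta).
  by have -> : aut_inv (aut_inv theta) = theta by apply: aut_inj.
pose phi := Homeo (@star_ptK theta) KV
  (@star_pt_continuous (aut_inv theta)) (@star_pt_continuous theta).
have phiE v : sgval (theta v) = phi * sgval v * phi^-1.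
  by apply: homeo_inj => x /=; rewrite -star_pt_equiv KV.
have phiN : sgset NHV phi.
  apply/seteqP; split=> [_ [v Vv <-]|v Vv].
    rewrite -[v]/(sgval (@SgIn _ thompsonV v Vv)) -phiE.
    exact: (@sgvalP _ thompsonV).
  exists (sgval (ainv theta (@SgIn _ thompsonV v Vv))); first exact: (@sgvalP _ thompsonV).
  by rewrite -phiE ainvK.
by exists (@SgIn _ NHV phi phiN).
Qed.

End Rubin.

(** * Germs of V at a point *)

Section Germs.
Implicit Types (m w a b c d e : word) (x y z : cantor_space).
Implicit Types (v f g h k t : thompsonV).

Local Notation zero := (q2val Q2_zero).

Lemma log_slopeM f g x :
  log_slope (sgval (f * g)) x
  = (log_slope (sgval f) (sgval g x) + log_slope (sgval g) x)%R.
Proof.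
have [m [w [mx gm]]] := V_local g x; have [k [l [kx fk]]] := V_local f (sgval g x).
have wx : sdi w (sgval g x) by apply/(acts_on_sdi _ gm).
have [u [s [e ux]]] := sdi_open wx kx.
have gmu := acts_on_cat u gm; have fks := acts_on_cat s fk.
have mux : sdi (m ++ u) x by apply/(acts_on_sdi _ gmu).
rewrite e in gmu ux; rewrite (log_slopeE ux fks) (log_slopeE mux gmu).
rewrite (log_slopeE mux (acts_onM gmu fks)); lia.
Qed.

Lemma log_slope_fixnear v x : fixnear v x -> log_slope (sgval v) x = 0%R.
Proof. by move=> [m mx vm]; rewrite (log_slopeE mx vm) GRing.subrr. Qed.

Lemma log_slopeV v x :
  log_slope (sgval v^-1) x = (- log_slope (sgval v) (sgval v^-1%g x))%R.
Proof.
have := log_slopeM v v^-1 x; rewrite mulgV log_slope_fixnear; first by lia.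
by exists [::].
Qed.

(** The contraction of slope 1/2 at 0, whose germ generates the germs of V at 0. *)
Definition contract0 := swap [:: true] [:: false; false] * swap [:: false] [:: true].

Lemma ortho_tf : ortho [:: true] [:: false].
Proof. exact: (@ortho_catS [::] true false [::] [::]). Qed.

Lemma contract0E : acts_on (sgval contract0) [:: false] [:: false; false].
Proof. exact: (contract_V [:: false] ortho_tf). Qed.

Lemma contract0X n i :
  acts_on (sgval (contract0 ^+ n)) (nseq i.+1 false) (nseq (n + i).+1 false).
Proof.
elim: n => [//|n IHn]; rewrite expgS; apply: acts_onM IHn _.
exact: (acts_on_cat (nseq (n + i) false) contract0E).
Qed.

Lemma wcat_zero n : wcat (nseq n false) zero = zero.
Proof.
by apply/funext => i; rewrite /wcat nth_nseq; case: ifP => //; case: ifP.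
Qed.

Lemma sdi_zero n : sdi (nseq n false) zero.
Proof. by exists zero => //; apply: wcat_zero. Qed.

Lemma contract0X_zero n : sgval (contract0 ^+ n) zero = zero.
Proof. by rewrite -(wcat_zero 1) contract0X !wcat_zero. Qed.

Lemma contract0_zero : sgval contract0 zero = zero.
Proof. exact: (contract0X_zero 1). Qed.

Lemma log_slope_contract0X n :
  log_slope (sgval (contract0 ^+ n)) zero = (- n%:Z)%R.
Proof.
by rewrite (log_slopeE (sdi_zero 1) (@contract0X n 0)) !size_nseq; lia.
Qed.

Lemma sdi_zero_nseq w : sdi w zero -> w = nseq (size w) false.
Proof.
move=> /sdiP {1}->; apply: (@eq_from_nth _ false); rewrite ?size_mkseq ?size_nseq //.
by move=> i iw; rewrite nth_mkseq // nth_nseq iw.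
Qed.

(** The two cases say that t is a power of [contract0] up to a trivial germ, without negative
    exponents. *)
Lemma stabilizer0_germ t : sgval t zero = zero ->
  exists n k, fixnear k zero /\
   ((t = contract0 ^+ n * k /\ log_slope (sgval t) zero = (- n%:Z)%R) \/
    (contract0 ^+ n * t = k /\ log_slope (sgval t) zero = (n%:Z)%R)).
Proof.
move=> t0; have [m [w [m0 tm]]] := V_local t zero.
have w0 : sdi w zero by rewrite -t0; apply/(acts_on_sdi _ tm).
(* The extra letter keeps both words nonempty, as [contract0] contracts only inside the cylinder of
   0. *)
have {}tm : acts_on (sgval t) (nseq (size m).+1 false) (nseq (size w).+1 false).
  rewrite -[(size m).+1]addn1 -[(size w).+1]addn1 !nseqD.
  by rewrite -(sdi_zero_nseq m0) -(sdi_zero_nseq w0); apply: acts_on_cat.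
rewrite (log_slopeE (sdi_zero _) tm) !size_nseq.
have [le|/ltnW le] := leqP (size m) (size w).
  exists (size w - size m)%N, ((contract0 ^+ (size w - size m))^-1 * t); split.
    exists (nseq (size m).+1 false); first exact: sdi_zero.
    apply: acts_onM tm _; apply: acts_onV.
    by have := @contract0X (size w - size m) (size m); rewrite subnK.
  by left; rewrite mulVKg; split=> //; lia.
exists (size m - size w)%N, (contract0 ^+ (size m - size w) * t); split.
  exists (nseq (size m).+1 false); first exact: sdi_zero.
  apply: acts_onM tm _.
  by have := @contract0X (size m - size w) (size w); rewrite subnK.
by right; split=> //; lia.
Qed.

Lemma Q2_tail x : Q2_set x -> exists N, forall n, (N <= n)%N -> x = wcat (pref n x) zero.
Proof.
move=> /finite_seqP[s xs]; exists (\max_(i <- s) i).+1 => n sn.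
apply/funext => i; rewrite /wcat size_mkseq; case: ltnP => ni; first by rewrite nth_mkseq.
apply/negP => xi; have : [set n | x n] i by [].
rewrite xs => /= si; have := @leq_bigmax_seq _ s predT id i si isT.
by move=> /leq_ltn_trans/(_ (leq_trans sn ni)); rewrite ltnn.
Qed.

Lemma Q2_transitive (p q : Q2) : exists v, Q2_act v p = q.
Proof.
have [pq|/neq_ortho[n no]] := pselect (q2val p = q2val q).
  by exists 1; apply: Q2_inj.
have [N NP] := Q2_tail (q2P p); have [K KP] := Q2_tail (q2P q).
pose l := (n + N + K)%N.
exists (swap (pref l p) (pref l q)); apply: Q2_inj.
have nl : (n <= l)%N by rewrite /l; lia.
have pE : q2val p = wcat (pref l p) zero by apply: NP; rewrite /l; lia.
have qE : q2val q = wcat (pref l q) zero by apply: KP; rewrite /l; lia.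
rewrite -[LHS]/(sgval (swap (pref l p) (pref l q)) p) [X in hfun _ X]pE.
by rewrite swapl -?qE //; apply: no.
Qed.

Lemma winf_cat c : winf c = wcat c (winf c).
Proof.
apply/funext => i; rewrite /wcat /winf; case: ltnP => ci; first by rewrite modn_small.
by rewrite -{1}(subnKC ci) modnDl.
Qed.

Lemma winf_unique c z : c <> [::] -> wcat c z = z -> z = winf c.
Proof.
move=> c0 cz; apply/funext => i; have [n] := ubnP i; elim: n i => // n IHn i ni.
have sc : (0 < size c)%N by case: c c0 {cz IHn}.
rewrite winf_cat -{1}cz /wcat; case: ltnP => // ci; apply: IHn; lia.
Qed.

Lemma winf_flatten c n : winf c = wcat (flatten (nseq n c)) (winf c).
Proof.
elim: n => [|n IHn]; first by rewrite wcat0.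
by rewrite /= wcat_cat -IHn -winf_cat.
Qed.

Lemma size_flatten_nseq c n : size (flatten (nseq n c)) = (n * size c)%N.
Proof. by rewrite size_flatten /shape map_nseq sumn_nseq mulnC. Qed.

Lemma V_tail_class g m c : c <> [::] ->
  exists w, sgval g (wcat m (winf c)) = wcat w (winf c).
Proof.
move=> c0; have [k [w [kx gk]]] := V_local g (wcat m (winf c)).
have sc : (0 < size c)%N by case: c c0 {kx}.
have e : wcat m (winf c) = wcat (m ++ flatten (nseq (size k) c)) (winf c).
  by rewrite wcat_cat -winf_flatten.
have kl : (size k <= size (m ++ flatten (nseq (size k) c)))%N.
  by rewrite size_cat size_flatten_nseq; nia.
have [|u eu] := sdi_le kx _ kl; first by rewrite e.
by exists (w ++ u); rewrite e eu !wcat_cat gk.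
Qed.

Lemma tail_class_V m w c : c <> [::] ->
  exists g, sgval g (wcat m (winf c)) = wcat w (winf c).
Proof.
move=> c0; have sc : (0 < size c)%N by case: c c0.
have [->|/neq_ortho[n no]] := pselect (wcat m (winf c) = wcat w (winf c)).
  by exists 1.
have sn u : (n <= size (u ++ flatten (nseq n c)))%N.
  by rewrite size_cat size_flatten_nseq; nia.
have {}no : ortho (m ++ flatten (nseq n c)) (w ++ flatten (nseq n c)).
  have := no _ _ (sn m) (sn w).
  have E u : pref (size (u ++ flatten (nseq n c))) (wcat u (winf c))
           = u ++ flatten (nseq n c).
    by rewrite (winf_flatten c n) -wcat_cat pref_wcat.
  by rewrite !E.
exists (swap (m ++ flatten (nseq n c)) (w ++ flatten (nseq n c))).
by rewrite {1}(winf_flatten c n) -wcat_cat swapl // wcat_cat -winf_flatten.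
Qed.

(** The map sending m d z to m d d z near the periodic point; its exponent [size d] is what
    [tail_dvd_exponent] tests. *)
Lemma contract_tail m d : d <> [::] -> exists g,
  sgval g (wcat m (winf d)) = wcat m (winf d) /\
  log_slope (sgval g) (wcat m (winf d)) = (- (size d)%:Z)%R.
Proof.
move=> d0; have [e oe] : exists e, ortho e (m ++ d).
  by apply: ortho_head => /(congr1 size); rewrite size_cat; case: d d0 => //= *; lia.
have gd := contract_V d oe; exists (swap e ((m ++ d) ++ d) * swap (m ++ d) e).
split; last first.
  rewrite winf_cat -wcat_cat (log_slopeE (sdi_wcat _ _) gd) !size_cat; lia.
by rewrite {1}winf_cat -wcat_cat gd !wcat_cat -!winf_cat.
Qed.

End Germs.

(** * The normaliser of V and germs *)

Section NormaliserActsOnGerms.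
Implicit Types (m w a b c d e : word) (x y z : cantor_space).
Implicit Types (v g h t s : thompsonV) (phi psi : NHV).

Local Notation zero := (q2val Q2_zero).

Lemma adVM phi : {morph adV phi : v g / v * g}.
Proof.
by move=> v g; apply: sgval_inj; apply: homeo_inj => x /=; rewrite hfunK.
Qed.

Lemma adV_mul phi psi v : adV (phi * psi) v = adV phi (adV psi v).
Proof. by apply: sgval_inj; apply: homeo_inj. Qed.

Lemma adV1 v : adV 1 v = v.
Proof. by apply: sgval_inj; apply: homeo_inj. Qed.

Lemma adV_one phi : adV phi 1 = 1.
Proof. by apply: (@mulgI _ (adV phi 1)); rewrite -adVM !mulg1. Qed.

Lemma adVK phi : cancel (adV phi) (adV phi^-1).
Proof. by move=> v; rewrite -adV_mul mulVg adV1. Qed.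
Lemma adVVK phi : cancel (adV phi^-1) (adV phi).
Proof. by move=> v; rewrite -adV_mul mulgV adV1. Qed.

Lemma adVV phi v : adV phi v^-1 = (adV phi v)^-1.
Proof.
apply: (@mulgI _ (adV phi v)); rewrite -adVM !mulgV; apply: thompsonV_eq => x.
exact: (hinvK (sgval phi)).
Qed.

Lemma adVX phi v n : adV phi (v ^+ n) = adV phi v ^+ n.
Proof.
elim: n => [|n IHn]; last by rewrite !expgS adVM IHn.
by rewrite -[v ^+ 0](mulgV 1) adVM adVV mulgV.
Qed.

Lemma adVE phi v x : sgval (adV phi v) (sgval phi x) = sgval phi (sgval v x).
Proof. by rewrite /= hfunK. Qed.

Lemma adV_invE phi v : sgval (adV phi^-1%g v) = (sgval phi)^-1 * sgval v * sgval phi.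
Proof. by rewrite -[LHS]/(_ * _ * _) -[X in _ * X]/((sgval phi)^-1^-1) invgK. Qed.

Lemma adV_invK phi v x :
  sgval (adV phi^-1%g v) (hinv (sgval phi) x) = hinv (sgval phi) (sgval v x).
Proof. by rewrite adV_invE /= hinvK. Qed.

Lemma homeo_sdi (f : homeo) m x : sdi m (f x) ->
  exists n, forall k, (n <= k)%N -> forall y, sdi (pref k x) y -> sdi m (f y).
Proof.
move=> mfx; have [n nU] : exists n, sdi (pref n x) `<=` f @^-1` sdi m.
  by apply: nbhs_sdi; apply: (@hfun_continuous f x); apply: sdi_nbhs.
by exists n => k nk y; have [u ->] := pref_cat x nk => /sdi_sub/nU.
Qed.

Lemma adV_fixnear phi v x : fixnear v x -> fixnear (adV phi v) (sgval phi x).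
Proof.
move=> [m mx vm]; have [n nP] : exists n, forall k, (n <= k)%N -> forall y,
    sdi (pref k (sgval phi x)) y -> sdi m ((sgval phi)^-1 y).
  move: mx; rewrite -{1}(hfunK (sgval phi) x); apply: (@homeo_sdi (sgval phi)^-1).
exists (pref n (sgval phi x)); first exact: sdi_pref.
move=> y; set z := wcat _ y; have : sdi m ((sgval phi)^-1 z).
  exact: (nP n (leqnn n) _ (sdi_wcat _ _)).
move=> [r _ rz]; have zr : z = sgval phi (wcat m r) by rewrite rz; apply/esym/hinvK.
by rewrite zr adVE vm.
Qed.

Lemma contract0_orbit z : (forall n, sdi [:: false] (sgval (contract0 ^+ n)^-1 z)) -> z = zero.
Proof.
move=> zP; apply/funext => i.
have [y _ yE] := zP i; have := congr1 (sgval (contract0 ^+ i)) yE.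
rewrite VVK (@contract0X i 0) addn0 => <-.
by rewrite /wcat size_nseq ltnSn nth_nseq ltnSn.
Qed.

(** The conjugate g fixes y = phi^-1(0) and sends a prefix [m] to [w] there. If w is longer, then w
    = m c and y = m c^oo. Otherwise g^-1 maps a small cylinder around y into itself, so phi sends
    each of its points to a point whose backward orbit under [contract0] stays in the cylinder of 0;
    only 0 has this property, against the injectivity of phi. *)
Lemma conj_contract0 phi : exists m c,
  [/\ c <> [::], hinv (sgval phi) zero = wcat m (winf c) &
   log_slope (sgval (adV phi^-1%g contract0)) (hinv (sgval phi) zero)
   = (- (size c)%:Z)%R].
Proof.
set y := hinv _ zero; set g := adV phi^-1%g contract0.
have gy : sgval g y = y by rewrite /g adV_invK contract0_zero.
have [m [w [my gm]]] := V_local g y.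
have wy : sdi w y by rewrite -gy; apply/(acts_on_sdi _ gm).
have [wm|mw] := leqP (size w) (size m); last first.
  have [c cE] := sdi_le my wy (ltnW mw); subst w; exists m, c; split.
  - by move=> c0; move: mw; rewrite c0 cats0 ltnn.
  - have [z _ zE] := my; rewrite -zE; congr wcat; apply: winf_unique.
      by move=> c0; move: mw; rewrite c0 cats0 ltnn.
    by apply: (@wcat_inj m); rewrite -wcat_cat -gm zE gy.
  - by rewrite (log_slopeE my gm) size_cat; lia.
exfalso; have [n nP] : exists n, forall k, (n <= k)%N -> forall z,
    sdi (pref k y) z -> sdi [:: false] (sgval phi z).
  by apply: homeo_sdi; rewrite /y hinvK; apply: (sdi_zero 1).
pose a := pref (n + size m)%N y; have sa : size a = (n + size m)%N by rewrite size_mkseq.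
have [r ar] : exists r, a = w ++ r.
  by apply: (sdi_le wy (sdi_pref _ _)); rewrite sa; lia.
have ga z : sdi a z -> sdi a (sgval g^-1 z).
  have gr := acts_on_cat r (acts_onV gm).
  have : sdi (m ++ r) y.
    rewrite -[y](VK g) gy; apply/(acts_on_sdi _ gr); rewrite -ar; exact: sdi_pref.
  move=> mry; have [|u mu] := sdi_le (sdi_pref (n + size m) y) mry.
    by rewrite size_cat sa; have := congr1 size ar; rewrite size_cat sa; lia.
  rewrite {1}ar => az; apply: (@sdi_sub _ u); rewrite -/a in mu; rewrite -mu.
  exact/(acts_on_sdi _ gr).
have gna z k : sdi a z -> sdi a (sgval (g ^+ k)^-1 z).
  elim: k z => [|k IHk] z az; first by rewrite invg1.
  by rewrite expgSr invgM VM; apply: ga; apply: IHk.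
have a0 z : sdi a z -> sgval phi z = zero.
  move=> az; apply: contract0_orbit => k.
  have -> : (contract0 ^+ k)^-1 = adV phi (g ^+ k)^-1.
    by rewrite adVV adVX /g adVVK.
  rewrite adVE; apply: (nP (n + size m)%N); first exact: leq_addr.
  exact: gna.
have : wcat a zero = wcat a (fun=> true).
  by apply: (can_inj (@hfunK (sgval phi))); rewrite !a0.
by move=> /wcat_inj /(congr1 (fun r : cantor_space => r 0%N)).
Qed.

(** The factor by which conjugation rescales exponents. It is shown to equal k_phi in [kphiE]; prime
    words do not enter before that. *)
Definition germ_exponent phi : int :=
  (- log_slope (sgval (adV phi^-1%g contract0)) (hinv (sgval phi) zero))%R.

(** Both sides are additive on the stabiliser of 0 and vanish on trivial germs, so it is enough to
    compare them on [contract0]. *)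
Lemma log_slope_conj phi t : sgval t zero = zero ->
  log_slope (sgval (adV phi^-1%g t)) (hinv (sgval phi) zero)
  = (germ_exponent phi * log_slope (sgval t) zero)%R.
Proof.
set y := hinv _ zero.
have conjM s t' : sgval t' zero = zero ->
    log_slope (sgval (adV phi^-1%g (s * t'))) y
    = (log_slope (sgval (adV phi^-1%g s)) y + log_slope (sgval (adV phi^-1%g t')) y)%R.
  by move=> t'0; rewrite adVM log_slopeM /y adV_invK t'0.
have conjX n : log_slope (sgval (adV phi^-1%g (contract0 ^+ n))) y
    = (- (germ_exponent phi * n%:Z))%R.
  elim: n => [|n IHn].
    rewrite log_slope_fixnear; first by lia.
    by exists [::] => //; rewrite adVX.
  by rewrite expgSr conjM ?contract0_zero // IHn /germ_exponent -/y; lia.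
move=> t0; have [n [k [kfix]]] := stabilizer0_germ t0.
have k0 : log_slope (sgval (adV phi^-1%g k)) y = 0%R.
  by apply: log_slope_fixnear; apply: adV_fixnear.
case=> -[e ->].
  by rewrite e conjM ?(fixnear_fix kfix) // k0 conjX; lia.
by have := k0; rewrite -e conjM // conjX; lia.
Qed.

(** Carried back to 0, the contraction of exponent [size d] at phi^-1(0) becomes an element of V
    fixing 0, whose exponent there is an integer. *)
Lemma tail_dvd_exponent phi m d : d <> [::] ->
  hinv (sgval phi) zero = wcat m (winf d) ->
  exists n : nat, (size d)%:Z%R = (germ_exponent phi * n%:Z)%R.
Proof.
move=> d0 yE; have [g [gy gs]] := contract_tail m d0.
rewrite -yE in gy gs; have := log_slope_conj phi (t := adV phi g).
rewrite adVK gs => /(_ _) e.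
have t0 : sgval (adV phi g) zero = zero.
  by rewrite -{1}(hinvK (sgval phi) zero) adVE gy hinvK.
have {}e := e t0.
have [m' [c [c0 _ cs]]] := conj_contract0 phi.
have gp : (0 < germ_exponent phi)%R.
  rewrite /germ_exponent cs; case: c c0 {cs} => //= *; lia.
exists `|log_slope (sgval (adV phi g)) zero|%N.
nia.
Qed.

Lemma hinv_Q2 phi m c : c <> [::] -> hinv (sgval phi) zero = wcat m (winf c) ->
  hinv (sgval phi) @` Q2_set = [set wcat y (winf c) | y in setT].
Proof.
move=> c0 yE; apply/seteqP; split=> [_ [q Qq <-]|_ [w _ <-]].
  have [v vq] := Q2_transitive Q2_zero (InQ2 Qq).
  have [w wE] := V_tail_class (adV phi^-1%g v) m c0.
  exists w => //; rewrite -wE -yE adV_invK; congr (hinv _ _).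
  by have := congr1 q2val vq.
have [g gE] := tail_class_V m w c0; exists (sgval (adV phi g) zero).
  exact: Q2_thompsonV (q2P Q2_zero).
by rewrite -{1}(hinvK (sgval phi) zero) adVE hfunK yE.
Qed.

(** The word c of [conj_contract0] is prime because a shorter root would have a length divisible by
    |c|. Any other admissible prime word has length n |c|, and is the n-th power of its prefix of
    length |c|; hence n = 1. *)
Lemma kphiE phi : (kphi (sgval phi))%:Z%R = germ_exponent phi.
Proof.
have [m [c [c0 yE cs]]] := conj_contract0 phi.
have gE : germ_exponent phi = (size c)%:Z%R by rewrite /germ_exponent cs; lia.
have sc : (0 < size c)%N by case: c c0 {yE cs gE}.
rewrite gE; congr Posz; apply: xget_unique => /=.
  exists c; split=> //; last exact: hinv_Q2 yE.
  split; first exact/eqP.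
  move=> [d [j [dc cE]]]; have d0 : d <> [::].
    by move=> d0; move: sc; rewrite cE d0 size_flatten_nseq muln0.
  have wE : winf c = winf d.
    by apply/esym/winf_unique => //; rewrite cE -winf_flatten.
  rewrite wE in yE; have [n] := tail_dvd_exponent d0 yE; rewrite gE.
  have sd : (0 < size d)%N by case: d d0 {dc cE wE yE}.
  by case: n => [|n]; nia.
move=> k [c' [[/eqP c'0 c'prime] Q2E ->]].
have [m' yE'] : exists m', hinv (sgval phi) zero = wcat m' (winf c').
  have : (hinv (sgval phi) @` Q2_set) (hinv (sgval phi) zero).
    by exists zero => //; apply: (q2P Q2_zero).
  by rewrite Q2E => -[m' _ <-]; exists m'.
have [n] := tail_dvd_exponent c'0 yE'; rewrite gE => ns.
have sc' : (0 < size c')%N by case: c' c'0 {c'prime Q2E yE' ns}.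
have {}ns : size c' = (n * size c)%N by nia.
apply: contrapT => ne; apply: c'prime.
have lt : (size c < size c')%N by case: n ns => [|[|n]]; nia.
pose r := winf c'.
have rc' i j : r (i + j * size c')%N = r i by rewrite /r /winf addnC modnMDl.
have yc i : (size m <= i)%N -> hinv (sgval phi) zero (i + size c)%N = hinv (sgval phi) zero i.
  move=> mi; rewrite yE /wcat !ltnNge mi (leq_trans mi (leq_addr _ _)) /=.
  by rewrite /winf -addnBAC // modnDr.
(* Shifting by [size m] periods of c' passes beyond the preperiod [m] of phi^-1(0), where the
   sequence has period [size c]. *)
have rc i : r (i + size c)%N = r i.
  have := yc (size m' + i + size m * size c')%N.
  rewrite yE' /wcat; set a := (_ + _ + _)%N.
  have -> : ((a + size c < size m') = false)%N by rewrite /a; lia.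
  have -> : ((a < size m') = false)%N by rewrite /a; lia.
  have -> : (a + size c - size m' = (i + size c) + size m * size c')%N by rewrite /a; lia.
  have -> : (a - size m' = i + size m * size c')%N by rewrite /a; lia.
  rewrite -/r !rc'; apply; rewrite /a; nia.
pose d := pref (size c) r; exists d, n; split; first by rewrite size_mkseq.
have sd : size d = size c by rewrite size_mkseq.
have rE : r = winf d.
  apply: winf_unique; first by move=> d0; move: sc; rewrite -sd d0.
  rewrite -[RHS](wcat_pref (size c)); congr wcat; apply/funext => i.
  by rewrite /shift addnC rc.
have rn : r = wcat (flatten (nseq n d)) r by rewrite rE -winf_flatten.
rewrite -[LHS](pref_wcat c' r) -[X in pref _ X]winf_cat -/r {1}rn.
by rewrite ns -sd -size_flatten_nseq pref_wcat.
Qed.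

Lemma log_slope_kphi phi t : sgval t zero = zero ->
  log_slope (sgval (adV phi^-1%g t)) (hinv (sgval phi) zero)
  = ((kphi (sgval phi))%:Z * log_slope (sgval t) zero)%R.
Proof. by rewrite kphiE; apply: log_slope_conj. Qed.

(** Two choices of v differ by an element fixing 0, for which the right-hand side vanishes by
    [log_slope_kphi]. *)
Lemma gammaphiE phi v :
  gammaphi (sgval phi) (Q2_act v Q2_zero)
  = (log_slope (sgval (adV phi^-1%g v)) (hinv (sgval phi) zero)
     - (kphi (sgval phi))%:Z * log_slope (sgval v) zero)%R.
Proof.
apply: xget_unique; first by exists v; rewrite adV_invE.
move=> d [s [svx ->]]; have sv : sgval s zero = sgval v zero := congr1 q2val svx.
rewrite -adV_invE; pose t := v^-1 * s; have t0 : sgval t zero = zero.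
  by rewrite /t VM sv VK.
have -> : s = v * t by rewrite /t mulVKg.
clearbody t; have := log_slope_kphi phi t0.
rewrite adVM !log_slopeM adV_invK t0; lia.
Qed.

(** The origin of the correction in the action: transporting ell by phi gives k_phi ell up to the
    coboundary of gamma_phi. The first part modifies zeta, the second is absorbed by f. *)
Lemma ell_gammaphi phi v (x : Q2) :
  ell (sgval (adV phi^-1%g v)) (hinv (sgval phi) x)
  = ((kphi (sgval phi))%:Z * ell (sgval v) x
     + gammaphi (sgval phi) x - gammaphi (sgval phi) (Q2_act v^-1%g x))%R.
Proof.
have [s sx] := Q2_transitive Q2_zero x.
pose t := v^-1 * s; have st : s = v * t by rewrite /t mulVKg.
have tx : Q2_act v^-1 x = Q2_act t Q2_zero by apply: Q2_inj; rewrite -sx.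
have tv : sgval t zero = hinv (sgval v) x by rewrite /t VM -sx.
clearbody t; rewrite tx -[in gammaphi _ x]sx !gammaphiE st adVM !log_slopeM.
rewrite adV_invK tv /ell.
have -> : hinv (sgval (adV phi^-1 v)) (hinv (sgval phi) x)
        = hinv (sgval phi) (hinv (sgval v) x).
  by rewrite -[LHS]/(sgval (adV phi^-1 v)^-1 _) -adVV adV_invK.
lia.
Qed.

End NormaliserActsOnGerms.

(** * The automorphisms F, ad and A *)

Section IntegerPowers.
Variable G : groupType.
Implicit Types (x y z : G) (n : int).

Lemma expgz0 x : expgz x 0%R = 1. Proof. by []. Qed.

Lemma expgzS x n : expgz x (n + 1)%R = expgz x n * x.
Proof.
case: n => [n|[|n]].
- have -> : (Posz n + 1)%R = Posz n.+1 by lia.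
  exact: expgSr.
- exact/esym/(mulVg x).
have -> : (Negz n.+1 + 1)%R = Negz n by lia.
by rewrite /= [x ^+ n.+2]expgS invgM mulgVK.
Qed.

Lemma expgzD x m n : expgz x (m + n)%R = expgz x m * expgz x n.
Proof.
elim: n => [|n IHn|n IHn]; first by rewrite GRing.addr0 mulg1.
  have -> : (m + n.+1%:Z)%R = (m + n%:Z + 1)%R by lia.
  have -> : (n.+1%:Z)%R = (n%:Z + 1)%R by lia.
  by rewrite !expgzS IHn mulgA.
apply: (@mulIg _ x); rewrite -mulgA -!expgzS.
have -> : (m - n.+1%:Z + 1)%R = (m - n%:Z)%R by lia.
by have -> : (- n.+1%:Z + 1)%R = (- n%:Z)%R by lia.
Qed.

Lemma expgzN x n : expgz x (- n)%R = (expgz x n)^-1.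
Proof.
by apply: (@mulgI _ (expgz x n)); rewrite -expgzD mulgV GRing.addrN.
Qed.

Lemma expgzVl x n : expgz x^-1 n = (expgz x n)^-1.
Proof. by case: n => n /=; rewrite expVgn. Qed.

Lemma expgz1g n : expgz (1 : G) n = 1.
Proof. by case: n => n /=; rewrite expg1n ?invg1. Qed.

Lemma expgz_center z n : center_set z -> center_set (expgz z n).
Proof.
have cX k : center_set z -> center_set (z ^+ k).
  move=> cz; elim: k => [|k IHk]; first exact: center1.
  by rewrite expgS; apply: centerM.
by move=> cz; case: n => n /=; [apply: cX | apply: centerV; apply: cX].
Qed.

Lemma expgzMl z x n : center_set z -> expgz (z * x) n = expgz z n * expgz x n.
Proof.
move=> cz; have zX k : (z * x) ^+ k = z ^+ k * x ^+ k.
  by rewrite expgMn //; apply: cz.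
case: n => n /=; first exact: zX.
rewrite zX invgM; apply/esym.
have := @expgz_center z (Negz n) cz; apply.
Qed.

Lemma expgzX x k n : expgz (x ^+ k) n = expgz x (k%:Z * n)%R.
Proof.
elim: n => [|n IHn|n IHn]; first by rewrite GRing.mulr0.
  have -> : (n.+1%:Z)%R = (n%:Z + 1)%R by lia.
  by rewrite GRing.mulrDr GRing.mulr1 expgzS expgzD IHn.
apply: (@mulIg _ (x ^+ k)); rewrite -expgzS.
rewrite -[x ^+ k in RHS]/(expgz x k%:Z) -expgzD.
have -> : (- n.+1%:Z + 1)%R = (- n%:Z)%R by lia.
have -> : (k%:Z * - n.+1%:Z + k%:Z)%R = (k%:Z * - n%:Z)%R by lia.
exact: IHn.
Qed.

Lemma aut_expgz (beta : aut G) x n : beta (expgz x n) = expgz (beta x) n.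
Proof.
have bX k : beta (x ^+ k) = beta x ^+ k.
  by elim: k => [|k IHk]; rewrite ?aut1 // !expgS afunM IHk.
by case: n => n; rewrite /expgz ?autV bX.
Qed.

End IntegerPowers.

(** * Locally constant maps and density of Q_2 *)

Section LocallyConstantMaps.
Variable Gamma : groupType.
Implicit Types (a b : LGamma Gamma) (x y z : cantor_space) (m w : word).
Local Notation zero := (q2val Q2_zero).

Lemma loc_const_near T (h : cantor_space -> T) x : loc_const_set h ->
  exists n, forall k, (n <= k)%N -> forall y, sdi (pref k x) y -> h y = h x.
Proof.
move=> /loc_constP /(_ x)[m mx hm]; exists (size m) => k mk y.
have [u ->] := pref_cat x mk; rewrite -(sdiP mx) => /sdi_sub[z _ <-].
by rewrite -[in RHS](wcat_shift mx).
Qed.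

Lemma loc_const_depth T (h : cantor_space -> T) : loc_const_set h ->
  exists N, forall m, size m = N -> forall y z, h (wcat m y) = h (wcat m z).
Proof.
move=> hl; apply: word_compact => [m u am y z|x]; first by rewrite !wcat_cat.
have [n nP] := loc_const_near x hl; exists n => y z.
by rewrite !(nP n).
Qed.

Lemma LGamma_eq a b : (forall x, sgval a x = sgval b x) -> a = b.
Proof. by move=> ab; apply: sgval_inj; apply/funext. Qed.

Definition Q2_near (n : nat) x : Q2 :=
  InQ2 (proj2 (Q2_wcat (pref n x) zero) (q2P Q2_zero)).

Lemma Q2_nearP n x : sdi (pref n x) (Q2_near n x). Proof. exact: sdi_wcat. Qed.

Lemma LGamma_dense a b : (forall q : Q2, sgval a q = sgval b q) -> a = b.
Proof.
move=> ab; apply: LGamma_eq => x.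
have [n nP] := loc_const_near x (sgvalP a); have [k kP] := loc_const_near x (sgvalP b).
rewrite -(nP _ (leq_addr k n) _ (Q2_nearP _ _)) -(kP _ (leq_addl n k) _ (Q2_nearP _ _)).
exact: ab.
Qed.

Lemma loc_const_cst (T : Type) (t : T) : loc_const_set (fun=> t).
Proof. by apply/loc_constP => x; exists [::]. Qed.

Definition LGamma_cst (g : Gamma) : LGamma Gamma := @SgIn _ (LGamma Gamma) _ (loc_const_cst g).

Lemma loc_const_sdi m : loc_const_set (fun x => `[< sdi m x >]).
Proof.
apply/loc_constP => x; exists (pref (size m) x); first exact: sdi_pref.
move=> y z; have [mx|mx] := pselect (sdi m x).
  by rewrite -(sdiP mx) !asboolT.
have o := ortho_pref mx (leqnn _).
by rewrite !asboolF // => h; apply: (o _ _ h).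
Qed.

Lemma restrict_subproof m a :
  loc_const_set (fun x => if `[< sdi m x >] then sgval a x else 1).
Proof.
exact: (loc_const2 (fun (s : bool) g => if s then g else 1)
  (loc_const_sdi m) (sgvalP a)).
Qed.
Definition restrict m a : LGamma Gamma := @SgIn _ (LGamma Gamma) _ (restrict_subproof m a).

Lemma restrictT m a x : sdi m x -> sgval (restrict m a) x = sgval a x.
Proof. by move=> mx; rewrite /= asboolT. Qed.
Lemma restrictF m a x : ~ sdi m x -> sgval (restrict m a) x = 1.
Proof. by move=> mx; rewrite /= asboolF. Qed.

End LocallyConstantMaps.

(** * Composition laws of F, ad and A, and their common kernel *)

Section BasicAutomorphisms.
Variable Gamma : groupType.
Local Notation G := (fraction_group Gamma).
Local Notation zero := (q2val Q2_zero).
Implicit Types (p q : G) (zeta xi : center Gamma) (phi psi : NHV).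
Implicit Types (beta : aut Gamma) (f h : NK Gamma).

Definition lval p x : Gamma := sgval (sdl p) x.

Lemma fgP p q : lval p =1 lval q -> sdr p = sdr q -> p = q.
Proof. by move=> pq; apply: sdprod_eq; apply: LGamma_eq. Qed.

Lemma fg_dense p q : (forall r : Q2, lval p r = lval q r) -> sdr p = sdr q -> p = q.
Proof. by move=> pq; apply: sdprod_eq; apply: LGamma_dense. Qed.

Lemma lvalM p q x : lval (p * q) x = lval p x * lval q (hinv (sgval (sdr p)) x).
Proof. by []. Qed.

Lemma lval_near p x :
  exists n, forall k, (n <= k)%N -> forall y, sdi (pref k x) y -> lval p y = lval p x.
Proof. exact: loc_const_near (sgvalP (sdl p)). Qed.

Lemma iotaG_inj : injective (@iotaG Gamma).
Proof.
move=> p q e; apply: fg_dense; last exact: (congr1 (fun r => sdr r) e).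
by move=> r; have := congr1 (fun r' : big_group Gamma => (sdl r' : Q2 -> Gamma) r) e.
Qed.

Lemma ellM (v g : thompsonV) x : ell (sgval (v * g)) x
  = (ell (sgval v) x + ell (sgval g) (hinv (sgval v) x))%R.
Proof.
rewrite /ell log_slopeM; congr (log_slope _ _ + _)%R.
by rewrite -[hinv _ x]/(sgval (v * g)^-1 x) invgM VM VVK.
Qed.

Lemma ell1 x : ell (sgval (1 : thompsonV)) x = 0%R.
Proof. by apply: log_slope_fixnear; exists [::]. Qed.

Lemma lvalF zeta p x :
  lval (Fmap zeta p) x = expgz (sgval zeta) (ell (sgval (sdr p)) x) * lval p x.
Proof. by []. Qed.

Lemma FmapM zeta : {morph Fmap zeta : p q / p * q}.
Proof.
move=> p q; apply: fgP => // x; rewrite !(lvalF, lvalM) ellM expgzD.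
rewrite !mulgA; congr (_ * _); rewrite -!mulgA; congr (_ * _).
exact: expgz_center (sgvalP zeta) _.
Qed.

Lemma Fmap_mul zeta xi p : Fmap (zeta * xi) p = Fmap zeta (Fmap xi p).
Proof.
apply: fgP => // x; rewrite !lvalF mulgA; congr (_ * _).
exact: expgzMl (sgvalP zeta).
Qed.

Lemma Fmap1 p : Fmap 1 p = p.
Proof. by apply: fgP => // x; rewrite lvalF expgz1g mul1g. Qed.

Lemma FmapK zeta : cancel (Fmap zeta) (Fmap zeta^-1).
Proof. by move=> p; rewrite -Fmap_mul mulVg Fmap1. Qed.
Lemma FmapVK zeta : cancel (Fmap zeta^-1) (Fmap zeta).
Proof. by move=> p; rewrite -Fmap_mul mulgV Fmap1. Qed.

Definition Faut zeta : aut G := Aut (FmapK zeta) (FmapVK zeta) (FmapM zeta).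

Lemma admapE f p :
  iotaG (admap f p) = iotaK (sgval f) * iotaG p * (iotaK (sgval f))^-1.
Proof. exact: svalP (cid (admap_subproof f p)). Qed.

Lemma iota_conjE (f : Kbar Gamma) p (r : Q2) :
  (sdl (iotaK f * iotaG p * (iotaK f)^-1) : Q2 -> Gamma) r
  = f r * lval p r * (f (Q2_act (sdr p)^-1 r))^-1.
Proof.
rewrite -iotaKV.
have E1 (s : Q2) : Q2_act 1^-1 s = s by apply: Q2_inj.
have E2 (s : Q2) v : Q2_act (1 * v)^-1 s = Q2_act v^-1 s by rewrite mul1g.
rewrite -[LHS]/(f r * lval p (Q2_act 1^-1 r) * (f (Q2_act (1 * sdr p)^-1 r))^-1).
by rewrite E1 E2.
Qed.

Lemma sdr_admap f p : sdr (admap f p) = sdr p.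
Proof.
have := congr1 (fun r : big_group Gamma => sdr r) (admapE f p).
by rewrite -iotaKV /= => ->; rewrite mul1g mulg1.
Qed.

Lemma lval_admap f p (r : Q2) : lval (admap f p) r
  = sgval f r * lval p r * (sgval f (Q2_act (sdr p)^-1 r))^-1.
Proof. by rewrite -iota_conjE -admapE. Qed.

Lemma admapM f : {morph admap f : p q / p * q}.
Proof.
move=> p q; apply: iotaG_inj; rewrite iotaGM !admapE iotaGM.
by rewrite !mulgA mulgVK.
Qed.

Lemma admap_mul f h p : admap (f * h) p = admap f (admap h p).
Proof. by apply: iotaG_inj; rewrite !admapE iotaKM invgM !mulgA. Qed.

Lemma admap1 p : admap 1 p = p.
Proof. by apply: iotaG_inj; rewrite admapE iotaK1 invg1 mulg1 mul1g. Qed.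

Lemma admapK f : cancel (admap f) (admap f^-1).
Proof. by move=> p; rewrite -admap_mul mulVg admap1. Qed.
Lemma admapVK f : cancel (admap f^-1) (admap f).
Proof. by move=> p; rewrite -admap_mul mulgV admap1. Qed.

Definition adaut f : aut G := Aut (admapK f) (admapVK f) (admapM f).

(** Since alpha is onto G, conjugation by f maps G onto itself, so f lies in the normaliser. *)
Lemma adaut_of_conj (alpha : aut G) (f : Kbar Gamma) :
  (forall p, iotaG (alpha p) = iotaK f * iotaG p * (iotaK f)^-1) ->
  exists2 h : NK Gamma, sgval h = f & alpha = adaut h.
Proof.
move=> af; have fN : NK_set f.
  apply/seteqP; split=> [_ [_ [p _ <-] <-]|_ [p _ <-]].
    by rewrite -af; exists (alpha p).
  exists (iotaG (ainv alpha p)); first by exists (ainv alpha p).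
  by rewrite -af ainvK.
exists (@SgIn _ (NK Gamma) f fN) => //; apply: aut_inj => p; apply: iotaG_inj.
by rewrite af; apply/esym/admapE.
Qed.

Lemma lvalA phi beta p x :
  lval (Amap phi beta p) x = beta (lval p (hinv (sgval phi) x)).
Proof. by []. Qed.

Lemma sdr_Amap phi beta p : sdr (Amap phi beta p) = adV phi (sdr p).
Proof. by []. Qed.

Lemma lval_pair (a : LGamma Gamma) (v : thompsonV) x : lval (SdPair a v) x = sgval a x.
Proof. by []. Qed.

Lemma sdr_pair (a : LGamma Gamma) (v : thompsonV) : sdr (SdPair a v : G) = v.
Proof. by []. Qed.

Lemma AmapM phi beta : {morph Amap phi beta : p q / p * q}.
Proof.
move=> p q; apply: fgP => [x|]; last exact: adVM.
rewrite !(lvalA, lvalM) afunM; congr (_ * beta (lval q _)).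
by rewrite /= hfunK.
Qed.

Lemma Amap_mul phi psi beta beta' p :
  Amap (phi * psi) (beta * beta') p = Amap phi beta (Amap psi beta' p).
Proof. by apply: fgP => //; apply: adV_mul. Qed.

Lemma Amap1 p : Amap 1 1 p = p.
Proof. by apply: fgP => //; apply: adV1. Qed.

Lemma AmapK phi beta : cancel (Amap phi beta) (Amap phi^-1 beta^-1).
Proof. by move=> p; rewrite -Amap_mul !mulVg Amap1. Qed.
Lemma AmapVK phi beta : cancel (Amap phi^-1 beta^-1) (Amap phi beta).
Proof. by move=> p; rewrite -Amap_mul !mulgV Amap1. Qed.

Definition Aaut phi beta : aut G := Aut (AmapK phi beta) (AmapVK phi beta) (AmapM phi beta).

Lemma Faut_adautC zeta f : Faut zeta * adaut f = adaut f * Faut zeta.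
Proof.
apply: aut_inj => p; apply: fg_dense => [r|]; last first.
  by rewrite -[RHS]/(sdr (admap f _)) sdr_admap -[LHS]/(sdr (admap f _)) sdr_admap.
rewrite -[lval _ r in LHS]/(lval (Fmap zeta (admap f p)) r).
rewrite -[lval _ r in RHS]/(lval (admap f (Fmap zeta p)) r).
rewrite lval_admap !lvalF lval_admap sdr_admap !mulgA; congr (_ * _ * _).
exact: expgz_center (sgvalP zeta) _.
Qed.

(** F_zeta ad(f) on classes, through a representative of the class of f; [JautE] removes the
    choice. *)
Definition Jaut (n : center Gamma * quo (@constZ Gamma)) : aut G :=
  Faut n.1 * adaut (repr n.2).

Lemma adaut_mul f h : adaut (f * h) = adaut f * adaut h.
Proof. by apply: aut_inj => p; apply: admap_mul. Qed.

Lemma adaut_quo f h : quo_pi constZ f = quo_pi constZ h -> adaut f = adaut h.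
Proof.
move=> /quo_eqP[z zE]; have -> : h = f * NK_const (sgval z) by rewrite -zE mulVKg.
rewrite adaut_mul; suff -> : adaut (NK_const (sgval z)) = 1 by rewrite mulg1.
apply: aut_inj => p; apply: fg_dense => [r|]; last exact: sdr_admap.
rewrite -[lval _ r in LHS]/(lval (admap (NK_const (sgval z)) p) r) lval_admap /=.
by rewrite (sgvalP z) mulgK.
Qed.

Lemma JautE zeta f : Jaut (zeta, quo_pi constZ f) = Faut zeta * adaut f.
Proof. by congr (_ * _); apply: adaut_quo; rewrite /quo_pi reprK. Qed.

Lemma quo_piE f h : quo_pi constZ (f * h) = quo_pi constZ f * quo_pi constZ h.
Proof. exact: quo_piM. Qed.

Lemma mulgACA_comm (A : groupType) (s t u v : A) :
  t * u = u * t -> s * t * (u * v) = s * u * (t * v).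
Proof. by move=> tu; rewrite !mulgA -(mulgA s) tu mulgA. Qed.

Lemma JautM : {morph Jaut : n n' / n * n'}.
Proof.
move=> [zeta r] [xi s]; have [f ->] := quo_piP r; have [h ->] := quo_piP s.
have -> : ((zeta, quo_pi constZ f) * (xi, quo_pi constZ h)
    : center Gamma * quo (@constZ Gamma))
  = (zeta * xi, quo_pi constZ (f * h)) by rewrite quo_piE.
have FM : Faut (zeta * xi) = Faut zeta * Faut xi by apply: aut_inj => p; apply: Fmap_mul.
rewrite (JautE (zeta * xi)) (JautE zeta) (JautE xi) adaut_mul FM.
exact: mulgACA_comm (Faut_adautC xi f).
Qed.

Lemma sdr_Faut_adaut zeta f p : sdr ((Faut zeta * adaut f) p) = sdr p.
Proof. exact: sdr_admap. Qed.

Lemma lval_Faut_adaut zeta f p (r : Q2) : lval ((Faut zeta * adaut f) p) r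
  = expgz (sgval zeta) (ell (sgval (sdr p)) r)
    * (sgval f r * lval p r * (sgval f (Q2_act (sdr p)^-1 r))^-1).
Proof.
by rewrite -lval_admap -[LHS]/(lval (Fmap zeta (admap f p)) r) lvalF sdr_admap.
Qed.

(* Evaluating at the germ of slope 1/2 at 0 isolates zeta. *)
Lemma kernel_FadA zeta f phi beta : Faut zeta * adaut f * Aaut phi beta = 1 ->
  exists g, [/\ zeta = 1, f = NK_const g, phi = 1 & beta = inner g^-1].
Proof.
move=> e1; have E p : (Faut zeta * adaut f) (Amap phi beta p) = p.
  by have := congr1 (fun alpha : aut G => alpha p) e1.
have phi1 : phi = 1.
  apply: sgval_inj; apply: homeo_inj; apply: commute_V_id => v x.
  rewrite -adVE; congr (hfun (sgval _) _).
  have := congr1 (fun p => sdr p) (E (SdPair 1 v)).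
  by rewrite sdr_Faut_adaut.
subst phi.
have Ea (a : LGamma Gamma) (r : Q2) :
    sgval f r * beta (sgval a r) * (sgval f r)^-1 = sgval a r.
  have := congr1 (fun p => lval p r) (E (SdPair a 1)).
  rewrite lval_Faut_adaut sdr_Amap adV1 sdr_pair ell1 expgz0 mul1g lvalA !lval_pair.
  by have -> : Q2_act 1^-1 r = r by apply: Q2_inj.
have Ev v (r : Q2) : expgz (sgval zeta) (ell (sgval v) r)
    * (sgval f r * (sgval f (Q2_act v^-1 r))^-1) = 1.
  have := congr1 (fun p => lval p r) (E (SdPair 1 v)).
  by rewrite lval_Faut_adaut sdr_Amap adV1 sdr_pair lvalA !lval_pair aut1 mulg1.
have z1 : zeta = 1.
  apply: sgval_inj; have := Ev contract0^-1 Q2_zero.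
  have c0 : Q2_act contract0 Q2_zero = Q2_zero.
    by apply: Q2_inj; apply: contract0_zero.
  rewrite invgK c0 mulgV mulg1 /ell.
  have -> : hinv (sgval contract0^-1) zero = zero by apply: contract0_zero.
  rewrite log_slopeV.
  have -> : sgval contract0^-1 zero = zero.
    by rewrite -{1}contract0_zero VK.
  by rewrite (log_slope_contract0X 1) GRing.opprK.
subst zeta; pose g := sgval f Q2_zero.
have fg r : sgval f r = g.
  have [v vr] := Q2_transitive r Q2_zero.
  have := Ev v^-1 r; rewrite invgK vr expgz1g mul1g => /(congr1 (fun t => t * g)).
  by rewrite mulgVK mul1g.
exists g; split=> //; first by apply: sgval_inj; apply/funext.
apply: aut_inj => x /=; have := Ea (LGamma_cst x) Q2_zero; rewrite -/g /= => gx.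
by rewrite invgK -[X in _ = _ * X * _]gx -!mulgA mulVg mulg1 mulKg.
Qed.

(** This coincidence produces the kernel of Xi, and lets [conj_Jaut] absorb an inner coefficient map
    into f. *)
Lemma Aaut_inner g : Aaut 1 (inner g) = adaut (NK_const g).
Proof.
apply: aut_inj => p; apply: fg_dense => [r|]; last by rewrite /= sdr_admap adV1.
rewrite -[lval _ r in RHS]/(lval (admap _ p) r) lval_admap. by [].
Qed.

(** With beta trivial, the element g given by [kernel_FadA] is central, so its class is trivial.
    Injectivity is what gives the conjugation action its laws. *)
Lemma Jaut_inj : injective Jaut.
Proof.
suff J1 n : Jaut n = 1 -> n = 1.
  move=> n n' e; apply: (@mulIg _ n'^-1); rewrite mulgV; apply: J1.
  have : Jaut 1 = 1 by apply: (@mulgI _ (Jaut 1)); rewrite -JautM !mulg1.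
  by rewrite !JautM e -JautM mulgV.
case: n => zeta r; have [f ->] := quo_piP r; rewrite JautE => e.
have := @kernel_FadA zeta f 1 1; rewrite e mul1g => -[|g [-> -> _ b1]].
  by apply: aut_inj => p; apply: Amap1.
congr (_, _); apply/esym/quo_eqP; rewrite invg1 mul1g.
have cg : center_set g.
  move=> x; have := congr1 (fun b : aut Gamma => b x) b1 => /= xE.
  by rewrite {1}xE invgK !mulgA mulgV mul1g.
by exists (@SgIn _ (center Gamma) g cg).
Qed.

End BasicAutomorphisms.

(** * The copy of V on the sequences beginning with 1 *)

Section HalfEmbedding.
Implicit Types (x y z : cantor_space) (v g k : thompsonV).
Local Notation zero := (q2val Q2_zero).

Lemma cons_shift x : x = wcat [:: x 0%N] (shift 1 x).
Proof. by rewrite -[LHS](wcat_pref 1). Qed.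

Definition half_fun (h : cantor_space -> cantor_space) x : cantor_space :=
  if x 0%N then wcat [:: true] (h (shift 1 x)) else x.

Lemma half_funT h y : half_fun h (wcat [:: true] y) = wcat [:: true] (h y).
Proof. by rewrite /half_fun /= -[1%N]/(size [:: true]) shift_wcat. Qed.

Lemma half_funF h y : half_fun h (wcat [:: false] y) = wcat [:: false] y.
Proof. by []. Qed.

Lemma half_funK h h' : cancel h h' -> cancel (half_fun h) (half_fun h').
Proof.
move=> hK x; rewrite [x]cons_shift; case: (x 0%N); last by rewrite !half_funF.
by rewrite !half_funT hK.
Qed.

Lemma half_fun_affine v : locally_affine (half_fun (sgval v)).
Proof.
move=> x; case x0: (x 0%N); last first.
  exists [:: false], [:: false]; split=> //.
  by exists (shift 1 x) => //; rewrite -x0 -cons_shift.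
have [m [w [mx vm]]] := V_local v (shift 1 x).
exists (true :: m), (true :: w); split.
  by rewrite [x]cons_shift x0; apply/(sdi_catE [:: true]).
by move=> y; rewrite (wcat_cat [:: true] m) (wcat_cat [:: true] w) half_funT vm.
Qed.

Definition half v : thompsonV :=
  affine_V (half_funK (VK v)) (half_funK (VVK v)) (@half_fun_affine v).

Lemma halfE v x : sgval (half v) x = half_fun (sgval v) x.
Proof. reflexivity. Qed.

Lemma halfM : {morph half : v g / v * g}.
Proof.
move=> v g; apply: thompsonV_eq => x; rewrite (VM (half v)) !halfE.
by rewrite [x]cons_shift; case: (x 0%N); rewrite ?half_funT // !half_funF.
Qed.

Lemma half_fixnear v : fixnear (half v) zero.
Proof.
by exists [:: false]; [exists zero => //; apply: (wcat_zero 1) | exact: half_funF].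
Qed.

Definition unhalf_fun v y := shift 1 (sgval v (wcat [:: true] y)).

Lemma unhalf_funE v y : acts_on (sgval v) [:: false] [:: false] ->
  sgval v (wcat [:: true] y) = wcat [:: true] (unhalf_fun v y).
Proof.
move=> v0; rewrite [LHS]cons_shift; case e: (sgval v _ 0%N) => //.
have vf : sgval v (wcat [:: true] y) = sgval v (wcat [:: false] (unhalf_fun v y)).
  by rewrite v0 [LHS]cons_shift e.
by have /V_inj/(congr1 (fun r : cantor_space => r 0%N)) := vf.
Qed.

Lemma unhalf_funK v : acts_on (sgval v) [:: false] [:: false] ->
  cancel (unhalf_fun v) (unhalf_fun v^-1).
Proof.
move=> v0 y; rewrite {1}/unhalf_fun -unhalf_funE // VK.
by rewrite -[1%N]/(size [:: true]) shift_wcat.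
Qed.

Lemma unhalf_fun_affine v : acts_on (sgval v) [:: false] [:: false] ->
  locally_affine (unhalf_fun v).
Proof.
move=> v0 y; have [m [w [my vm]]] := V_local v (wcat [:: true] y).
have [u [s [e uy]]] := sdi_open (sdi_wcat [:: true] y) my.
(* One letter more than [u] ensures that the image word is nonempty; its first letter is then 1, and
   [behead] removes it. *)
move: uy => /sdi_catE uy; have [r er] := pref_cat y (leqnSn (size u)).
rewrite -(sdiP uy) in er; exists (u ++ r), (behead ((w ++ s) ++ r)).
split=> [|z]; first by rewrite -er; apply: sdi_pref.
have vz : sgval v (wcat [:: true] (wcat (u ++ r) z)) = wcat ((w ++ s) ++ r) z.
  rewrite -wcat_cat catA e; exact: (acts_on_cat r (acts_on_cat s vm)).
have : (0 < size ((w ++ s) ++ r))%N.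
  by have := congr1 size er; rewrite size_mkseq !size_cat; lia.
move: vz; rewrite unhalf_funE //; case: ((w ++ s) ++ r) => // b l vz _ /=.
have bt : b = true by have := congr1 (fun r : cantor_space => r 0%N) vz.
by subst b; apply: (@wcat_inj [:: true]); rewrite vz -wcat_cat.
Qed.

(** An element trivial on the cylinder of 0 comes from V through the morphism [half], so the
    simplicity of V applies to it. *)
Lemma half_surj v : acts_on (sgval v) [:: false] [:: false] -> exists g, v = half g.
Proof.
move=> v0; have v0' := acts_onV v0.
have K' : cancel (unhalf_fun v^-1) (unhalf_fun v).
  by have := unhalf_funK v0'; rewrite invgK.
exists (affine_V (unhalf_funK v0) K' (unhalf_fun_affine v0)).
apply: thompsonV_eq => x; rewrite halfE [x]cons_shift.
by case: (x 0%N); rewrite ?half_funT ?half_funF ?unhalf_funE // v0.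
Qed.

End HalfEmbedding.

(** * Automorphisms inducing the identity on V *)

Section Decomposition.
Variable Gamma : groupType.
Local Notation G := (fraction_group Gamma).
Local Notation zero := (q2val Q2_zero).
Local Notation cst := (@LGamma_cst Gamma).
Implicit Types (p q : G) (zeta xi : center Gamma) (phi psi : NHV).
Implicit Types (a b : LGamma Gamma) (v g k t : thompsonV) (x y z : cantor_space).
Implicit Types (m w e u : word) (alpha : aut G).

Definition inL a : G := SdPair a 1.
Definition inV v : G := SdPair 1 v.

Lemma lval_inL a x : lval (inL a) x = sgval a x. Proof. by []. Qed.
Lemma lval_inV v x : lval (inV v) x = 1. Proof. by []. Qed.

Lemma inLM a b : inL (a * b) = inL a * inL b.
Proof. by apply: fgP => //=; rewrite mulg1. Qed.
Lemma inVM v g : inV (v * g) = inV v * inV g.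
Proof. by apply: fgP => // x; rewrite lvalM !lval_inV mulg1. Qed.
Lemma inLV a v : SdPair a v = inL a * inV v.
Proof.
apply: fgP => [x|] /=; last by rewrite mul1g.
by rewrite lvalM lval_inV lval_inL mulg1.
Qed.
Lemma inVL v a : inV v * inL a = inL (LGamma_act v a) * inV v.
Proof.
apply: fgP => [x|] /=; last by rewrite mulg1 mul1g.
by rewrite !lvalM !lval_inL !lval_inV mul1g mulg1.
Qed.

Definition kap alpha a x := lval (alpha (inL a)) x.
Definition coc alpha v x := lval (alpha (inV v)) x.

Lemma restrict_split m a :
  restrict m a = restrict (rcons m false) a * restrict (rcons m true) a.
Proof.
apply: LGamma_eq => y.
rewrite -[RHS]/(sgval (restrict _ a) y * sgval (restrict _ a) y).
have o := @ortho_rcons m false; have [my|my] := pselect (sdi m y); last first.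
  by rewrite !restrictF ?mulg1 // => h; apply: my; apply/sdi_split; auto.
rewrite (restrictT _ my); case: (proj1 (sdi_split m y) my) => h.
- by rewrite (restrictT _ h) restrictF ?mulg1 // => /(o y h).
- by rewrite (restrictT _ h) restrictF ?mul1g // => h'; apply: (o y h').
Qed.

Section AutOverV.
Variable alpha : aut G.
Hypothesis sdr_alpha : forall p, sdr (alpha p) = sdr p.

Lemma lval_alpha a v x : lval (alpha (SdPair a v)) x = kap alpha a x * coc alpha v x.
Proof. by rewrite inLV afunM lvalM sdr_alpha. Qed.

Lemma kapM a b x : kap alpha (a * b) x = kap alpha a x * kap alpha b x.
Proof. by rewrite /kap inLM afunM lvalM sdr_alpha. Qed.

Lemma kap1 x : kap alpha 1 x = 1.
Proof. by apply: (@mulgI _ (kap alpha 1 x)); rewrite -kapM !mulg1. Qed.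

Lemma kapV a x : kap alpha a^-1 x = (kap alpha a x)^-1.
Proof. by apply: (@mulgI _ (kap alpha a x)); rewrite -kapM !mulgV kap1. Qed.

Lemma cocM v g x : coc alpha (v * g) x = coc alpha v x * coc alpha g (hinv (sgval v) x).
Proof. by rewrite /coc inVM afunM lvalM sdr_alpha. Qed.

Lemma coc1 x : coc alpha 1 x = 1.
Proof. by apply: (@mulgI _ (coc alpha 1 x)); rewrite -(cocM 1 1) !mulg1. Qed.

(** The image under alpha of the relation v a = a^v v: [kap] is equivariant up to conjugation by the
    cocycle. *)
Lemma coc_kap v a x : coc alpha v x * kap alpha a (hinv (sgval v) x)
  = kap alpha (LGamma_act v a) x * coc alpha v x.
Proof.
have := congr1 (fun p => lval (alpha p) x) (inVL v a).
by rewrite !afunM !lvalM !sdr_alpha.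
Qed.

Lemma sdr_ainv p : sdr (ainv alpha p) = sdr p.
Proof. by rewrite -[in RHS](ainvK alpha p) sdr_alpha. Qed.

Lemma kap_surj (h : Gamma) x : exists b, kap alpha b x = h.
Proof.
exists (sdl (ainv alpha (inL (cst h)))).
rewrite /kap; have -> : inL (sdl (ainv alpha (inL (cst h)))) = ainv alpha (inL (cst h)).
  by apply: sdprod_eq => //=; rewrite sdr_ainv.
by rewrite ainvK.
Qed.

Definition supported m a := forall x, ~ sdi m x -> sgval a x = 1.

Lemma supported_restrict m a : supported m (restrict m a).
Proof. by move=> x; apply: restrictF. Qed.

Lemma supported_comm m e a b : ortho m e -> supported m a -> supported e b ->
  a * b = b * a.
Proof.
move=> me sa sb; apply: LGamma_eq => x.
rewrite -[LHS]/(sgval a x * sgval b x) -[RHS]/(sgval b x * sgval a x).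
have [mx|/sa ->] := pselect (sdi m x); last by rewrite mulg1 mul1g.
by rewrite (sb x) ?mulg1 ?mul1g // => /(me x mx).
Qed.

Definition offset m a : LGamma Gamma := (restrict m a)^-1 * a.

Lemma offsetT m a x : sdi m x -> sgval (offset m a) x = 1.
Proof.
by move=> mx; rewrite -[LHS]/((sgval (restrict m a) x)^-1 * sgval a x) restrictT ?mulVg.
Qed.

Lemma supported_offset m a b : supported m b -> offset m a * b = b * offset m a.
Proof.
move=> sb; apply: LGamma_eq => x.
rewrite -[LHS]/(sgval (offset m a) x * sgval b x).
rewrite -[RHS]/(sgval b x * sgval (offset m a) x).
have [/offsetT ->|/sb ->] := pselect (sdi m x); by rewrite mulg1 mul1g.
Qed.

(* For x outside the cylinder of m, the values at x of the images of the maps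
   supported in m form a normal subgroup of Gamma; moving m into a disjoint
   cylinder by an element of V fixing x, this subgroup commutes with itself. *)
Lemma kap_supported_central m a x : ~ sdi m x -> supported m a ->
  center_set (kap alpha a x).
Proof.
move=> mx sa h; have [b <-] := kap_surj h x.
have [e [em ex]] := exists_ortho mx; pose g := swap m e.
have me := ortho_sym em.
have gx : hinv (sgval g) x = x.
  by rewrite -[LHS]/(sgval g^-1 x) swapV; apply: swap_id.
have se : supported e (LGamma_act g a).
  move=> y ey; rewrite -[LHS]/(sgval a (sgval g^-1 y)) swapV; apply: sa.
  move=> my; apply: ey; rewrite -[y](VVK g).
  by apply/(acts_on_sdi _ (swapl me)); rewrite swapV.
(* Conjugating the translate by a map whose [kap] at x equals the cocycle of [g] cancels that
   cocycle and keeps the support in [e]. *)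
have [a' sa' a'E] : exists2 a', supported e a' & kap alpha a x = kap alpha a' x.
  have [c cE] := kap_surj (coc alpha g x) x.
  exists (c^-1 * LGamma_act g a * c).
    move=> y ey; rewrite -[LHS]/((sgval c y)^-1 * sgval (LGamma_act g a) y * sgval c y).
    by rewrite se // mulg1 mulVg.
  rewrite !kapM kapV cE; have := coc_kap g a x; rewrite gx => E.
  by rewrite -mulgA -E mulKg.
have cr : kap alpha a x * kap alpha (restrict m b) x
        = kap alpha (restrict m b) x * kap alpha a x.
  by rewrite a'E -!kapM (supported_comm me (@supported_restrict m b) sa').
have co : kap alpha a x * kap alpha (offset m b) x
        = kap alpha (offset m b) x * kap alpha a x.
  by rewrite -!kapM supported_offset.
have -> : b = restrict m b * offset m b by rewrite /offset mulVKg.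
by rewrite kapM mulgA cr -mulgA co mulgA.
Qed.

(** Each half of [m] is the image of [m] under an element of V fixing x. The value u at x is
    central, so the cocycle does not alter it and both halves have value u as well; then u = u u. *)
Lemma kap_cylinder m (h : Gamma) x : ~ sdi m x ->
  kap alpha (restrict m (cst h)) x = 1.
Proof.
move=> mx; have [e [em ex]] := exists_ortho mx.
pose r w := restrict w (cst h); rewrite -/(r m).
have rE w y : sgval (r w) y = if `[< sdi w y >] then h else 1 by [].
have half_eq s : kap alpha (r (m ++ [:: s])) x = kap alpha (r m) x.
  pose g := swap e (m ++ [:: s]) * swap m e.
  have gm : acts_on (sgval g) m (m ++ [:: s]) := contract_V [:: s] em.
  have gx : hinv (sgval g) x = x.
    have {1}<- : sgval g x = x; last by apply: hfunK.
    by rewrite /g VM !swap_id // => /sdi_sub.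
  have <- : LGamma_act g (r m) = r (m ++ [:: s]).
    apply: LGamma_eq => y; rewrite -[LHS]/(sgval (r m) (sgval g^-1 y)) !rE.
    congr (if _ then _ else _); apply/asbool_equiv_eq.
    by rewrite -(acts_on_sdi _ gm) VVK.
  have := coc_kap g (r m) x; rewrite gx.
  rewrite -(kap_supported_central mx (@supported_restrict m (cst h)) (coc alpha g x)).
  by move=> /mulIg.
have rm : r m = r (m ++ [:: false]) * r (m ++ [:: true]).
  by rewrite !cats1; apply: restrict_split.
have : kap alpha (r m) x * 1 = kap alpha (r m) x * kap alpha (r m) x.
  by rewrite mulg1 {1}rm kapM !half_eq.
by move=> /mulgI <-.
Qed.

(** Cut [a] into cylinders on which it is constant: [kap_cylinder] kills the pieces away from x, and
    the piece containing x is trivial because a(x) = 1. *)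
Lemma kap_local1 a x : sgval a x = 1 -> kap alpha a x = 1.
Proof.
move=> ax; have [N NP] := loc_const_depth (sgvalP a).
suff H n u : (size u + n)%N = N -> kap alpha (restrict u a) x = 1.
  rewrite -(H N [::]) //; congr (kap alpha _ x).
  by apply: LGamma_eq => y; rewrite restrictT.
elim: n u => [|n IHn] u un.
  have {}un : size u = N by rewrite -un addn0.
  have [ux|ux] := pselect (sdi u x).
    rewrite -[RHS](kap1 x); congr (kap alpha _ x); apply: LGamma_eq => y.
    have [uy|uy] := pselect (sdi u y); last by rewrite restrictF.
    rewrite restrictT // -(wcat_shift uy) (NP u un _ (shift (size u) x)).
    by rewrite wcat_shift.
  rewrite -(kap_cylinder (sgval a (wcat u x)) ux); congr (kap alpha _ x).
  apply: LGamma_eq => y; have [uy|uy] := pselect (sdi u y); last by rewrite !restrictF.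
  by rewrite !restrictT //= -(wcat_shift uy) (NP u un _ x).
by rewrite restrict_split kapM !IHn ?mulg1 // size_rcons; lia.
Qed.

Lemma kap_local a x : kap alpha a x = kap alpha (cst (sgval a x)) x.
Proof.
have : kap alpha (a * (cst (sgval a x))^-1) x = 1.
  by apply: kap_local1; rewrite -[LHS]/(sgval a x * (sgval a x)^-1) mulgV.
rewrite kapM kapV => /(congr1 (fun h => h * kap alpha (cst (sgval a x)) x)).
by rewrite mulgVK mul1g.
Qed.

Lemma coc_kap_cst v (h : Gamma) x :
  coc alpha v x * kap alpha (cst h) (hinv (sgval v) x) = kap alpha (cst h) x * coc alpha v x.
Proof. by rewrite coc_kap; congr (kap alpha _ x * _); apply: LGamma_eq. Qed.

End AutOverV.

(** By locality of [kap] for the inverse automorphism, a map may be replaced by the constant equal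
    to its value at x. *)
Lemma kap_ainv alpha (h : Gamma) x : (forall p, sdr (alpha p) = sdr p) ->
  kap (aut_inv alpha) (cst (kap alpha (cst h) x)) x = h.
Proof.
move=> sa; have sa' p : sdr (aut_inv alpha p) = sdr p by apply: sdr_ainv.
pose a := sdl (alpha (inL (cst h))).
have aE : inL a = alpha (inL (cst h)) by apply: sdprod_eq => //=; rewrite sa.
rewrite -[kap alpha (cst h) x]/(sgval a x) -kap_local // /kap aE.
by rewrite /= afunK.
Qed.

End Decomposition.

(** * The cocycle at 0 and the decomposition over the identity of V *)

Section CocycleAtZero.
Variable Gamma : groupType.
Local Notation G := (fraction_group Gamma).
Local Notation zero := (q2val Q2_zero).
Local Notation cst := (@LGamma_cst Gamma).
Implicit Types (p q : G) (v g k t s : thompsonV) (x y z : cantor_space).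

Variable alpha : aut G.
Hypothesis sdr_alpha : forall p, sdr (alpha p) = sdr p.

Lemma kap_cstK :
  cancel (fun h => kap alpha (cst h) zero) (fun h => kap (aut_inv alpha) (cst h) zero).
Proof. by move=> h; apply: kap_ainv. Qed.
Lemma kap_cstVK :
  cancel (fun h => kap (aut_inv alpha) (cst h) zero) (fun h => kap alpha (cst h) zero).
Proof. by move=> h; apply: (@kap_ainv _ (aut_inv alpha)); apply: sdr_ainv. Qed.
Lemma kap_cstM x : {morph (fun h => kap alpha (cst h) x) : h h' / h * h'}.
Proof. by move=> h h'; rewrite -kapM //; congr (kap alpha _ x); apply: LGamma_eq. Qed.

Definition kap0 : aut Gamma := Aut kap_cstK kap_cstVK (kap_cstM zero).

Lemma hinv_fix v x : sgval v x = x -> hinv (sgval v) x = x.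
Proof. by move=> {1}<-; apply: hfunK. Qed.

(** At a fixed point, equivariance says that the cocycle commutes with the values of [kap0], which
    fill Gamma. *)
Lemma coc_zero_central t : sgval t zero = zero -> center_set (coc alpha t zero).
Proof.
move=> t0 h; have := coc_kap_cst sdr_alpha t (ainv kap0 h) zero.
by rewrite hinv_fix // -[kap alpha _ zero]/(kap0 (ainv kap0 h)) ainvK.
Qed.

Lemma coc_zeroM s t : sgval s zero = zero ->
  coc alpha (s * t) zero = coc alpha s zero * coc alpha t zero.
Proof. by move=> s0; rewrite cocM // hinv_fix. Qed.

Lemma coc_half v : coc alpha (half v) zero = 1.
Proof.
have half0 s : sgval (half s) zero = zero by apply: fixnear_fix; apply: half_fixnear.
apply: (V_hom_abelian_trivial (chi := fun v => coc alpha (half v) zero)) => s t.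
  by rewrite halfM coc_zeroM.
exact: coc_zero_central.
Qed.

(** A power of [contract0] conjugates k to an element trivial on the whole cylinder of 0, which lies
    in the image of [half]; there the cocycle at 0 is a homomorphism from V with central values. *)
Lemma coc_fixnear k : fixnear k zero -> coc alpha k zero = 1.
Proof.
move=> kf; have k0 := fixnear_fix kf; case: kf => m m0 km.
have {}km : acts_on (sgval k) (nseq (size m).+1 false) (nseq (size m).+1 false).
  by rewrite -addn1 nseqD -(sdi_zero_nseq m0); apply: acts_on_cat.
pose s := contract0 ^+ size m; have s0 : sgval s zero = zero by apply: contract0X_zero.
have sm : acts_on (sgval s) [:: false] (nseq (size m).+1 false).
  by have := @contract0X (size m) 0; rewrite addn0.
have [g gE] : exists g, s^-1 * k * s = half g.
  by apply: half_surj; apply: acts_onM sm (acts_onM km (acts_onV sm)).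
have sV0 : sgval s^-1 zero = zero by rewrite -{1}s0 VK.
clearbody s.
have : coc alpha (s * (s^-1 * k * s)) zero = coc alpha (k * s) zero by rewrite !mulgA mulgV mul1g.
rewrite gE (coc_zeroM _ s0) coc_half mulg1 (coc_zeroM _ k0).
by rewrite -{1}[coc alpha s zero]mul1g => /mulIg.
Qed.

Lemma coc_stabilizer t : sgval t zero = zero ->
  coc alpha t zero = expgz (coc alpha contract0 zero)^-1 (log_slope (sgval t) zero).
Proof.
move=> t0; have [n [k [kf]]] := stabilizer0_germ t0.
have cX j : coc alpha (contract0 ^+ j) zero = coc alpha contract0 zero ^+ j.
  elim: j => [|j IHj]; first exact: coc1.
  by rewrite !expgS coc_zeroM ?IHj //; apply: contract0_zero.
case=> -[e ->].
  rewrite e coc_zeroM ?contract0X_zero // (coc_fixnear kf) mulg1 cX.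
  by rewrite expgzN /= expVgn invgK.
have := coc_fixnear kf; rewrite -e coc_zeroM ?contract0X_zero // cX.
move=> E; apply: (@mulgI _ (coc alpha contract0 zero ^+ n)).
by rewrite E /= expVgn mulgV.
Qed.

(** The inverse is taken because [contract0] has exponent -1 at 0. *)
Definition zeta0 : center Gamma :=
  @SgIn Gamma (center Gamma) (coc alpha contract0 zero)^-1
    (centerV (coc_zero_central contract0_zero)).

Definition reduced_coc v x := expgz (sgval zeta0) (- ell (sgval v) x)%R * coc alpha v x.

Lemma coc_reduced v x :
  coc alpha v x = expgz (sgval zeta0) (ell (sgval v) x) * reduced_coc v x.
Proof. by rewrite /reduced_coc expgzN mulVKg. Qed.

Lemma reduced_cocM v g x :
  reduced_coc (v * g) x = reduced_coc v x * reduced_coc g (hinv (sgval v) x).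
Proof.
rewrite /reduced_coc ellM GRing.opprD expgzD cocM // -!mulgA; congr (_ * _).
rewrite !mulgA; congr (_ * _).
exact: (expgz_center _ (sgvalP zeta0)).
Qed.

Lemma ell_fix v x : sgval v x = x -> ell (sgval v) x = log_slope (sgval v) x.
Proof. by move=> vx; rewrite /ell hinv_fix. Qed.

Lemma reduced_coc_stabilizer t : sgval t zero = zero -> reduced_coc t zero = 1.
Proof.
by move=> t0; rewrite /reduced_coc ell_fix // coc_stabilizer // -expgzD GRing.addNr.
Qed.

(** A cocycle that is trivial on the stabiliser of 0 is a coboundary on the orbit of 0. The
    potential at v0 is the value of the reduced cocycle of v, for whichever v was chosen
    ([potentialE]). *)
Definition potential : Kbar Gamma :=
  fun q : Q2 => reduced_coc (sval (cid (Q2_transitive Q2_zero q))) q.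

Lemma potentialE v (q : Q2) : Q2_act v Q2_zero = q -> potential q = reduced_coc v q.
Proof.
move=> vq; rewrite /potential; case: cid => w /= wq.
have -> : v = w * (w^-1 * v) by rewrite mulVKg.
have wq0 : hinv (sgval w) q = zero by rewrite -wq; apply: hfunK.
rewrite reduced_cocM wq0 reduced_coc_stabilizer ?mulg1 // VM.
by rewrite -[sgval v zero]/(q2val (Q2_act v Q2_zero)) vq.
Qed.

Lemma potential_coc v (q : Q2) :
  reduced_coc v q = potential q * (potential (Q2_act v^-1 q))^-1.
Proof.
have [w wq] := Q2_transitive Q2_zero (Q2_act v^-1 q).
have vwq : Q2_act (v * w) Q2_zero = q.
  by apply: Q2_inj; have /= -> := congr1 q2val wq; apply: hinvK.
rewrite (potentialE vwq) reduced_cocM -[hinv _ _]/(q2val (Q2_act v^-1 q)).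
by rewrite -(potentialE wq) mulgK.
Qed.

(** Equivariance carries [kap0] along the orbit of 0; the power of zeta in the cocycle is central
    and cancels, leaving the same potential. *)
Lemma kap_potential (h : Gamma) (q : Q2) :
  kap alpha (cst h) q = potential q * kap0 h * (potential q)^-1.
Proof.
have [v vq] := Q2_transitive Q2_zero q.
have := coc_kap_cst sdr_alpha v h q.
have -> : hinv (sgval v) q = zero by rewrite -vq; apply: hfunK.
rewrite -[kap alpha _ zero]/(kap0 h) coc_reduced -(potentialE vq).
have zc := expgz_center (ell (sgval v) q) (sgvalP zeta0).
rewrite -mulgA [in RHS]mulgA -[in RHS]zc -[in RHS]mulgA => /mulgI ->.
by rewrite mulgK.
Qed.

Lemma decomposition : exists (zeta : center Gamma) (f : NK Gamma),
  alpha = Faut zeta * adaut f * Aaut 1 kap0.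
Proof.
have key p : iotaG ((Faut zeta0)^-1 (alpha p))
    = iotaK potential * iotaG (Aaut 1 kap0 p) * (iotaK potential)^-1.
  apply: sdprod_eq; last first.
    by rewrite -iotaKV /= sdr_alpha adV1 mul1g mulg1.
  apply/funext => q; rewrite iota_conjE -[LHS]/(lval (Fmap zeta0^-1 (alpha p)) q).
  rewrite -[lval _ q in RHS]/(kap0 (lval p q)) -[sdr _]/(adV 1 (sdr p)) adV1.
  rewrite lvalF sdr_alpha; case: p => a v; rewrite lval_alpha // kap_local //.
  rewrite kap_potential coc_reduced potential_coc lval_pair sdr_pair.
  have zc := expgz_center (ell (sgval v) q) (sgvalP zeta0).
  rewrite expgzVl.
  have cancelE (c K R : Gamma) : center_set c -> c^-1 * (K * (c * R)) = K * R.
    by move=> cc; rewrite (mulgA K) -cc -mulgA mulKg.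
  by rewrite cancelE // mulgA mulgVK.
pose alpha2 := (Faut zeta0)^-1 * (alpha * (Aaut 1 kap0)^-1).
have [f fE a2E] : exists2 f : NK Gamma, sgval f = potential & alpha2 = adaut f.
  apply: adaut_of_conj => p; rewrite -{2}(ainvK (Aaut 1 kap0) p) -key.
  by [].
exists zeta0, f; rewrite -a2E /alpha2 mulVKg mulgVK.
by [].
Qed.

End CocycleAtZero.

(** * The automorphism group of G *)

Section InnerStructure.
Variable Gamma : groupType.
Local Notation G := (fraction_group Gamma).
Local Notation zero := (q2val Q2_zero).
Local Notation cst := (@LGamma_cst Gamma).
Implicit Types (p q : G) (zeta xi : center Gamma) (phi psi : NHV).
Implicit Types (beta : aut Gamma) (f h : NK Gamma).
Implicit Types (v g k t s : thompsonV) (x y z : cantor_space).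

Section InnerAtZero.
Variable alpha : aut G.
Hypothesis sdr_alpha : forall p, sdr (alpha p) = sdr p.

Definition inner_at x := exists c, forall h : Gamma, kap alpha (cst h) x = c * h * c^-1.

Lemma inner_at_V v x : inner_at x -> inner_at (sgval v x).
Proof.
move=> [c cP]; exists (coc alpha v (sgval v x) * c) => h.
have := coc_kap_cst sdr_alpha v h (sgval v x); rewrite hfunK cP => E.
by rewrite invgM !mulgA -(mulgA _ c) -(mulgA _ (c * h)) E mulgK.
Qed.

(* Contracting a point where kap is inner towards 0 does not change kap, as the
   cocycle of the contraction is locally constant and central at 0. *)
Lemma inner_at_zero x : inner_at x -> exists c, kap0 sdr_alpha = inner c.
Proof.
move=> xI; have [n nP] := lval_near (alpha (inV Gamma contract0)) zero.
have prefE j : pref j zero = nseq j false.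
  by rewrite [RHS](sdiP (sdi_zero j)) size_nseq.
have cocE y : sdi (nseq n.+1 false) y ->
    coc alpha contract0 y = coc alpha contract0 zero.
  by rewrite -prefE; apply: nP.
(* V moves x into the neighbourhood of 0 where the cocycle is constant. One zero more than n is
   used, as [contract0] contracts only inside the cylinder of 0. *)
have [y yn [c cP]] : exists2 y, sdi (nseq n.+1 false) y & inner_at y.
  have [xn|xn] := pselect (sdi (nseq n.+1 false) x); first by exists x.
  have o := ortho_pref xn (leqnn _).
  exists (sgval (swap (pref (size (nseq n.+1 false)) x) (nseq n.+1 false)) x).
    by apply/(acts_on_sdi _ (swapl o)); apply: sdi_pref.
  exact: inner_at_V.
exists c; apply: aut_inj => h; rewrite -[LHS]/(kap alpha (cst h) zero) /= -cP.
have yj j : sdi (nseq (j + n).+1 false) (sgval (contract0 ^+ j) y).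
  by apply/(acts_on_sdi _ (@contract0X j n)).
have kapj j : kap alpha (cst h) (sgval (contract0 ^+ j) y) = kap alpha (cst h) y.
  elim: j => [//|j IHj]; rewrite -IHj expgS VM; set w := sgval (contract0 ^+ j) y.
  have := coc_kap_cst sdr_alpha contract0 h (sgval contract0 w).
  rewrite hfunK cocE.
    have cz := coc_zero_central sdr_alpha contract0_zero.
    by rewrite cz => /mulIg ->.
  have := yj j.+1; rewrite expgS VM -/w.
  have -> : ((j.+1 + n).+1 = n.+1 + j.+1)%N by lia.
  by rewrite nseqD; apply: sdi_sub.
have [N NP] := lval_near (alpha (inL (cst h))) zero.
rewrite -(kapj N); apply/esym; apply: (NP N) => //; rewrite prefE.
by have := yj N; rewrite -addnS nseqD; apply: sdi_sub.
Qed.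

End InnerAtZero.

Lemma sdr_Aaut_inv phi beta p : sdr ((Aaut phi beta)^-1 p) = adV phi^-1 (sdr p).
Proof. by []. Qed.

Lemma lval_Aaut_inv phi beta p x :
  lval ((Aaut phi beta)^-1 p) x = ainv beta (lval p (sgval phi x)).
Proof. by []. Qed.

(** The conjugate induces the identity on V, and its coefficient map at phi(0) is conjugation by
    beta(f(0)), whether or not phi(0) is in Q_2. [inner_at_zero] makes it inner at 0, and the
    constant c enters the map h. *)
Lemma conj_Jaut phi beta zeta f : exists xi h,
  Aaut phi beta * (Faut zeta * adaut f) * (Aaut phi beta)^-1 = Faut xi * adaut h.
Proof.
set alpha := _ * _ * _.
have sdr_alpha p : sdr (alpha p) = sdr p.
  rewrite -[LHS]/(adV phi (sdr ((Faut zeta * adaut f) ((Aaut phi beta)^-1 p)))).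
  by rewrite sdr_Faut_adaut sdr_Aaut_inv adVVK.
have [c cE] : exists c, kap0 sdr_alpha = inner c.
  apply: (@inner_at_zero _ _ (sgval phi zero)); exists (beta (sgval f Q2_zero)) => g.
  rewrite -[LHS]/(beta (lval ((Faut zeta * adaut f) ((Aaut phi beta)^-1 (inL (cst g))))
    (hinv (sgval phi) (sgval phi zero)))).
  rewrite hfunK lval_Faut_adaut sdr_Aaut_inv lval_Aaut_inv.
  have -> : adV phi^-1 (sdr (inL (cst g))) = 1. by apply: adV_one.
  have -> : Q2_act 1^-1 Q2_zero = Q2_zero by apply: Q2_inj.
  by rewrite ell1 expgz0 mul1g !afunM autV -[lval _ _]/g ainvK.
have [xi [h ->]] := decomposition sdr_alpha; exists xi, (h * NK_const c).
by rewrite cE Aaut_inner adaut_mul mulgA.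
Qed.

(** At a point z = phi^-1(r) of Q_2 this is the formula for ad(f). Outside Q_2, f is constant near z
    and near its preimage under the V-part of p, so the identity can be read at a point of Q_2 close
    to z. *)
Lemma lval_translate f (fphi : Kbar Gamma) phi p (r : Q2) :
  is_translate (sgval phi) (sgval f) fphi ->
  lval (admap f p) (hinv (sgval phi) r)
  = fphi r * lval p (hinv (sgval phi) r)
    * (fphi (Q2_act (adV phi (sdr p))^-1 r))^-1.
Proof.
move=> ft; set z := hinv _ r; set s := Q2_act _ r.
have sE : hinv (sgval phi) s = hinv (sgval (sdr p)) z.
  rewrite -[q2val s]/(sgval (adV phi (sdr p))^-1 r) -adVV.
  by rewrite -{1}(hinvK (sgval phi) r) adVE hfunK.
have [zQ|zQ] := pselect (Q2_set z).
  have E1 : fphi r = sgval f (InQ2 zQ).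
    by apply: Kval_unique (ft r) _; left; exists (InQ2 zQ).
  have E2 : fphi s = sgval f (Q2_act (sdr p)^-1 (InQ2 zQ)).
    apply: Kval_unique (ft s) _; left; exists (Q2_act (sdr p)^-1 (InQ2 zQ)) => //.
  by rewrite E1 E2 -lval_admap.
have [m mz mf] : exists2 m, sdi m z & forall q : Q2, sdi m q -> sgval f q = fphi r.
  have [[q qz _]|[_ fr]] := ft r; last exact: fr.
  by case: zQ; have := q2P q; rewrite qz.
have [w wz wf] : exists2 w, sdi w (hinv (sgval (sdr p)) z) &
    forall q : Q2, sdi w q -> sgval f q = fphi s.
  have [[q qz _]|[_ fs]] := ft s; last by rewrite -sE; exact: fs.
  case: zQ; rewrite -[z](VVK (sdr p)); apply: Q2_thompsonV.
  by have := q2P q; rewrite qz sE.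
have [n nP] := lval_near (admap f p) z; have [k kP] := lval_near p z.
have [l lP] := homeo_sdi (f := (sgval (sdr p))^-1) wz.
pose N := (n + k + l + size m)%N; pose q := Q2_near N z.
have qN : sdi (pref N z) q by apply: Q2_nearP.
have mq : sdi m q.
  have mN : (size m <= N)%N by rewrite /N; lia.
  by have [u e] := pref_cat z mN; move: qN; rewrite e -(sdiP mz) => /sdi_sub.
have wq : sdi w (Q2_act (sdr p)^-1 q).
  by apply: (lP N) qN; rewrite /N; lia.
rewrite -(nP N _ q qN) ?lval_admap ?(mf _ mq) ?(wf _ wq); last by rewrite /N; lia.
by rewrite (kP N _ q qN) // /N; lia.
Qed.

Lemma center_shuffle (c e1 e2 F A F' : Gamma) : center_set e1 -> center_set e2 ->
  c^-1 * (c * e1 * e2^-1 * (F * A * F'^-1)) = F * e1 * A * (F' * e2)^-1.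
Proof.
move=> c1 /centerV c2; rewrite invgM -(c1 F) -!mulgA mulKg; congr (_ * _).
by rewrite c2 -!mulgA -c2.
Qed.

(** [ell_gammaphi] splits the exponent of zeta: the multiple of ell gives the new central element,
    and the coboundary joins f^phi. *)
Lemma conj_Jaut_translate phi beta zeta f (fphi : Kbar Gamma) :
  is_translate (sgval phi) (sgval f) fphi ->
  exists2 h : NK Gamma, sgval h = Kmap beta fphi
                   * zpow (beta (sgval zeta)) (gammaphi (sgval phi))
  & Aaut phi beta * (Faut zeta * adaut f) * (Aaut phi beta)^-1
    = Faut (aut_center beta zeta ^+ kphi (sgval phi)) * adaut h.
Proof.
move=> ft; set alpha := _ * _ * _; set xi := _ ^+ _.
have [h hE aE] : exists2 h : NK Gamma, sgval h = Kmap beta fphi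
                   * zpow (beta (sgval zeta)) (gammaphi (sgval phi))
    & (Faut xi)^-1 * alpha = adaut h; last first.
  by exists h => //; rewrite -aE mulVKg.
apply: adaut_of_conj => p; rewrite -(ainvK (Aaut phi beta) p).
set q := ainv _ p; apply: (@mulgI _ (iotaG 1)); rewrite iotaG1 !mul1g.
have aq : alpha (Aaut phi beta q) = Amap phi beta (Fmap zeta (admap f q)).
  rewrite -[LHS]/(Amap phi beta (Fmap zeta (admap f
    (ainv (Aaut phi beta) (Aaut phi beta q))))).
  by rewrite afunK.
have zc : center_set (beta (sgval zeta)) by apply: aut_center_subproof.
apply: sdprod_eq; last first.
  rewrite -iotaKV -[LHS]/(sdr (alpha (Aaut phi beta q))) aq.
  rewrite -[LHS]/(adV phi (sdr (admap f q))) sdr_admap.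
  by rewrite -[RHS]/(1 * adV phi (sdr q) * 1) mul1g mulg1.
apply/funext => r; rewrite iota_conjE.
rewrite -[LHS]/(lval (Fmap xi^-1 (alpha (Aaut phi beta q))) r) aq lvalF.
rewrite sdr_Amap lvalA lvalF sdr_admap -[sdr (Fmap _ _)]/(sdr (admap f q)) sdr_admap.
rewrite (lval_translate q r ft).
have xiE : sgval xi = beta (sgval zeta) ^+ kphi (sgval phi).
  rewrite /xi; elim: (kphi _) => // n IHn.
  by rewrite !expgS -IHn.
rewrite -[sgval xi^-1]/((sgval xi)^-1) xiE expgzVl expgzX.
have := ell_gammaphi phi (adV phi (sdr q)) r; rewrite adVK => ->.
rewrite !expgzD expgzN !afunM !autV !aut_expgz.
apply: center_shuffle; exact: expgz_center.
Qed.

Lemma sdr_aut_inL (alpha : aut G) a : sdr (alpha (inL a)) = 1.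
Proof.
pose P := [set v | exists a, sdr (alpha (inL a)) = v].
pose N (s : bool) := [set v | exists2 a, supported [:: s] a & sdr (alpha (inL a)) = v].
have sdrM p q : sdr (alpha (p * q)) = sdr (alpha p) * sdr (alpha q) by rewrite afunM.
have inL1 : inL (1 : LGamma Gamma) = 1 by [].
have sdr1 : sdr (alpha (inL 1)) = 1 by rewrite inL1 aut1.
have PM v g : P v -> P g -> P (v * g).
  by move=> [b <-] [c <-]; exists (b * c); rewrite inLM sdrM.
have sdrV b : sdr (alpha (inL b^-1)) = (sdr (alpha (inL b)))^-1.
  apply: (@mulgI _ (sdr (alpha (inL b)))).
  by rewrite -sdrM -inLM !mulgV sdr1.
have PV v : P v -> P v^-1 by move=> [b <-]; exists b^-1.
pose PS := @Subgroup thompsonV P (ex_intro _ 1 sdr1) PM PV.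
have conjL p b : p * inL b * p^-1 = inL (sdl p * LGamma_act (sdr p) b * (sdl p)^-1).
  apply: (@mulIg _ p); rewrite mulgVK; case: p => c v.
  rewrite -[sdl _]/c -[sdr _]/v (inLV c v) -mulgA inVL !inLM !mulgA.
  by rewrite -(mulgA (inL c * inL _) (inL c^-1)) -(inLM c^-1 c) mulVg inL1 mulg1.
have PJ g v : P v -> P (g * v * g^-1).
  move=> [b <-]; pose p := ainv alpha (inV Gamma g).
  exists (sdl p * LGamma_act (sdr p) b * (sdl p)^-1); rewrite -conjL !sdrM /p ainvK.
  by rewrite autV ainvK.
pose PN := @NSubgroup thompsonV PS PJ.
apply: contrapT => a1.
have PT v : P v by apply: (@V_simple PN (sdr (alpha (inL a)))) => //; exists a.
have N_split v : exists v0 v1, [/\ N false v0, N true v1 & v = v0 * v1].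
  have [b <-] := PT v; exists (sdr (alpha (inL (restrict [:: false] b)))).
  exists (sdr (alpha (inL (restrict [:: true] b)))); split.
  - by exists (restrict [:: false] b) => //; apply: supported_restrict.
  - by exists (restrict [:: true] b) => //; apply: supported_restrict.
  rewrite -sdrM -inLM -(@restrict_split _ [::]); congr (sdr (alpha (inL _))).
  by apply: LGamma_eq => x; rewrite restrictT.
(* Every g in V is now the image of some c in LGamma, and conjugation by c preserves supports.
   Together with [N_swap] this makes the two subgroups equal, and a subgroup commuting with itself
   is abelian. *)
have NJ (s : bool) g v : N s v -> N s (g * v * g^-1).
  move=> [b sb <-]; have [c <-] := PT g; exists (c * b * c^-1).
    move=> x /sb bx; rewrite -[LHS]/(sgval c x * sgval b x * (sgval c x)^-1).
    by rewrite bx mulg1 mulgV.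
  by rewrite !inLM !sdrM sdrV.
have ft : ortho [:: false] [:: true] by apply: (@ortho_catS [::] false true [::] [::]).
pose w := swap [:: false] [:: true].
have N_swap (s : bool) v : N s v -> N (~~ s) v.
  move=> [b sb bv]; pose c := sdr (alpha (inV Gamma w)).
  suff : N (~~ s) (c * v * c^-1).
    by move=> /(NJ _ c^-1); rewrite invgK !mulgA mulVg mul1g mulgVK.
  exists (LGamma_act w b).
    move=> x xs; apply: sb => xs'; apply: xs.
    rewrite -[x](VVK w); apply/(acts_on_sdi (m := [:: s])) => //.
    by case: (s); [apply: swapr | apply: swapl].
  rewrite -bv; apply: (@mulIg _ c); rewrite mulgVK -!sdrM -inVL.
  by [].
have NC (s : bool) v g : N s v -> N (~~ s) g -> v * g = g * v.
  move=> [b sb <-] [c sc <-]; rewrite -!sdrM -!inLM.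
  rewrite (@supported_comm _ [:: s] [:: ~~ s]) //.
  by case: (s) => //; apply: ortho_sym.
have [g [h [_ _]]] := V_noncommuting [::]; apply.
have [g0 [g1 [Ng0 Ng1 ->]]] := N_split g; have [h0 [h1 [Nh0 Nh1 ->]]] := N_split h.
have Ng1' := N_swap _ _ Ng1.
have c00 : g0 * h0 = h0 * g0 by apply: (NC false) => //; apply: (N_swap false).
have c01 : g0 * h1 = h1 * g0 by apply: (NC false).
have c10 : g1 * h0 = h0 * g1 by apply: (NC true).
have c11 : g1 * h1 = h1 * g1 by apply: (NC true) => //; apply: (N_swap true).
rewrite (mulgACA_comm g0 h1 c10) c00 c11; exact: mulgACA_comm c01.
Qed.

Lemma sdr_aut_inV (alpha : aut G) p : sdr (alpha p) = sdr (alpha (inV Gamma (sdr p))).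
Proof.
case: p => a v; rewrite -[sdr (SdPair a v)]/v inLV afunM.
by rewrite -[LHS]/(sdr (alpha (inL a)) * sdr (alpha (inV Gamma v))) sdr_aut_inL mul1g.
Qed.

Lemma induced_K (alpha : aut G) :
  cancel (fun v => sdr (alpha (inV Gamma v))) (fun v => sdr (ainv alpha (inV Gamma v))).
Proof.
move=> v; have := sdr_aut_inV (aut_inv alpha) (alpha (inV Gamma v)).
by rewrite /= afunK => <-.
Qed.

Lemma induced_M (alpha : aut G) :
  {morph (fun v => sdr (alpha (inV Gamma v))) : v g / v * g}.
Proof. by move=> v g; rewrite inVM afunM. Qed.

Definition induced (alpha : aut G) : aut thompsonV :=
  @Aut _ (fun v => sdr (alpha (inV Gamma v))) (fun v => sdr (ainv alpha (inV Gamma v)))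
    (@induced_K alpha) (@induced_K (aut_inv alpha)) (@induced_M alpha).

Lemma aut_decomposition (alpha : aut G) : exists zeta f phi beta,
  alpha = Faut zeta * adaut f * Aaut phi beta.
Proof.
have [phi phiE] := Rubin_V (induced alpha).
have thE v : induced alpha v = adV phi v by apply: sgval_inj.
pose alpha' := alpha * (Aaut phi 1)^-1.
have sdr_alpha' p : sdr (alpha' p) = sdr p.
  rewrite -[LHS]/(sdr (alpha ((Aaut phi 1)^-1 p))) sdr_aut_inV.
  by rewrite -[LHS]/(induced alpha (sdr ((Aaut phi 1)^-1 p))) thE sdr_Aaut_inv adVVK.
have [zeta [f E]] := decomposition sdr_alpha'.
move: (kap0 sdr_alpha') E => beta E; exists zeta, f, phi, beta.
have -> : alpha = alpha' * Aaut phi 1 by rewrite mulgVK.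
rewrite E -mulgA; congr (_ * _); apply: aut_inj => p.
by rewrite -[LHS]/(Amap 1 _ (Amap phi 1 p)) -Amap_mul mul1g mulg1.
Qed.

End InnerStructure.

(** * The action by conjugation and the map Xi *)

Section ConjugationAction.
Variable Gamma : groupType.
Local Notation Nt := (center Gamma * quo (@constZ Gamma))%type.
Local Notation Ht := (NHV * aut Gamma)%type.
Implicit Types (n : Nt) (h : Ht).

Definition AautH h : aut (fraction_group Gamma) := Aaut h.1 h.2.

Lemma AautHM : {morph AautH : h k / h * k}.
Proof. by move=> h k; apply: aut_inj => p; apply: Amap_mul. Qed.

Lemma AautH1 : AautH 1 = 1.
Proof. by apply: aut_inj => p; apply: Amap1. Qed.

Lemma conj_act_subproof h n : exists n', Jaut n' = AautH h * Jaut n * (AautH h)^-1.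
Proof.
case: n => zeta r; have [f ->] := quo_piP r; rewrite JautE.
have [xi [g ->]] := conj_Jaut h.1 h.2 zeta f.
by exists (xi, quo_pi constZ g); rewrite JautE.
Qed.

Definition conj_act h n : Nt := sval (cid (conj_act_subproof h n)).

Lemma conj_actE h n : Jaut (conj_act h n) = AautH h * Jaut n * (AautH h)^-1.
Proof. exact: svalP (cid (conj_act_subproof h n)). Qed.

Lemma conj_actM h : {morph conj_act h : n n' / n * n'}.
Proof.
move=> n n'; apply: Jaut_inj; rewrite JautM !conj_actE JautM.
by rewrite !mulgA mulgVK.
Qed.

Lemma conj_act1 n : conj_act 1 n = n.
Proof. by apply: Jaut_inj; rewrite conj_actE AautH1 invg1 mulg1 mul1g. Qed.

Lemma conj_act_mul h k n : conj_act (h * k) n = conj_act h (conj_act k n).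
Proof. by apply: Jaut_inj; rewrite !conj_actE AautHM invgM !mulgA. Qed.

Definition conj_action : gaction Ht Nt := GAction conj_actM conj_act1 conj_act_mul.

Definition Xi (p : sdprod conj_action) : aut (fraction_group Gamma) :=
  Jaut (sdl p) * AautH (sdr p).

Lemma XiM : {morph Xi : p q / p * q}.
Proof.
move=> p q; rewrite /Xi -[sdl (p * q)]/(sdl p * conj_act (sdr p) (sdl q)).
rewrite -[sdr (p * q)]/(sdr p * sdr q) JautM conj_actE AautHM.
by rewrite !mulgA mulgVK.
Qed.

Lemma XiE zeta f phi beta : Xi (SdPair (zeta, quo_pi constZ f) (phi, beta))
  = Faut zeta * adaut f * Aaut phi beta.
Proof. by rewrite /Xi JautE. Qed.

End ConjugationAction.

Theorem theoremC (Gamma : groupType) :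
  exists act : gaction (NHV * aut Gamma)%type
                       (center Gamma * quo (@constZ Gamma))%type,
    (forall (phi : NHV) (beta : aut Gamma) (zeta : center Gamma)
            (f : NK Gamma) (fphi : Kbar Gamma),
       is_translate (sgval phi) (sgval f) fphi ->
       exists2 f' : NK Gamma,
         sgval f' = Kmap beta fphi
                    * zpow (beta (sgval zeta)) (gammaphi (sgval phi))
       & act (phi, beta) (zeta, quo_pi constZ f)
         = (aut_center beta zeta ^+ kphi (sgval phi), quo_pi constZ f')) /\
    exists Xi : sdprod act -> aut (fraction_group Gamma),
      [/\ forall (zeta : center Gamma) (f : NK Gamma) (phi : NHV)
                 (beta : aut Gamma),
            Xi (SdPair (zeta, quo_pi constZ f) (phi, beta))
            =1 Fmap zeta \o admap f \o Amap phi beta,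
          {morph Xi : p q / p * q},
          (forall alpha : aut (fraction_group Gamma), exists p, Xi p = alpha)
        & [set p | Xi p = 1]
          = [set SdPair (1, quo_pi constZ (NK_const g)) (1, inner g^-1)
              | g in [set: Gamma]]].
Proof.
exists (conj_action Gamma); split.
  move=> phi beta zeta f fphi /(conj_Jaut_translate beta zeta)[h hE hconj].
  exists h => //; apply: Jaut_inj; rewrite -[LHS]/(Jaut (conj_act _ _)) conj_actE.
  by rewrite !JautE -hconj.
exists (@Xi Gamma); split.
- by move=> zeta f phi beta p; rewrite XiE.
- exact: XiM.
- move=> alpha; have [zeta [f [phi [beta ->]]]] := aut_decomposition alpha.
  by exists (SdPair (zeta, quo_pi constZ f) (phi, beta)); rewrite XiE.
apply/seteqP; split=> [[[zeta r] [phi beta]] /=|_ [g _ <-]].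
  have [f ->] := quo_piP r; rewrite XiE => /kernel_FadA[g [-> -> -> ->]].
  by exists g.
have F1 : Faut 1 = 1 :> aut (fraction_group Gamma).
  by apply: aut_inj => p; apply: Fmap1.
have gV : NK_const g^-1 = (NK_const g)^-1 by apply: sgval_inj.
have ad1 : adaut 1 = 1 :> aut (fraction_group Gamma).
  by apply: aut_inj => p; apply: admap1.
by rewrite /= XiE F1 mul1g Aaut_inner gV -adaut_mul mulgV ad1.
Qed.
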